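(* Uniformly for every convex body $C\subset\mathbb{R}^2$, and uniformly for every closed interval $I\subset\mathbb{T}_{2\pi}$, it holds (as $\rho\to+\infty$) $$\int_I\int_0^1\left|\widehat{\mathbf{1}}_{[\delta]C}(\rho\,\mathbf{u}(\theta))\right|^2 d\delta\,d\theta\asymp\rho^{-3}\left(P_C(I)+P_C(I+\pi)\right),$$ with the convention that if $P_C(I)+P_C(I+\pi)=0$, then the statement means $$\lim_{\rho\to+\infty}\rho^3\int_I\int_0^1\left|\widehat{\mathbf{1}}_{[\delta]C}(\rho\,\mathbf{u}(\theta))\right|^2 d\delta\,d\theta=0.$$
   Context: For $p>0$, $\mathbb{T}_p=\mathbb{R}/p\mathbb{Z}$; $\mathbf{u}(\theta)=(\cos\theta,\sin\theta)$. A convex body is a bounded convex subset of $\mathbb{R}^2$ with non-empty interior. Intervals of angles $I$ are assumed non-trivial: $|I|>0$. For $\delta\ge0$, $[\delta]C=\delta C$. The Fourier transform of the indicator function of a bounded measurable $\Omega\subset\mathbb{R}^2$ is $\widehat{\mathbf{1}}_\Omega(\boldsymbol{\xi})=\int_\Omega e^{-2\pi i\mathbf{x}\cdot\boldsymbol{\xi}}\,d\mathbf{x}$. Let $\boldsymbol{\Gamma}_C:\mathbb{T}_{|\partial C|}\to\mathbb{R}^2$ be the arc-length parameterization of $\partial C$ ($|\partial C|$ is the perimeter). For $s\in\mathbb{T}_{|\partial C|}$ the set of normals at $s$ is $\nu_C(s)=\{\theta\in\mathbb{T}_{2\pi}:\inf_{\mathbf{a}\in C}\mathbf{a}\cdot\mathbf{u}(\theta)=\boldsymbol{\Gamma}_C(s)\cdot\mathbf{u}(\theta)\}$.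 The portion of perimeter of $C$ with respect to an interval $I\subset\mathbb{T}_{2\pi}$ is the Lebesgue measure $$P_C(I)=\left|\{s\in\mathbb{T}_{|\partial C|}:\nu_C(s)\cap I\neq\varnothing\}\right|.$$ Asymptotics: for positive functions $f,g$ on an unbounded set $U\subseteq[0,+\infty)$, $f(x)\preccurlyeq g(x)$ means that there is $c>0$ with $\limsup_{x\to+\infty}f(x)/g(x)\le c$. When $f=f_y,g=g_y$ depend on a parameter $y$, the relation holds uniformly in $y$ if the value $c$ does not depend on $y$. $f\asymp g$ means both $f\preccurlyeq g$ and $g\preccurlyeq f$. *)

(* Defs.v *)
From mathcomp Require Import all_boot all_order all_algebra.
From mathcomp Require Import all_classical all_reals all_analysis.
From mathcomp Require Import complex.

Set Implicit Arguments.
Unset Strict Implicit.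
Unset Printing Implicit Defensive.

Import Order.TTheory GRing.Theory Num.Theory.
Import numFieldNormedType.Exports.

Local Open Scope classical_set_scope.
Local Open Scope ring_scope.

Section plane.
Context {R : realType}.
Implicit Types (C : set (R * R)) (x y : R * R).

Definition dot x y : R := x.1 * y.1 + x.2 * y.2.

(* The library norm on [R * R] is the sup norm, hence a separate definition. *)
Definition enorm x : R := Num.sqrt (dot x x).

Definition uvec (theta : R) : R * R := (cos theta, sin theta).

Definition convex_body C :=
  [/\ bounded_set C, @convex_set R (R * R)%type C & interior C !=set0].

Definition dilate (delta : R) C : set (R * R) := [set delta *: x | x in C].

Definition bdry C : set (R * R) := closure C `\` interior C.

End plane.

Section fourier.
Context {R : realType}.

Definition cis (t : R) : R[i] := Complex (cos t) (sin t).

Definition cintegral d (T : measurableType d)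
    (mu : {measure set T -> \bar R}) (D : set T) (f : T -> R[i]) : R[i] :=
  Complex (\int[mu]_(x in D) complex.Re (f x))
          (\int[mu]_(x in D) complex.Im (f x)).

(* The measure is defined on the Borel sets of the plane.  A convex set need
   not be Borel, but its boundary is null, and the library integral (a supremum
   over simple functions below the integrand cut off outside the domain) then
   agrees with the Lebesgue integral. *)
Definition fourier_indic (Omega : set (R * R)) (xi : R * R) : R[i] :=
  cintegral (@lebesgue_measure R \x @lebesgue_measure R)%E Omega
    (fun x => cis (- (2 * pi * dot x xi))).

(* A set [I] of angles modulo [2 * pi] is given by a lift to the real line,
   on which the projection is injective up to a null set. *)
Definition fourier_average (C : set (R * R)) (I : set R) (rho : R) : R :=
  \int[lebesgue_measure]_(theta in I)
    \int[lebesgue_measure]_(delta in `[0, 1])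
      (Normc.normc (fourier_indic (dilate delta C) (rho *: uvec theta))) ^+ 2.

End fourier.

Section perimeter.
Context {R : realType}.
Implicit Types (C : set (R * R)) (L : R) (gamma : R -> R * R).

(* Two-dimensional analogue of [variation] and [total_variation]. *)
Definition polygonal_length (a b : R) gamma (s : seq R) : R :=
  let F := gamma \o nth b (a :: s) in
  \sum_(0 <= n < size s) enorm (F n.+1 - F n).

Definition curve_length (a b : R) gamma : \bar R :=
  ereal_sup [set (polygonal_length a b gamma s)%:E | s in itv_partition a b].

(* [gamma] is the arc-length parameterization of the boundary of [C], seen as
   an [L]-periodic function on the real line; [L] is then the perimeter. *)
Definition arc_length_param C L gamma :=
  [/\ 0 < L,
      forall s, gamma (s + L) = gamma s,
      {in `[0, L[ &, injective gamma},
      gamma @` `[0, L[ = bdry C &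
      forall a b, a <= b -> curve_length a b gamma = (b - a)%:E].

(* Set of real lifts of the normals at [s]; it is [2 * pi]-periodic. *)
Definition normals C gamma (s : R) : set R :=
  [set theta | inf [set dot a (uvec theta) | a in C]
               = dot (gamma s) (uvec theta)].

(* The circle of length [L] is identified with [0, L[.  Since [normals] is
   periodic, [I] may be any lift of a set of angles. *)
Definition perimeter_portion C L gamma (I : set R) : R :=
  fine (lebesgue_measure
    [set s | 0 <= s < L /\ (normals C gamma s `&` I !=set0)]).

End perimeter.

Section asymptotics.
Context {R : realType}.
Implicit Types f g : R -> R.

(* The constant is explicit, so that uniformity in a parameter is expressed by
   quantifying over the constant first. *)
Definition asymp_le_with (c : R) f g :=
  (limf_esup (fun x => (f x / g x)%:E) (pinfty_nbhs R) <= c%:E)%E.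

Definition asymp_with (c : R) f g :=
  asymp_le_with c f g /\ asymp_le_with c g f.

End asymptotics.

(* Main.v *)
(* The energy only sees the closure of [C].  By Fubini, the Fourier transform in
   direction [u] is the one-dimensional transform of the chord length function,
   which is concave on its support.  Averaging over dilations, its energy at
   frequency [rho] is comparable to [rho^-2] times the sum of the squares of the
   two chords at depth [lambda = 1 / rho] below the supporting lines orthogonal
   to [u]: second differences give the upper bound, and the Fejer kernel the
   lower one.

   It remains to see that the integral over a short interval of directions of
   the squared chord is comparable to [lambda] times a portion of perimeter.
   For a boundary point [z] and a fixed direction [theta0], the depth of [z] in
   direction [theta] divided by [cos (theta - theta0)] is a quasi-convex function
   of [theta], and its increments control the abscissa of [z] relative to the
   point touched by the supporting line.  Integrating these increments over both
   the curve and the directions, the integral over the curve first gives the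
   squared chord (boundary arcs between points touched by nearly parallel
   supporting lines have length comparable to their width), whereas the integral
   over the directions first gives [lambda] for each boundary point that is
   touched.  Letting [lambda] tend to 0, only the touched points remain. *)

Require Import Defs.
From mathcomp Require Import all_boot all_order all_algebra.
From mathcomp Require Import all_classical all_reals all_analysis.
From mathcomp Require Import complex measurable_realfun ring lra.
Set Implicit Arguments.
Unset Strict Implicit.
Unset Printing Implicit Defensive.
Import Order.TTheory GRing.Theory Num.Theory.
Import numFieldNormedType.Exports.

Local Open Scope classical_set_scope.
Local Open Scope ring_scope.

(** * Integrals of bounded functions of bounded support *)

(** The constants may depend neither on [C] nor on [I]. The inradius, the diameter and the Lipschitz
    constant of the depth therefore enter only through the threshold below which [lambda] must lie,
    and the estimates carry an additive error [eta] chosen last; the same error turns the case of a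
    vanishing portion into a limit. The obstacle is that boundary points and normals do not
    determine each other: an edge has one normal for a whole segment, a corner has an interval of
    normals for one point. Instead of a change of variables between arc length and angle, increments
    over a small angular step [eps], proportional to [lambda], are used; [eps] appears in both
    orders of integration and cancels. The trigonometric factors are comparable to 1 only near a
    fixed direction, so the work is done on windows of length at most 1, and three halvings reduce
    any interval of at most a full turn to such windows. The lower bound sees only touched points
    whose weighted depth reaches [lambda] within the window; all of them but at most one do so for
    small [lambda]. *)

(* Every integrand below is bounded, measurable and of bounded support, so that
   integrability is never an issue. *)
Definition bbs {R : realType} d (T : measurableType d) (nrm : T -> R)
    (f : T -> R) :=
  measurable_fun setT f /\
  exists B : R, forall x, `|f x| <= B /\ (B < nrm x -> f x = 0).

Section bbs_closure.
Context {R : realType} d (T : measurableType d) (nrm : T -> R).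
Implicit Types f g : T -> R.
Notation bbs := (bbs nrm).

Lemma bbs_measurable f : bbs f -> measurable_fun setT f.
Proof. by case. Qed.

Lemma bbs_dominated f g K : bbs f -> measurable_fun setT g ->
  (forall x, `|g x| <= K * `|f x|) -> bbs g.
Proof.
move=> [mf [B hB]] mg gf; split=> //; exists (Num.max B (K * B)) => x.
have [K0|K0] := leP 0 K.
  split.
    rewrite (le_trans (gf x))// le_max; apply/orP; right.
    by rewrite ler_wpM2l// (hB x).1.
  rewrite gt_max => /andP[Bx _]; apply/eqP; rewrite -normr_le0.
  by rewrite (le_trans (gf x))// (hB x).2// normr0 mulr0.
have gx0 : g x = 0.
  by apply/eqP; rewrite -normr_le0 (le_trans (gf x))// mulr_le0_ge0// ltW.
rewrite gx0 normr0; split=> //.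
by rewrite le_max (le_trans _ (hB x).1).
Qed.

Lemma bbsD f g : bbs f -> bbs g -> bbs (fun x => f x + g x).
Proof.
move=> [mf [B hB]] [mg [B' hB']]; split; first exact: measurable_realfun.measurable_funD.
have B0 : forall x : T, 0 <= B by move=> x; rewrite (le_trans _ (hB x).1).
have B0' : forall x : T, 0 <= B' by move=> x; rewrite (le_trans _ (hB' x).1).
exists (B + B') => x; split.
  by rewrite (le_trans (ler_normD _ _))// lerD ?(hB x).1 ?(hB' x).1.
move=> BB; rewrite (hB x).2 ?(hB' x).2 ?addr0//.
  by rewrite (le_lt_trans _ BB)// lerDr (B0 x).
by rewrite (le_lt_trans _ BB)// lerDl (B0' x).
Qed.

Lemma bbsM f g K : bbs f -> measurable_fun setT g ->
  (forall x, `|g x| <= K) -> bbs (fun x => f x * g x).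
Proof.
move=> bf mg gK; apply: (@bbs_dominated f _ K) => //.
  exact: measurable_funM (bbs_measurable bf) mg.
by move=> x; rewrite normrM mulrC ler_wpM2r.
Qed.

Lemma bbsMl f g K : bbs f -> measurable_fun setT g ->
  (forall x, `|g x| <= K) -> bbs (fun x => g x * f x).
Proof.
move=> bf mg gK; under eq_fun do rewrite mulrC.
exact: (bbsM bf mg gK).
Qed.

Lemma bbsZ f k : bbs f -> bbs (fun x => k * f x).
Proof. by move=> bf; apply: (@bbsMl _ (cst k) `|k|) => // x. Qed.

Lemma bbsN f : bbs f -> bbs (fun x => - f x).
Proof. by move/(bbsZ (-1)); under eq_fun do rewrite mulN1r. Qed.

Lemma bbsB f g : bbs f -> bbs g -> bbs (fun x => f x - g x).
Proof. by move=> bf bg; apply: bbsD => //; exact: bbsN. Qed.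

Lemma bbs_norm f : bbs f -> bbs (fun x => `|f x|).
Proof.
move=> bf; apply: (@bbs_dominated f _ 1) => //.
  by apply: measurableT_comp => //; exact: bbs_measurable bf.
by move=> x; rewrite normr_id mul1r.
Qed.

Lemma bbs_indic (A : set T) M : measurable A -> (forall x, A x -> nrm x <= M) ->
  bbs (\1_A).
Proof.
move=> mA hA; split; first exact: measurable_indic.
exists (Num.max M 1) => x; rewrite indicE; split.
  by case: (_ \in _); rewrite ?normr1 ?normr0 le_max ?lexx ?ler01 ?orbT.
rewrite gt_max => /andP[Mx _]; case: (asboolP (A x)) => Ax.
  by have := lt_le_trans Mx (hA x Ax); rewrite ltxx.
by rewrite memNset.
Qed.

End bbs_closure.

Section real_integral.
Context {R : realType} d (T : measurableType d).
Variable mu : {measure set T -> \bar R}.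
Variable nrm : T -> R.
Hypothesis nrm_fin :
  forall B : R, measurable [set x | nrm x <= B] /\ (mu [set x | (nrm x <= B)%R] < +oo)%E.
Implicit Types f g : T -> R.
Notation bbs := (bbs nrm).

Lemma bbs_integrable f : bbs f -> mu.-integrable setT (EFin \o f).
Proof.
move=> [mf [B hB]]; have [mA Afin] := nrm_fin B.
have -> : EFin \o f = EFin \o f \_ [set x | nrm x <= B].
  apply/funext => x /=; rewrite patchE; case: ifPn => // /negP xB.
  rewrite (hB x).2//; have [h|//] := leP (nrm x) B.
  by exfalso; apply: xB; rewrite inE.
rewrite -restrict_EFin -integrable_mkcond//.
apply: measurable_bounded_integrable => //; first exact: measurable_funS mf.
exists B; split; first exact: num_real.
by move=> M BM x _ /=; rewrite (le_trans (hB x).1)// ltW.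
Qed.

Lemma RintD f g : bbs f -> bbs g ->
  \int[mu]_x (f x + g x) = \int[mu]_x f x + \int[mu]_x g x.
Proof. by move=> bf bg; rewrite RintegralD//; exact: bbs_integrable. Qed.

Lemma RintB f g : bbs f -> bbs g ->
  \int[mu]_x (f x - g x) = \int[mu]_x f x - \int[mu]_x g x.
Proof. by move=> bf bg; rewrite RintegralB//; exact: bbs_integrable. Qed.

Lemma RintZ f k : bbs f -> \int[mu]_x (k * f x) = k * \int[mu]_x f x.
Proof. by move=> bf; rewrite RintegralZl//; exact: bbs_integrable. Qed.

Lemma RintN f : bbs f -> \int[mu]_x (- f x) = - \int[mu]_x f x.
Proof.
by move=> bf; under eq_Rintegral do rewrite -mulN1r; rewrite RintZ// mulN1r.
Qed.

Lemma le_Rint f g : bbs f -> bbs g -> (forall x, f x <= g x) ->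
  \int[mu]_x f x <= \int[mu]_x g x.
Proof. by move=> bf bg fg; apply: le_Rintegral => //; exact: bbs_integrable. Qed.

Lemma le_norm_Rint f : bbs f -> `|\int[mu]_x f x| <= \int[mu]_x `|f x|.
Proof. by move=> bf; apply: le_normr_Rintegral => //; exact: bbs_integrable. Qed.

Lemma Rint_indic (A : set T) : measurable A -> \int[mu]_x \1_A x = fine (mu A).
Proof. by move=> mA; rewrite /Rintegral integral_indic// setIT. Qed.

Lemma Rintegral_indic f (A : set T) :
  \int[mu]_(x in A) f x = \int[mu]_x (\1_A x * f x).
Proof.
rewrite Rintegral_mkcond; apply: eq_Rintegral => x _.
by rewrite patchE indicE; case: ifPn => _; rewrite ?mul1r ?mul0r.
Qed.

End real_integral.

Definition norm1 {R : realType} (x : measurableTypeR R) : R := `|x|.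

Definition norm2 {R : realType} (z : measurableTypeR R * measurableTypeR R) : R :=
  Num.max `|z.1| `|z.2|.

Notation bbsR := (bbs norm1).
Notation bbs2 := (bbs norm2).

(** * Affine substitution on the line *)

Section lebesgue_line.
Context {R : realType}.
Notation mu := (@lebesgue_measure R).
Implicit Types (f g : R -> R).

Lemma measurable_affine (k s : R) : measurable_fun setT (fun x : R => k * x + s).
Proof. exact: measurable_realfun.measurable_funD. Qed.

Let affine (k s : R) : measurableTypeR R -> measurableTypeR R :=
  fun x => k * x + s.

Let maffine k s : measurable_fun setT (affine k s).
Proof. exact: measurable_affine. Qed.

Let affine_image k s : {measure set (measurableTypeR R) -> \bar R} :=
  measure_function_pushforward__canonical__measure_function_Measure mu
    (maffine k s).

(** By uniqueness of Lebesgue measure it is enough to compare half-open intervals. A negative [k]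
    turns []a, b]] into an interval closed on the left, of the same length. *)
Lemma affine_lebesgue (k s : R) (A : set R) : k != 0 -> measurable A ->
  mu A = (`|k|%:E * mu ((fun x => k * x + s)%R @^-1` A))%E.
Proof.
move=> k0 mA.
rewrite [RHS](_ : _ = mscale (NngNum (normr_ge0 k)) (affine_image k s) A)//.
apply: lebesgue_measure_unique => //= _ [[a b]] _ <-.
rewrite -[RHS]/(`|k|%:E * mu ((fun x => k * x + s)%R @^-1` `]a, b]))%E.
have [k_gt0|k_lt0|/eqP] := ltgtP 0 k; last by rewrite eq_sym (negbTE k0).
- rewrite (_ : _ @^-1` _ = `](a - s) / k, (b - s) / k]%classic); last first.
    apply/seteqP; split => x /=; rewrite !in_itv/= ltr_pdivrMr// ler_pdivlMr//.
      by rewrite (mulrC x) ltrBlDr lerBrDr.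
    by rewrite (mulrC x) ltrBlDr lerBrDr.
  rewrite !lebesgue_measure_itv/= !lte_fin ltr_pM2r ?invr_gt0// ltrD2r.
  case: ifP => ab; last by rewrite mule0.
  rewrite -!EFinB -EFinM gtr0_norm//; congr (_%:E); field.
  by rewrite gt_eqF.
- rewrite (_ : _ @^-1` _ = `[(b - s) / k, (a - s) / k[%classic); last first.
    apply/seteqP; split => x /=; rewrite !in_itv/= ltr_ndivlMr// ler_ndivrMr//.
      by rewrite (mulrC x) ltrBlDr lerBrDr andbC.
    by rewrite (mulrC x) ltrBlDr lerBrDr andbC.
  rewrite !lebesgue_measure_itv/= !lte_fin ltr_nM2r ?invr_lt0// ltrD2r.
  case: ifP => ab; last by rewrite mule0.
  rewrite -!EFinB -EFinM ltr0_norm//; congr (_%:E); field.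
  by rewrite lt_eqF.
Qed.

Lemma ge0_Rint_affine f (k s : R) : k != 0 -> measurable_fun setT f ->
  (forall x, 0 <= f x) ->
  \int[mu]_x f x = `|k| * \int[mu]_x f (k * x + s).
Proof.
move=> k0 mf f0.
have key : (\int[mu]_x (f x)%:E = `|k|%:E * \int[mu]_x (f (k * x + s)%R)%:E)%E.
  have mg : measurable_fun setT (EFin \o f) by exact/measurable_EFinP.
  have := @ge0_integral_pushforward _ _ (measurableTypeR R) (measurableTypeR R)
    R _ (maffine k s) mu setT (EFin \o f) measurableT mg
    (fun x _ => f0 x).
  rewrite preimage_setT => <-.
  rewrite -(ge0_integral_mscale (affine_image k s) measurableT
    (NngNum (normr_ge0 k)))//.
    by apply: eq_measure_integral => A mA _; exact: affine_lebesgue.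
  by move=> x _; rewrite lee_fin.
(* The integral may be infinite; [fine] then gives 0 on both sides, as [|k| > 0]. *)
rewrite /Rintegral key.
case: (\int[mu]_x (f (k * x + s)%R)%:E)%E => //=.
  by rewrite gt0_muley ?lte_fin ?normr_gt0//= mulr0.
by rewrite gt0_muleNy ?lte_fin ?normr_gt0//= mulr0.
Qed.

Lemma norm1_fin (B : R) : measurable [set x : measurableTypeR R | norm1 x <= B] /\
  (mu [set x | (norm1 x <= B)%R] < +oo)%E.
Proof.
have -> : [set x : measurableTypeR R | norm1 x <= B] = `[- B, B]%classic.
  by apply/seteqP; split => x /=; rewrite in_itv/= ler_norml.
split; first exact: measurable_itv.
by rewrite lebesgue_measure_itv/=; case: ifP; rewrite ltry.
Qed.

Lemma bbs_affine f (k s : R) : k != 0 -> bbsR f -> bbsR (fun x => f (k * x + s)).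
Proof.
move=> k0 [mf [B hB]]; split.
  by apply: measurableT_comp => //; exact: measurable_affine.
exists (Num.max B ((B + `|s|) / `|k|)) => x; split.
  by rewrite le_max (hB _).1.
rewrite /norm1 gt_max => /andP[_]; rewrite ltr_pdivrMr ?normr_gt0// => h.
apply: (hB _).2; rewrite -(ltrD2r `|s|) (lt_le_trans h)//.
have := ler_normB (k * x + s) s; rewrite addrK normrM mulrC; exact.
Qed.

(** Both terms of [|f| - (|f| - f)] are non-negative, which reduces the signed case to
    [ge0_Rint_affine]. *)
Lemma Rint_affine f (k s : R) : k != 0 -> bbsR f ->
  \int[mu]_x f x = `|k| * \int[mu]_x f (k * x + s).
Proof.
move=> k0 bf; have bn := bbs_norm bf.
have mf := bbs_measurable bf.
have b2 : bbsR (fun x => `|f x| - f x) by apply: bbsB.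
have -> : \int[mu]_x f x = \int[mu]_x `|f x| - \int[mu]_x (`|f x| - f x).
  rewrite -(RintB norm1_fin)//.
  by apply: eq_Rintegral => x _; rewrite subKr.
rewrite (ge0_Rint_affine s k0 (bbs_measurable bn))//.
rewrite (ge0_Rint_affine s k0 (bbs_measurable b2)); last first.
  by move=> x; rewrite subr_ge0 ler_norm.
rewrite -mulrBr -(RintB norm1_fin).
- by congr (_ * _); apply: eq_Rintegral => x _; rewrite subKr.
- exact: (bbs_affine s k0 bn).
- exact: (bbs_affine s k0 b2).
Qed.

Lemma Rint_shift f (s : R) : bbsR f -> \int[mu]_x f (x + s) = \int[mu]_x f x.
Proof.
move=> bf; rewrite (Rint_affine s (oner_neq0 R) bf) normr1 mul1r.
by apply: eq_Rintegral => x _; rewrite mul1r.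
Qed.

Lemma bbs_shift f (s : R) : bbsR f -> bbsR (fun x => f (x + s)).
Proof.
move=> /(bbs_affine s (oner_neq0 R)); congr bbs.
by apply/funext => x; rewrite mul1r.
Qed.

Lemma bbs_itv (i : interval R) (M : R) : (forall x, x \in i -> `|x| <= M) ->
  bbsR (\1_[set` i]).
Proof. by move=> iM; apply: (bbs_indic (M := M)) => //; exact: measurable_itv. Qed.

Lemma bbs_segment (a b : R) : bbsR (\1_(`[a, b]%classic)).
Proof.
apply: (@bbs_itv _ (`|a| + `|b|)) => x; rewrite in_itv/= ler_norml => /andP[ax xb].
have := ler_norm (- a); have := ler_norm b; rewrite normrN.
have := normr_ge0 a; have := normr_ge0 b; lra.
Qed.

Lemma Rint_segment (a b : R) : a <= b -> \int[mu]_x \1_(`[a, b]%classic) x = b - a.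
Proof.
move=> ab; rewrite Rint_indic; last exact: measurable_itv.
have := lebesgue_measure_itv `[a, b]; rewrite /= lte_fin => ->.
case: ltP => //= ba.
by apply/esym/eqP; rewrite subr_eq0 eq_le ab ba.
Qed.

Lemma segE (a b x : R) : \1_(`[a, b]%classic) x = ((a <= x) && (x <= b))%R%:R :> R.
Proof. by rewrite indicE; congr (nat_of_bool _)%:R; rewrite mem_setE in_itv. Qed.

Lemma Rint_le_segment f (a b M : R) : bbsR f -> a <= b ->
  (forall x, f x <= M * \1_(`[a, b]%classic) x) ->
  \int[mu]_x f x <= M * (b - a).
Proof.
move=> bf ab fM; rewrite -Rint_segment// -(RintZ norm1_fin); last exact: bbs_segment.
by apply: (le_Rint norm1_fin) => //; apply: bbsZ; exact: bbs_segment.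
Qed.

Lemma Rint0_eq f : (forall x, f x = 0) -> \int[mu]_x f x = 0.
Proof. by move=> f0; rewrite /Rintegral integral0_eq// => x _; rewrite f0. Qed.

End lebesgue_line.

(** * Fubini on the plane *)

Section lebesgue_plane.
Context {R : realType}.
Notation mu := (@lebesgue_measure R).
Notation mu2 := ((@lebesgue_measure R) \x (@lebesgue_measure R))%E.
Implicit Type f : R * R -> R.

Lemma norm2_fin (B : R) : measurable [set z | norm2 z <= B] /\
  (mu2 [set z | (norm2 z <= B)%R] < +oo)%E.
Proof.
have -> : [set z | norm2 z <= B] =
    [set x : measurableTypeR R | norm1 x <= B] `*` [set x | norm1 x <= B].
  by apply/seteqP; split => -[x y] /=; rewrite ge_max => /andP.
have [mB fB] := norm1_fin B; split; first exact: measurableX.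
by rewrite product_measure1E//; apply: lte_mul_pinfty => //; rewrite ge0_fin_numE.
Qed.

Lemma bbs2_integrable f : bbs2 f -> mu2.-integrable setT (EFin \o f).
Proof. exact: (bbs_integrable norm2_fin). Qed.

Lemma bbs2_slice1 f x : bbs2 f -> bbsR (fun y => f (x, y)).
Proof.
move=> [mf [B hB]]; split; first exact: measurableT_comp.
exists B => y; split; first exact: (hB _).1.
by move=> By; apply: (hB _).2; rewrite lt_max By orbT.
Qed.

Lemma bbs2_slice2 f y : bbs2 f -> bbsR (fun x => f (x, y)).
Proof.
move=> [mf [B hB]]; split; first exact: measurableT_comp.
exists B => x; split; first exact: (hB _).1.
by move=> Bx; apply: (hB _).2; rewrite lt_max Bx.
Qed.

Lemma Rint_prod1 f : bbs2 f ->
  \int[mu2]_z f z = \int[mu]_x \int[mu]_y f (x, y).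
Proof.
move=> bf; rewrite /Rintegral -integral12_prod_meas1 ?bbs2_integrable//.
congr fine; apply: eq_integral => x _; rewrite /fubini_F /= fineK//.
exact: integrable_fin_num (bbs_integrable norm1_fin (bbs2_slice1 x bf)).
Qed.

Lemma Rint_prod2 f : bbs2 f ->
  \int[mu2]_z f z = \int[mu]_y \int[mu]_x f (x, y).
Proof.
move=> bf; rewrite /Rintegral -integral21_prod_meas1 ?bbs2_integrable//.
congr fine; apply: eq_integral => x _; rewrite /fubini_G /= fineK//.
exact: integrable_fin_num (bbs_integrable norm1_fin (bbs2_slice2 x bf)).
Qed.

Lemma Rint_swap f : bbs2 f ->
  \int[mu]_x \int[mu]_y f (x, y) = \int[mu]_y \int[mu]_x f (x, y).
Proof. by move=> bf; rewrite -Rint_prod1// Rint_prod2. Qed.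

Lemma bbs2_fubini1 f : bbs2 f -> bbsR (fun x => \int[mu]_y f (x, y)).
Proof.
move=> bf; have [mf [B hB]] := bf; split.
  have mF := measurable_fubini_F (bbs2_integrable bf).
  have -> : (fun x => \int[mu]_y f (x, y)) = fine \o fubini_F mu (EFin \o f).
    by [].
  exact: measurableT_comp (fine_measurable _) mF.
have B0 : 0 <= B by rewrite (le_trans _ (hB (0, 0)).1).
exists (Num.max B (B * (B + B))) => x; split; last first.
  rewrite gt_max => /andP[Bx _]; apply: Rint0_eq => y.
  by apply: (hB _).2; rewrite lt_max Bx.
(* A slice is bounded by [B] and lives on a segment of length [2 * B]. *)
rewrite le_max; apply/orP; right.
have bs := bbs2_slice1 x bf.
rewrite (le_trans (le_norm_Rint norm1_fin bs))// -[X in _ * (X + _)]opprK [X in _ * X]addrC.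
apply: Rint_le_segment => [||y]; [exact: bbs_norm|lra|].
rewrite segE -ler_norml; case: (leP `|y| B) => yB; first by rewrite mulr1 (hB _).1.
by rewrite mulr0 (hB _).2 ?normr0// lt_max; apply/orP; right.
Qed.

Lemma bbs2_swap f : bbs2 f -> bbs2 (fun z => f (z.2, z.1)).
Proof.
move=> [mf [B hB]]; split; first by apply: (measurableT_comp mf); exact: measurable_fun_pair.
by exists B => z; rewrite /norm2 maxC; exact: (hB (z.2, z.1)).
Qed.

Lemma bbs2_fubini2 f : bbs2 f -> bbsR (fun y => \int[mu]_x f (x, y)).
Proof. by move/bbs2_swap/bbs2_fubini1. Qed.

(** The shape of the oscillatory and of the angular integrands below: a bounded kernel cut off in
    each variable. *)
Lemma bbs2_tensor (f g : R -> R) (k : R * R -> R) (K : R) : bbsR f -> bbsR g ->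
  measurable_fun setT (k : measurableTypeR R * measurableTypeR R -> R) ->
  (forall z, `|k z| <= K) -> bbs2 (fun z => f z.1 * (g z.2 * k z)).
Proof.
move=> [mf [B hB]] [mg [C hC]] mk kK.
have K0 : 0 <= K by rewrite (le_trans _ (kK (0, 0))).
have B0 : 0 <= B by rewrite (le_trans _ (hB 0).1).
have C0 : 0 <= C by rewrite (le_trans _ (hC 0).1).
split.
  by apply: measurable_funM; [|apply: measurable_funM => //]; exact: measurableT_comp.
exists (Num.max (B * (C * K)) (Num.max B C)) => -[x y]; rewrite /norm2 /=; split.
  rewrite le_max; apply/orP; left; rewrite !normrM.
  by rewrite ler_pM ?mulr_ge0// ?(hB x).1// ler_pM// (hC y).1.
rewrite lt_max !gt_max => /orP[/and3P[_ xB _]|/and3P[_ _ yC]].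
  by rewrite (hB x).2// mul0r.
by rewrite (hC y).2// mul0r mulr0.
Qed.

End lebesgue_plane.

(** * Lipschitz functions and elementary trigonometric bounds *)

Section lipschitz.
Context {R : realType}.

Lemma lipschitz_fun_continuous (f : R -> R) (K : R) :
  (forall x y, `|f x - f y| <= K * `|x - y|) -> continuous f.
Proof.
move=> fK x; apply/cvgrPdist_le => e e0.
have K1 : 0 < `|K| + 1 by rewrite ltr_wpDl.
exists (e / (`|K| + 1)); first by rewrite /= divr_gt0.
move=> y /= xy; rewrite (le_trans (fK x y))//.
have := ltW xy; rewrite ler_pdivlMr// => h; rewrite (le_trans _ h)// mulrC ler_wpM2l//.
by rewrite (le_trans (ler_norm _))// lerDl.
Qed.

Lemma lipschitz_derive (f df : R -> R) : (forall x : R, is_derive x (1 : R) f (df x)) ->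
  (forall x, `|df x| <= 1) -> forall x y, `|f x - f y| <= `|x - y|.
Proof.
move=> dF d1 x y; wlog yx : x y / y <= x.
  by move=> H; have [/H//|/ltW/H] := leP y x; rewrite distrC [leRHS]distrC.
have cf : continuous f.
  move=> z; apply: differentiable_continuous; apply/derivable1_diffP.
  exact: (@ex_derive _ _ _ _ _ _ _ (dF z)).
have [c _ ->] := MVT_segment yx (fun z _ => dF z) (continuous_subspaceT cf).
by rewrite normrM ler_piMl.
Qed.

Lemma cos_lipschitz (x y : R) : `|cos x - cos y| <= `|x - y|.
Proof.
apply: (lipschitz_derive (df := fun z => - sin z)) => z.
by rewrite normrN sin_max.
Qed.

Lemma sin_lipschitz (x y : R) : `|sin x - sin y| <= `|x - y|.
Proof. by apply: (lipschitz_derive (df := cos)) => z; exact: cos_max. Qed.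

Lemma cosB1_le (x : R) : 1 - cos x <= x ^+ 2 / 2.
Proof.
have := sin_lipschitz (x / 2) 0; rewrite sin0 !subr0 => h.
have : sin (x / 2) ^+ 2 <= (x / 2) ^+ 2.
  by rewrite -[leLHS]real_normK ?num_real// -[leRHS]real_normK ?num_real// ler_sqr ?nnegrE.
have -> : cos x = cos ((x / 2) *+ 2) by rewrite -mulr_natr mulfVK ?pnatr_eq0.
by rewrite cos_mulr2n -mulr_natl cos2sin2; lra.
Qed.

End lipschitz.

(** * Fourier energy of a concave profile *)

Section profile.
Context {R : realType}.
Notation mu := (@lebesgue_measure R).
Implicit Types (h e : R -> R) (W : R).

(** Concavity is required on [[0, W]] only, in a form without division: [h] may jump at both ends,
    as a chord function does where the body ends in an edge. *)
Definition concave_profile W h := [/\ bbsR h, forall x, 0 <= h x,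
  forall x, ~~ ((0 <= x) && (x <= W)) -> h x = 0 &
  forall x y z, 0 <= x -> x <= y -> y <= z -> z <= W ->
    h x * (z - y) + h z * (y - x) <= h y * (z - x)].

Lemma concave_profile_refl W h : concave_profile W h ->
  concave_profile W (fun x => h (W - x)).
Proof.
move=> [bh h0 hout hc]; split=> //.
- have := bbs_affine W (k := -1) _ bh; rewrite oppr_eq0 oner_eq0 => /(_ isT).
  by congr bbs; apply/funext => x; rewrite mulN1r addrC.
- by move=> x xW; apply: hout; apply: contra xW; lra.
- move=> x y z x0 xy yz zW.
  by have := hc (W - z) (W - y) (W - x); nra.
Qed.

(** Since [h 0] is non-negative, concavity makes the ratio [h x / x] non-increasing. *)
Lemma profile_ray W h x y : concave_profile W h -> 0 <= x -> x <= y -> y <= W ->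
  x * h y <= y * h x.
Proof.
move=> [_ h0 _ hc] x0 xy yW; have := hc 0 x y (lexx _) x0 xy yW.
have := h0 0; have : 0 <= h 0 * (y - x) by rewrite mulr_ge0// subr_ge0.
lra.
Qed.

Lemma profile_rayr W h x y : concave_profile W h -> 0 <= x -> x <= y -> y <= W ->
  (W - y) * h x <= (W - x) * h y.
Proof.
move=> hW x0 xy yW.
have := profile_ray (x := W - y) (y := W - x) (concave_profile_refl hW).
by rewrite !subKr; apply; lra.
Qed.

(** To the right of [x] the ratio of [h] to the distance from 0 does not increase. To the left the
    same holds for the distance from [W], and [W - y <= 2 * (W - x)] because [x <= W / 2]. *)
Lemma profile_le W h x y : concave_profile W h -> 0 <= x -> x <= W / 2 ->
  y <= 2 * x -> h y <= 2 * h x.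
Proof.
move=> hW x0 xW yx; have [_ h0 hout hc] := hW.
have [y0|y0] := ltP y 0; first by rewrite hout ?mulr_ge0// negb_and -ltNge y0.
have [xy|yx'] := leP x y.
  have [x00|x1] := ltP 0 x; last first.
    have -> : y = x by lra.
    by have := h0 x; lra.
  have := profile_ray hW x0 xy (ltac:(lra) : y <= W); have := h0 x => hx hh.
  rewrite -(ler_pM2l x00) (le_trans hh)//.
  by rewrite mulrA (mulrC x) ler_wpM2r.
have := profile_rayr hW y0 (ltW yx') (ltac:(lra) : x <= W) => hh.
have Wx : 0 < W - x by lra.
rewrite -(ler_pM2l Wx) (le_trans hh)// mulrA ler_wpM2r//; lra.
Qed.

(** * Upper bound for the energy of a profile *)

Lemma norm_le_pospart (D p : R) : D <= p -> 0 <= p -> `|D| <= 2 * p - D.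
Proof. by move=> Dp p0; rewrite ler_norml; apply/andP; split; lra. Qed.

Definition second_diff s h x := h (x + s) + h (x - s) - 2 * h x.

(** In the middle both neighbours of [x] are in [[0, W]] and concavity gives a non-positive value.
    Within [s] of an end one neighbour leaves the support, and [profile_le] bounds the other by
    twice the value at distance [s] from that end. *)
Lemma second_diff_le W h s x : concave_profile W h -> 0 < s -> s <= W / 2 ->
  second_diff s h x <=
  2 * h s * \1_(`[- s, s]%classic) x + 2 * h (W - s) * \1_(`[W - s, W + s]%classic) x.
Proof.
move=> hW s0 sW; have [bh h0 hout hc] := hW; rewrite /second_diff.
have out y : y < 0 \/ W < y -> h y = 0.
  by move=> yW; apply: hout; rewrite negb_and -!ltNge; apply/orP.
set A := 2 * h s * _; have A0 : 0 <= A by rewrite !mulr_ge0// indicE.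
set B := 2 * h (W - s) * _; have B0 : 0 <= B by rewrite !mulr_ge0// indicE.
apply: (@le_trans _ _ (h (x + s) + h (x - s) - 2 * h x)) => //.
have [xs|sx] := ltP x s.
  rewrite (out (x - s)) ?addr0; last by left; rewrite subr_lt0.
  have [x1|x1] := leP (- s) x; last first.
    rewrite out; last by left; rewrite -ltrBrDr sub0r.
    by rewrite sub0r (le_trans _ (addr_ge0 A0 B0))// oppr_le0 mulr_ge0.
  have -> : A = 2 * h s by rewrite /A segE x1 ltW// mulr1.
  rewrite (@le_trans _ _ (h (x + s)))// ?gerBl ?mulr_ge0//.
  rewrite (@le_trans _ _ (2 * h s)) ?lerDl//.
  by apply: (profile_le hW); [exact: ltW|done|rewrite mulr_natl mulr2n lerD2r ltW].
have [xW|xW] := ltP (W - s) x.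
  rewrite (out (x + s)) ?add0r; last by right; rewrite -ltrBlDr.
  have [x1|x1] := leP x (W + s); last first.
    rewrite out; last by right; rewrite ltrBrDr.
    by rewrite sub0r (le_trans _ (addr_ge0 A0 B0))// oppr_le0 mulr_ge0.
  have -> : B = 2 * h (W - s) by rewrite /B segE x1 ltW// mulr1.
  rewrite (@le_trans _ _ (h (x - s)))// ?gerBl ?mulr_ge0//.
  rewrite (@le_trans _ _ (2 * h (W - s))) ?lerDr//.
  have := profile_le (x := s) (y := W - (x - s)) (concave_profile_refl hW).
  rewrite subKr; apply; [exact: ltW|done|].
  by move: xW; clear; lra.
rewrite (le_trans _ (addr_ge0 A0 B0))//.
have := hc (x - s) x (x + s).
rewrite (_ : x + s - x = s) 1?(_ : x - (x - s) = s); [|ring|ring].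
rewrite (_ : x + s - (x - s) = 2 * s); last ring.
rewrite subr_ge0 gerBl lerDl -lerBrDr => /(_ sx (ltW s0) (ltW s0) xW) hh.
rewrite -(pmulr_rle0 _ s0) (_ : s * _ = h (x - s) * s + h (x + s) * s - h x * (2 * s)).
  by rewrite subr_le0.
by ring.
Qed.

(* Shifting by the half-period [s] of [e] turns [4 h] into minus the second
   difference of [h], whose integral is zero and which is positive only near
   the end points by concavity. *)
Lemma oscillatory_le W h e s : concave_profile W h -> 0 < s -> s <= W / 2 ->
  measurable_fun setT e -> (forall x, `|e x| <= 1) ->
  (forall x, e (x + s) = - e x) ->
  `|\int[mu]_x (h x * e x)| <= 2 * s * (h s + h (W - s)).
Proof.
move=> hW s0 sW me e1 es; have [bh h0 hout hc] := hW.
have esN x : e (x - s) = - e x by rewrite -{2}[x](subrK s) es opprK.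
have bhp := bbs_shift s bh; have bhm := bbs_shift (- s) bh.
have bhe := bbsM bh me e1; have bhpe := bbsM bhp me e1; have bhme := bbsM bhm me e1.
have bD : bbsR (second_diff s h).
  by apply: bbsB; [exact: bbsD|exact: bbsZ].
have bDe : bbsR (fun x => second_diff s h x * e x) by exact: (bbsM bD me e1).
set F := \int[mu]_x _.
have Fp : \int[mu]_x (h (x + s) * e x) = - F.
  rewrite -(Rint_shift (- s) bhpe) -(RintN norm1_fin bhe).
  by apply: eq_Rintegral => x _; rewrite subrK esN mulrN.
have Fm : \int[mu]_x (h (x - s) * e x) = - F.
  rewrite -(Rint_shift s bhme) -(RintN norm1_fin bhe).
  by apply: eq_Rintegral => x _; rewrite addrK es mulrN.
have F4 : \int[mu]_x (second_diff s h x * e x) = - (4 * F).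
  transitivity (\int[mu]_x (h (x + s) * e x + h (x - s) * e x - 2 * (h x * e x))).
    by apply: eq_Rintegral => x _; rewrite /second_diff; ring.
  rewrite (RintB norm1_fin) ?(RintD norm1_fin)//.
  - by rewrite (RintZ norm1_fin)// Fp Fm -/F; ring.
  - exact: bbsD.
  - exact: bbsZ.
have D0 : \int[mu]_x second_diff s h x = 0.
  rewrite (RintB norm1_fin) ?(RintD norm1_fin)//; last 2 first.
  - exact: bbsD.
  - exact: bbsZ.
  by rewrite (RintZ norm1_fin)// !Rint_shift//; ring.
pose P x := 2 * h s * \1_(`[- s, s]%classic) x
            + 2 * h (W - s) * \1_(`[W - s, W + s]%classic) x.
have bP1 : bbsR (fun x => 2 * h s * \1_(`[- s, s]%classic) x).
  by apply: bbsZ; exact: bbs_segment.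
have bP2 : bbsR (fun x => 2 * h (W - s) * \1_(`[W - s, W + s]%classic) x).
  by apply: bbsZ; exact: bbs_segment.
have bP : bbsR P by exact: bbsD.
have P0 x : 0 <= P x.
  by rewrite addr_ge0// !mulr_ge0// indicE.
(* The absolute value is [2 * D^+ - D] for the second difference [D]; as [D] has integral 0, only
   the majorant [P] of [D^+] contributes. *)
have absD x : `|second_diff s h x * e x| <= 2 * P x - second_diff s h x.
  rewrite normrM; have DP : second_diff s h x <= P x := second_diff_le x hW s0 sW.
  have Px := P0 x.
  apply: (@le_trans _ _ `|second_diff s h x|); first by rewrite ler_piMr.
  exact: norm_le_pospart.
have : `|4 * F| <= 2 * \int[mu]_x P x.
  rewrite -normrN -F4 (le_trans (le_norm_Rint norm1_fin bDe))//.
  rewrite -(RintZ norm1_fin 2 bP) -[leRHS]subr0 -D0 -(RintB norm1_fin)//; last exact: bbsZ.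
  apply: (le_Rint norm1_fin) => //; first exact: bbs_norm.
  by apply: bbsB => //; exact: bbsZ.
rewrite /P (RintD norm1_fin)// !(RintZ norm1_fin); [|exact: bbs_segment..].
rewrite !Rint_segment; [|lra..].
rewrite normrM ger0_norm//; lra.
Qed.

Definition cos_transform h (r : R) := \int[mu]_x (h x * cos (2 * pi * r * x)).
Definition sin_transform h (r : R) := \int[mu]_x (h x * sin (2 * pi * r * x)).

Lemma measurable_cos_affine (k s : R) : measurable_fun setT (fun x => cos (k * x + s)).
Proof.
apply: measurableT_comp (measurable_affine k s).
by apply: continuous_measurable_fun; exact: continuous_cos.
Qed.

Lemma measurable_cos_shift (k : R) : measurable_fun setT (fun x : R => cos (k * (x + 1))).
Proof.
have := measurable_cos_affine k k; congr measurable_fun.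
by apply/funext => t; rewrite mulrDr mulr1.
Qed.

Lemma measurable_sin_affine (k s : R) : measurable_fun setT (fun x => sin (k * x + s)).
Proof.
apply: measurableT_comp (measurable_affine k s).
by apply: continuous_measurable_fun; exact: continuous_sin.
Qed.

Lemma profile_max W h x : concave_profile W h -> 2 <= W -> h x <= W * h 1.
Proof.
move=> hW W2; have [_ h0 hout _] := hW; have h1 := h0 1.
have [x1|x1] := leP x 2.
  rewrite (le_trans (profile_le (x := 1) hW _ _ _)) ?ler_wpM2r//; lra.
have [xW|xW] := leP x W; last first.
  by rewrite hout ?mulr_ge0//; [lra|rewrite negb_and -!ltNge xW orbT].
have := profile_ray hW ler01 (ltac:(lra) : 1 <= x) xW; rewrite mul1r.
by move=> hh; rewrite (le_trans hh)// ler_wpM2r.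
Qed.

Lemma Rint_profile_le W h : concave_profile W h -> 2 <= W ->
  \int[mu]_x h x <= W * h 1 * W.
Proof.
move=> hW W2; have [bh h0 hout _] := hW.
rewrite -[X in _ * X]subr0; apply: Rint_le_segment => //; first lra.
move=> x; rewrite segE; case: (boolP (_ && _)) => xW; last by rewrite hout// mulr0.
by rewrite mulr1; exact: profile_max.
Qed.

(** The half-period is [1 / (2 * d)]. If it is at most [W / 2], [oscillatory_le] applies, and the
    values at distance [s] from the ends are compared with those at distance 1 at the cost of a
    factor [2 / d]. Otherwise [d * W < 1]: the profile is shorter than a period and the integral of
    [h] is a sufficient bound. *)
Lemma weighted_oscillatory_le W h e d : concave_profile W h -> 2 <= W ->
  0 < d -> d <= 1 ->
  measurable_fun setT e -> (forall x, `|e x| <= 1) ->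
  (forall x, e (x + (2 * d)^-1) = - e x) ->
  d ^+ 2 * `|\int[mu]_x (h x * e x)| <= 2 * (h 1 + h (W - 1)).
Proof.
move=> hW W2 d0 d1 me e1 ed; have [bh h0 hout _] := hW.
have h1 := h0 1; have hW1 := h0 (W - 1).
set s := (2 * d)^-1; have s0 : 0 < s by rewrite invr_gt0; lra.
have sd : 2 * (s * d) = 1 by rewrite /s; field; rewrite gt_eqF.
have [sW|sW] := leP s (W / 2).
  have /(ler_wpM2l (sqr_ge0 d)) := oscillatory_le hW s0 sW me e1 ed.
  move=> /le_trans; apply.
  have bd g : concave_profile W g -> d * g s <= 2 * g 1.
    move=> gW; have [_ g0 _ _] := gW; have g1 := g0 1.
    have [s1|s1] := leP 1 s.
      have := profile_ray gW ler01 s1 (ltac:(lra) : s <= W); rewrite mul1r.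
      by move/(ler_wpM2l (ltW d0)) => /le_trans; apply; nra.
    have := profile_le gW ler01 (ltac:(lra) : 1 <= W / 2) (ltac:(lra) : s <= 2 * 1).
    by have := g0 s; nra.
  have b1 := bd _ hW; have := bd _ (concave_profile_refl hW) => /= b2.
  rewrite (_ : d ^+ 2 * (2 * s * (h s + h (W - s))) = 2 * (s * d) * (d * h s + d * h (W - s))); last ring.
  by rewrite sd; lra.
have dW : d * W < 1.
  by rewrite -sd; nra.
apply: (@le_trans _ _ (d ^+ 2 * (W * h 1 * W))).
  apply: ler_wpM2l; first exact: sqr_ge0.
  rewrite (le_trans (le_norm_Rint norm1_fin (bbsM bh me e1)))//.
  rewrite (le_trans _ (Rint_profile_le hW W2))//.
  apply: (le_Rint norm1_fin) => //; first exact: bbs_norm (bbsM bh me e1).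
  by move=> x; rewrite normrM ger0_norm// ler_piMr.
rewrite (_ : d ^+ 2 * (W * h 1 * W) = (d * W) ^+ 2 * h 1); last ring.
have : (d * W) ^+ 2 <= 1 by rewrite exprn_ile1//; [rewrite mulr_ge0//; lra|exact: ltW].
by move=> /(ler_wpM2r h1); lra.
Qed.

Lemma phase_half_period (d x : R) : d != 0 ->
  2 * pi * d * (x + (2 * d)^-1) = 2 * pi * d * x + pi.
Proof. by move=> d0; field. Qed.

(** The factor [d ^+ 4] comes from the dilation: in the plane, the transform of [dilate d C] at a
    frequency is [d ^+ 2] times that of [C] at [d] times this frequency. *)
Definition energy h := \int[mu]_d (\1_(`[0, 1]%classic) d * d ^+ 4 *
  (cos_transform h d ^+ 2 + sin_transform h d ^+ 2)).

Lemma bbs_transform h (g : R -> R) : bbsR h -> measurable_fun setT g ->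
  (forall x, `|g x| <= 1) ->
  bbsR (fun d => \1_(`[0, 1]%classic) d * \int[mu]_x (h x * g (2 * pi * d * x))).
Proof.
move=> bh mg g1; have mh := bbs_measurable bh.
have bf : bbs2 (fun z => \1_(`[0, 1]%classic) z.1 * (h z.2 * g (2 * pi * z.1 * z.2))).
  apply: (bbs2_tensor (K := 1) (bbs_segment 0 1) bh) => //.
  apply: (measurableT_comp mg); apply: measurable_funM => //.
  exact: measurable_funM.
have := bbs2_fubini1 bf; congr bbs; apply/funext => d /=.
rewrite (RintZ norm1_fin)//.
apply: (bbsM bh _ (K := 1)) => //.
by apply: (measurableT_comp mg); exact: mulrl_measurable.
Qed.

Lemma square_indicator (b : bool) (d c s : R) :
  d ^+ 4 * (b%:R * c * (b%:R * c) + b%:R * s * (b%:R * s)) =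
  b%:R * d ^+ 4 * (c ^+ 2 + s ^+ 2).
Proof. by case: b => /=; ring. Qed.

Lemma energy_bbs h : bbsR h ->
  bbsR (fun d => \1_(`[0, 1]%classic) d * d ^+ 4 *
    (cos_transform h d ^+ 2 + sin_transform h d ^+ 2)).
Proof.
move=> bh.
have mc : measurable_fun setT (@cos R).
  by apply: continuous_measurable_fun; exact: continuous_cos.
have ms : measurable_fun setT (@sin R).
  by apply: continuous_measurable_fun; exact: continuous_sin.
have bc := bbs_transform bh mc (@cos_max R).
have bs := bbs_transform bh ms (@sin_max R).
have sq (f : R -> R) : bbsR f -> bbsR (fun x => f x * f x).
  by move=> bf; have [mf [B hB]] := bf; apply: (bbsM bf mf (K := B)) => x; exact: (hB x).1.
have := bbsD (sq _ bc) (sq _ bs).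
move=> bb; apply: (bbs_dominated (K := 1) bb).
  have := measurable_funM (exprn_measurable 4) (bbs_measurable bb).
  congr measurable_fun; apply/funext => d /=; rewrite segE.
  exact: square_indicator.
move=> d; rewrite !segE -/(cos_transform h d) -/(sin_transform h d) mul1r.
have [/andP[d0 d1]|_] := boolP (_ && _); last by rewrite !mul0r addr0.
rewrite !mul1r -!expr2 normrM ler_piMl// ger0_norm ?exprn_ge0//.
by rewrite exprn_ile1.
Qed.

(** The weight [d ^+ 4] is the square of the factor [d ^+ 2] that [weighted_oscillatory_le] absorbs,
    so the integrand has a bound independent of [d]. *)
Lemma energy_le W h : concave_profile W h -> 2 <= W ->
  energy h <= 8 * (h 1 + h (W - 1)) ^+ 2.
Proof.
move=> hW W2; have [bh h0 _ _] := hW.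
rewrite -[leRHS]mulr1 -[X in _ * X]subr0; apply: Rint_le_segment => //.
  exact: energy_bbs.
move=> d; rewrite segE; have [/andP[d0 d1]|_] := boolP (_ && _); last first.
  by rewrite !mul0r mulr0.
(* At [d = 0] there is no half-period, but the weight vanishes. *)
rewrite mul1r mulr1; move: d0; rewrite le_eqVlt => /predU1P[<-|d0].
  by rewrite expr0n mul0r mulr_ge0// sqr_ge0.
have dn : d != 0 by rewrite gt_eqF.
have key e : measurable_fun setT e -> (forall x, `|e x| <= 1) ->
    (forall x, e (x + (2 * d)^-1) = - e x) ->
    (d ^+ 2 * \int[mu]_x (h x * e x)) ^+ 2 <= (2 * (h 1 + h (W - 1))) ^+ 2.
  move=> me e1 ed; have := weighted_oscillatory_le hW W2 d0 d1 me e1 ed.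
  have := h0 1; have := h0 (W - 1) => ? ?.
  rewrite -[X in X * _]ger0_norm ?sqr_ge0// -normrM => hh.
  by rewrite -[leLHS]real_normK ?num_real// ler_sqr ?nnegrE//; lra.
have kc : (d ^+ 2 * cos_transform h d) ^+ 2 <= (2 * (h 1 + h (W - 1))) ^+ 2.
  apply: key => [|x|x].
  - have := measurable_cos_affine (2 * pi * d) 0.
    by congr measurable_fun; apply/funext => x; rewrite addr0.
  - exact: cos_max.
  - by rewrite phase_half_period// cosDpi.
have ks : (d ^+ 2 * sin_transform h d) ^+ 2 <= (2 * (h 1 + h (W - 1))) ^+ 2.
  apply: key => [|x|x].
  - have := measurable_sin_affine (2 * pi * d) 0.
    by congr measurable_fun; apply/funext => x; rewrite addr0.
  - exact: sin_max.
  - by rewrite phase_half_period// sinDpi.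
rewrite (_ : d ^+ 4 * _ = (d ^+ 2 * cos_transform h d) ^+ 2 + (d ^+ 2 * sin_transform h d) ^+ 2); last ring.
by apply: (le_trans (lerD kc ks)); rewrite exprMn; lra.
Qed.

(** * Lower bound for the energy of a profile, by the Fejer kernel *)

Lemma Rint_FTC (F f : R -> R) (a b : R) : a < b -> (forall x : R, is_derive x (1 : R) F (f x)) ->
  continuous f -> \int[mu]_(x in `[a, b]) f x = F b - F a.
Proof.
move=> ab dF cf.
have cF : continuous F.
  move=> x; apply: differentiable_continuous; apply/derivable1_diffP.
  exact: (@ex_derive _ _ _ _ _ _ _ (dF x)).
rewrite /Rintegral (@continuous_FTC2 _ f F)//.
- exact: continuous_subspaceT.
- split => [x _||].
  + exact: (@ex_derive _ _ _ _ _ _ _ (dF x)).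
  + by apply: cvg_at_right_filter; exact: cF.
  + by apply: cvg_at_left_filter; exact: cF.
- by move=> x _; rewrite derive1E; exact: (@derive_val _ _ _ _ _ _ _ (dF x)).
Qed.

Let tri (d : R) := \1_(`[0, 1]%classic) d * (1 - d).

Let tri_ge0 d : 0 <= tri d.
Proof.
rewrite /tri segE; case: (boolP (_ && _)) => [/andP[_ d1]|_]; last by rewrite mul0r.
by rewrite mul1r subr_ge0.
Qed.

Let tri_le d : tri d <= \1_(`[0, 1]%classic) d.
Proof.
rewrite /tri segE; case: (boolP (_ && _)) => [/andP[d0 d1]|_]; last by rewrite mul0r.
by rewrite mul1r lerBlDr lerDl.
Qed.

Let bbs_tri : bbsR tri.
Proof.
apply: (bbs_dominated (K := 1) (bbs_segment 0 1)).
  apply: measurable_funM; first exact: bbs_measurable (bbs_segment 0 1).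
  exact: measurable_realfun.measurable_funB.
by move=> d; rewrite mul1r !ger0_norm//; rewrite ?tri_ge0 ?tri_le// indicE.
Qed.

(* The Fourier transform of the triangle is the Fejer kernel. *)
Definition fejer (t : R) := \int[mu]_d (tri d * cos (2 * pi * t * d)).

Lemma fejerE t : t != 0 ->
  fejer t = (1 - cos (2 * pi * t)) / (4 * pi ^+ 2 * t ^+ 2).
Proof.
move=> t0; have pi0 : pi != 0 :> R by rewrite gt_eqF// pi_gt0.
set a : R := 2 * pi * t.
have a0 : a != 0 by rewrite !mulf_neq0.
(* A primitive of [(1 - d) * cos (a * d)], obtained by parts. *)
pose F d : R := (1 - d) * sin (a * d) / a - cos (a * d) / a ^+ 2.
have dF (d : R) : is_derive d (1 : R) F ((1 - d) * cos (a * d)).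
  rewrite /F; apply: is_derive_eq; rewrite /GRing.scale/=.
  by field.
have cf : continuous (fun d : R => (1 - d) * cos (a * d)).
  move=> d; apply: cvgM.
    by apply: cvgB; [exact: cvg_cst|exact: cvg_id].
  apply: continuous_comp; last exact: continuous_cos.
  by apply: cvgM; [exact: cvg_cst|exact: cvg_id].
rewrite /fejer (_ : \int[mu]_d _ =
    \int[mu]_(d in `[0, 1]) ((1 - d) * cos (a * d))); last first.
  rewrite [RHS]Rintegral_indic; apply: eq_Rintegral => d _.
  by rewrite /tri mulrA.
rewrite (Rint_FTC ltr01 dF cf).
rewrite /F subrr !mul0r subr0 mul1r mulr0 sin0 cos0 mul0r mulr1.
move: (cos a) => c; rewrite /a.
by move: (pi : R) pi0 => p p0; field; rewrite t0.
Qed.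

Let bbs_tri_cos c : bbsR (fun d => tri d * cos (c * d)).
Proof.
apply: (bbsM bbs_tri (K := 1)) => [|d]; last exact: cos_max.
by have := measurable_cos_affine c 0; congr measurable_fun; apply/funext => d; rewrite addr0.
Qed.

(** Provides measurability, including at [t = 0], where the quotient of [fejerE] degenerates. *)
Lemma fejer_lipschitz (t u : R) : `|fejer t - fejer u| <= 8 * `|t - u|.
Proof.
rewrite /fejer -(RintB norm1_fin)//.
rewrite (le_trans (le_norm_Rint norm1_fin (bbsB (bbs_tri_cos _) (bbs_tri_cos _))))//.
have -> : 8 * `|t - u| = 8 * `|t - u| * (1 - 0) by rewrite subr0 mulr1.
apply: Rint_le_segment => [||d].
- by apply: bbs_norm; exact: bbsB.
- exact: ler01.
rewrite -mulrBr normrM (ger0_norm (tri_ge0 d)).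
have := tri_le d; have := tri_ge0 d.
rewrite !segE; case: (boolP (_ && _)) => [/andP[d0 d1]|_] t0 t1; last first.
  have -> : tri d = 0 by apply/eqP; rewrite eq_le t0 andbT; exact: t1.
  by rewrite mul0r mulr0.
rewrite mulr1 -[leRHS]mul1r ler_pM// (le_trans (cos_lipschitz _ _))//.
rewrite -mulrBl -mulrBr !normrM (ger0_norm (pi_ge0 R)) (ger0_norm d0).
rewrite (ger0_norm (ler0n _ 2)) -mulrA ler_pM ?mulr_ge0 ?pi_ge0//.
  by have := pihalf_lt2 R; lra.
by rewrite ler_piMr.
Qed.

Lemma fejer_le (t : R) : fejer t <= fejer 0.
Proof.
apply: (le_Rint norm1_fin) => [||d] //.
by rewrite mulr0 mul0r cos0 ler_wpM2l// cos_le1.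
Qed.

Definition fejer_diff (t : R) := fejer t - fejer (t + 1).

Lemma measurable_fejer_diff : measurable_fun setT fejer_diff.
Proof.
have mf : measurable_fun setT fejer.
  by apply: continuous_measurable_fun; exact: lipschitz_fun_continuous fejer_lipschitz.
apply: measurable_realfun.measurable_funB => //.
apply: (measurableT_comp mf); exact: measurable_realfun.measurable_funD.
Qed.

Lemma fejer_diff_norm t : `|fejer_diff t| <= 2.
Proof.
have f1 u : `|fejer u| <= 1.
  rewrite (le_trans (le_norm_Rint norm1_fin (bbs_tri_cos _)))//.
  rewrite -[leRHS]mulr1 -[X in _ <= _ * X]subr0.
  apply: Rint_le_segment => // [|d]; first exact: bbs_norm.
  rewrite mul1r (le_trans _ (tri_le d))// normrM ger0_norm// ler_piMr//.
  exact: cos_max.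
by rewrite (le_trans (ler_normB _ _))// (_ : 2 = 1 + 1)// lerD.
Qed.

(** The two numerators agree, as 1 is a period of [cos (2 * pi * t)]. What remains is a difference
    of inverse squares, which is positive for [t > 0] and decays like an inverse cube. *)
Lemma fejer_diffE t : 0 < t ->
  fejer_diff t = (1 - cos (2 * pi * t)) / (4 * pi ^+ 2) *
    ((2 * t + 1) / (t ^+ 2 * (t + 1) ^+ 2)).
Proof.
move=> t0; have t1 : t + 1 != 0 by rewrite gt_eqF// addr_gt0.
have tn : t != 0 by rewrite gt_eqF.
have pi0 : pi != 0 :> R by rewrite gt_eqF// pi_gt0.
rewrite /fejer_diff !fejerE//.
have -> : cos (2 * pi * (t + 1)) = cos (2 * pi * t).
  by rewrite mulrDr mulr1 [2 * pi]mulrC mulr_natr cosD2pi.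
move: (cos _) => c; move: (pi : R) pi0 => p p0.
by field; rewrite t1 tn.
Qed.

Lemma fejer_diff_ge0 t : 0 <= t -> 0 <= fejer_diff t.
Proof.
rewrite le_eqVlt => /predU1P[<-|t0]; first by rewrite subr_ge0 fejer_le.
rewrite fejer_diffE// mulr_ge0// divr_ge0 ?mulr_ge0 ?sqr_ge0 ?subr_ge0 ?cos_le1 ?pi_ge0//.
all: by rewrite ?addr_ge0 ?mulr_ge0// ltW.
Qed.

Lemma fejer_diff_cube_le t : 0 < t -> t ^+ 3 * fejer_diff t <= 1.
Proof.
move=> t0; rewrite fejer_diffE//.
have c1 : 1 - cos (2 * pi * t) <= 2 by have := cos_geN1 (2 * pi * t); lra.
have c0 : 0 <= 1 - cos (2 * pi * t) by rewrite subr_ge0 cos_le1.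
have p2 := pi_ge2 R.
rewrite [leLHS](_ : _ = ((1 - cos (2 * pi * t)) * (t * (2 * t + 1))) /
    (4 * pi ^+ 2 * (t + 1) ^+ 2)); last first.
  by field; rewrite !gt_eqF//; lra.
rewrite ler_pdivrMr ?mulr_gt0 ?exprn_gt0//; [|lra..].
rewrite mul1r; apply: (@le_trans _ _ (2 * (t * (2 * t + 1)))).
  by rewrite ler_wpM2r// mulr_ge0//; lra.
apply: (@le_trans _ _ (4 * 2 ^+ 2 * (t + 1) ^+ 2)); first nra.
rewrite ler_wpM2r ?sqr_ge0// ler_wpM2l// ler_sqr ?nnegrE//; lra.
Qed.

Lemma cos_le0 (x : R) : pi / 2 <= x -> x <= 3 / 2 * pi -> cos x <= 0.
Proof.
move=> x1 x2; have := cosDpi (x - pi); rewrite subrK => ->.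
rewrite oppr_le0; apply: cos_ge0_pihalf; apply/andP; split; lra.
Qed.

(** The range is the half-period on which the cosine is non-positive, so that the numerator is at
    least 1. *)
Lemma fejer_diff_ge t : 1 / 4 <= t -> t <= 3 / 4 -> 1 / 64 <= t * fejer_diff t.
Proof.
move=> t1 t2; have t0 : 0 < t by lra.
rewrite fejer_diffE//; have pi0 := pi_gt0 R; have pi4 := pihalf_lt2 R.
have c0 : cos (2 * pi * t) <= 0 by apply: cos_le0; nra.
rewrite mulrCA (_ : t * _ = (2 * t + 1) / (t * (t + 1) ^+ 2)); last first.
  by field; rewrite !gt_eqF//; lra.
rewrite -[leLHS]mulr1; apply: ler_pM => //.
- rewrite ler_pdivlMr; last by rewrite mulr_gt0// exprn_gt0.
  have : pi ^+ 2 <= 4 ^+ 2 :> R by rewrite ler_sqr ?nnegrE//; lra.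
  lra.
- rewrite ler_pdivlMr; last by rewrite mulr_gt0// exprn_gt0//; lra.
  by nra.
Qed.

Let phase_transform h (d : R) := \int[mu]_t (h t * cos (2 * pi * d * (t + 1))).

(** The second factor vanishes to order 2 at 0, so that the weight [d ^+ 4] of the energy controls
    its square; on the kernel side it produces a second difference of step 1. *)
Let weight (d : R) := tri d * (2 - 2 * cos (2 * pi * d)).

Let phase_integral h := \int[mu]_d (weight d * phase_transform h d).

Let bbs_weight : bbsR weight.
Proof.
apply: (bbsM bbs_tri (K := 4)) => [|d].
  apply: measurable_realfun.measurable_funB => //.
  have := measurable_funM (measurable_cst (2 : R)) (measurable_cos_affine (2 * pi) 0).
  by congr measurable_fun; apply/funext => d; rewrite /= addr0.
by rewrite ger0_norm; have := cos_le1 (2 * pi * d); have := cos_geN1 (2 * pi * d); lra.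
Qed.

Let bbs2_phase h : bbsR h ->
  bbs2 (fun z => weight z.1 * (h z.2 * cos (2 * pi * z.1 * (z.2 + 1)))).
Proof.
move=> bh; apply: (bbs2_tensor (K := 1) bbs_weight bh) => [|z]; last exact: cos_max.
apply: measurableT_comp.
  by apply: continuous_measurable_fun; exact: continuous_cos.
apply: measurable_funM.
  exact: measurable_funM.
exact: measurable_realfun.measurable_funD.
Qed.

(** Fubini produces a difference of two values of [fejer_diff]; a translation by 1, as in summation
    by parts, moves this difference onto [h]. *)
Let phase_integralE h : bbsR h ->
  phase_integral h = - \int[mu]_t ((h t - h (t - 1)) * fejer_diff t).
Proof.
move=> bh; rewrite /phase_integral.
have bcos (k : R) : bbsR (fun t => h t * cos (k * (t + 1))).
  apply: (bbsM bh (K := 1)) => [|t]; last exact: cos_max.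
  exact: measurable_cos_shift.
transitivity (\int[mu]_d \int[mu]_t (weight d * (h t * cos (2 * pi * d * (t + 1))))).
  by apply: eq_Rintegral => d _; rewrite (RintZ norm1_fin).
rewrite (Rint_swap (bbs2_phase bh)) /=.
have inner t : \int[mu]_d (weight d * (h t * cos (2 * pi * d * (t + 1)))) =
    h t * (fejer_diff (t + 1) - fejer_diff t).
  have -> : fejer_diff (t + 1) - fejer_diff t =
      2 * fejer (t + 1) - (fejer (t + 2) + fejer t).
    by rewrite /fejer_diff (_ : t + 1 + 1 = t + 2); ring.
  rewrite /fejer -(RintZ norm1_fin)// -(RintD norm1_fin)// -(RintB norm1_fin); last 2 first.
  - exact: bbsZ.
  - exact: bbsD.
  rewrite -(RintZ norm1_fin); last first.
    by apply: bbsB; [exact: bbsZ|exact: bbsD].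
  apply: eq_Rintegral => d _; rewrite /weight.
  set p := 2 * pi * (t + 1) * d; set q := 2 * pi * d.
  have -> : 2 * pi * d * (t + 1) = p by rewrite /p; ring.
  have -> : 2 * pi * (t + 2) * d = p + q by rewrite /p /q; ring.
  have -> : 2 * pi * t * d = p - q by rewrite /p /q; ring.
  by rewrite cosD cosB; ring.
under eq_Rintegral do rewrite inner.
have mk := measurable_fejer_diff.
have k1 := fejer_diff_norm.
have mk1 : measurable_fun setT (fun t : R => fejer_diff (t + 1)).
  by apply: (measurableT_comp mk); exact: measurable_realfun.measurable_funD.
have b1 := bbsM bh mk k1; have b2 := bbsM bh mk1 (fun t => k1 (t + 1)).
have b3 := bbsM (bbs_shift (-1) bh) mk k1.
transitivity (\int[mu]_t (h t * fejer_diff (t + 1)) - \int[mu]_t (h t * fejer_diff t)).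
  by rewrite -(RintB norm1_fin)//; apply: eq_Rintegral => t _; rewrite mulrBr.
rewrite -(Rint_shift (-1) b2).
have -> : \int[mu]_t ((h t - h (t - 1)) * fejer_diff t) =
    \int[mu]_t (h t * fejer_diff t) - \int[mu]_t (h (t - 1) * fejer_diff t).
  by rewrite -(RintB norm1_fin)//; apply: eq_Rintegral => t _; rewrite mulrBl.
have -> : \int[mu]_t (h (t - 1) * fejer_diff (t - 1 + 1)) =
    \int[mu]_t (h (t - 1) * fejer_diff t).
  by apply: eq_Rintegral => t _; rewrite subrK.
by rewrite opprB.
Qed.

(** Replaces Cauchy-Schwarz: [2 * z <= a * z ^+ 2 + a^-1] is applied pointwise, and the free
    parameter [a] is chosen in [energy_ge]. *)
Let phase_integral_le h a : bbsR h -> 0 < a ->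
  `|phase_integral h| <= 32 * (a * energy h + a^-1).
Proof.
move=> bh a0.
have bw : bbsR (fun d => weight d * phase_transform h d).
  have := bbs2_fubini1 (bbs2_phase bh); congr bbs; apply/funext => d /=.
  rewrite (RintZ norm1_fin)//; apply: (bbsM bh (K := 1)) => [|t]; last exact: cos_max.
  exact: measurable_cos_shift.
have be := energy_bbs bh.
have b1 : bbsR (fun d => a^-1 * \1_(`[0, 1]%classic) d).
  by apply: bbsZ; exact: bbs_segment.
have b2 := bbsZ a be.
have b3 := bbsZ 32 (bbsD b2 b1).
rewrite (le_trans (le_norm_Rint norm1_fin bw))//.
rewrite (_ : 32 * _ = \int[mu]_d (32 * (a * (\1_(`[0, 1]%classic) d * d ^+ 4 *
  (cos_transform h d ^+ 2 + sin_transform h d ^+ 2)) + a^-1 * \1_(`[0, 1]%classic) d))); last first.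
  rewrite (RintZ norm1_fin); last exact: bbsD.
  rewrite (RintD norm1_fin)// !(RintZ norm1_fin)//; last exact: bbs_segment.
  by rewrite Rint_segment// subr0 mulr1.
apply: (le_Rint norm1_fin) => //; first exact: bbs_norm.
move=> d; rewrite /weight /tri !segE.
case: (boolP (_ && _)) => [/andP[d0 d1]|_]; last by rewrite !mul0r !mulr0 normr0 addr0 mulr0.
rewrite !mul1r mulr1.
set X := cos_transform h d; set Y := sin_transform h d.
have -> : phase_transform h d = cos (2 * pi * d) * X - sin (2 * pi * d) * Y.
  have bc : bbsR (fun t => h t * cos (2 * pi * d * t)).
    apply: (bbsM bh (K := 1)) => [|t]; last exact: cos_max.
    have := measurable_cos_affine (2 * pi * d) 0; congr measurable_fun.
    by apply/funext => t; rewrite addr0.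
  have bs : bbsR (fun t => h t * sin (2 * pi * d * t)).
    apply: (bbsM bh (K := 1)) => [|t]; last exact: sin_max.
    have := measurable_sin_affine (2 * pi * d) 0; congr measurable_fun.
    by apply/funext => t; rewrite addr0.
  rewrite /X /Y -!(RintZ norm1_fin)// -(RintB norm1_fin); [|exact: bbsZ..].
  by apply: eq_Rintegral => t _; rewrite mulrDr mulr1 cosD; ring.
have w0 : 0 <= 2 - 2 * cos (2 * pi * d) by have := cos_le1 (2 * pi * d); lra.
(* The constant is [4 * pi ^+ 2], rounded up by means of [pi <= 4]. *)
have w1 : 2 - 2 * cos (2 * pi * d) <= 64 * d ^+ 2.
  have := cosB1_le (2 * pi * d); rewrite !exprMn.
  have : pi ^+ 2 <= 4 ^+ 2 :> R.
    by rewrite ler_sqr ?nnegrE//; have := pihalf_lt2 R; have := pi_gt0 R; lra.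
  by move=> /(ler_wpM2r (sqr_ge0 d)); lra.
(* [G] is a coordinate of the vector [(X, Y)] after a rotation. *)
set G := cos _ * X - _; have G2 : G ^+ 2 <= X ^+ 2 + Y ^+ 2.
  have := cos2Dsin2 (2 * pi * d); rewrite /G.
  move: (cos _) (sin _) => c s cs.
  have -> : X ^+ 2 + Y ^+ 2 = (c ^+ 2 + s ^+ 2) * (X ^+ 2 + Y ^+ 2) by rewrite cs mul1r.
  by have := sqr_ge0 (s * X + c * Y); nra.
rewrite !normrM (ger0_norm w0) (ger0_norm (_ : 0 <= 1 - d)) ?subr_ge0//.
apply: (@le_trans _ _ (64 * d ^+ 2 * `|G|)).
  rewrite ler_wpM2r// (le_trans _ w1)// ler_piMl// lerBlDr lerDl//.
have n2 : `|G| ^+ 2 <= X ^+ 2 + Y ^+ 2 by rewrite real_normK ?num_real.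
have am : 2 * (d ^+ 2 * `|G|) <= a * (d ^+ 2 * `|G|) ^+ 2 + a^-1.
  have := sqr_ge0 (a * (d ^+ 2 * `|G|) - 1); rewrite -(pmulr_rge0 _ (_ : 0 < a^-1)) ?invr_gt0//.
  move: (d ^+ 2 * `|G|) => z; rewrite (_ : a^-1 * _ = a * z ^+ 2 + a^-1 - 2 * z); first lra.
  by field; rewrite gt_eqF.
have : (d ^+ 2 * `|G|) ^+ 2 <= d ^+ 4 * (X ^+ 2 + Y ^+ 2).
  by rewrite exprMn -exprM ler_wpM2l// exprn_ge0.
move=> /(ler_wpM2l (ltW a0)); lra.
Qed.

(** The shape of a minorant of [(h t - h (t - 1)) * fejer_diff t]: a gain in the middle of the first
    unit interval, and losses near the left end, up to the midpoint, and beyond it. *)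
Let steps (c1 c2 c3 c4 W t : R) := c1 * \1_(`[1 / 4, 3 / 4]%classic) t -
  (c2 * \1_(`[1, 32]%classic) t + (c3 * \1_(`[32, W / 2]%classic) t +
   c4 * \1_(`[W / 2, W + 1]%classic) t)).

Let bbsZ_segment (c a b : R) : bbsR (fun t => c * \1_(`[a, b]%classic) t).
Proof. by apply: bbsZ; exact: bbs_segment. Qed.

Let bbs_steps c1 c2 c3 c4 W : bbsR (steps c1 c2 c3 c4 W).
Proof.
by apply: bbsB; [|apply: bbsD; [|apply: bbsD]]; exact: bbsZ_segment.
Qed.

Let RintZ_segment (c a b : R) : a <= b ->
  \int[mu]_t (c * \1_(`[a, b]%classic) t) = c * (b - a).
Proof. by move=> ab; rewrite (RintZ norm1_fin) ?Rint_segment//; exact: bbs_segment. Qed.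

Let Rint_steps c1 c2 c3 c4 W : 64 <= W -> \int[mu]_t steps c1 c2 c3 c4 W t =
  c1 / 2 - (c2 * 31 + (c3 * (W / 2 - 32) + c4 * (W / 2 + 1))).
Proof.
move=> WM; have b3 := bbsZ_segment c3 32 (W / 2).
have b4 := bbsZ_segment c4 (W / 2) (W + 1).
have b2 := bbsZ_segment c2 1 32.
have b1 := bbsZ_segment c1 (1 / 4) (3 / 4).
rewrite (RintB norm1_fin b1 (bbsD b2 (bbsD b3 b4))).
rewrite (RintD norm1_fin b2 (bbsD b3 b4)) (RintD norm1_fin b3 b4).
by rewrite !RintZ_segment; [congr (_ * _ - (_ * _ + (_ + _ * _))); lra|lra..].
Qed.

(** If a concave function loses [v] on a unit interval, it keeps losing at least [v] per unit until
    [W]. Being non-negative there, on the left half it can lose at most its own value divided by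
    [W / 2], and this value is at most [2 * t * h 1]. *)
Lemma profile_decrease W h t : concave_profile W h -> 2 <= W -> 1 <= t -> t <= W / 2 ->
  h (t - 1) - h t <= 4 / W * t * h 1.
Proof.
move=> hW W2 t1 tw; have [_ h0 _ _] := hW; have h1 := h0 1.
have W0 : 0 < W / 2 by rewrite divr_gt0// (lt_le_trans _ W2).
have t0 : 0 <= t - 1 by rewrite subr_ge0.
rewrite -(ler_pM2l W0) (_ : W / 2 * (4 / W * t * h 1) = 2 * t * h 1); last first.
  by field; rewrite gt_eqF// (lt_le_trans _ W2).
have hm : h (t - 1) <= 2 * t * h 1.
  have [u2|u2] := leP (t - 1) 2.
    rewrite (le_trans (profile_le (x := 1) hW _ _ _))//; [lra|lra|].
    by rewrite ler_wpM2r// ler_peMr.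
  have := profile_ray (x := 1) (y := t - 1) hW ler01; rewrite mul1r.
  move=> /(_ ltac:(lra) ltac:(lra)) => hh; rewrite (le_trans hh)// ler_wpM2r//; lra.
have [hh|hh] := leP (h (t - 1)) (h t).
  apply: (@le_trans _ _ 0); first by apply: mulr_ge0_le0; [exact: ltW|rewrite subr_le0].
  by rewrite !mulr_ge0// (le_trans _ t1).
have := profile_rayr (x := t - 1) (y := t) hW t0; rewrite (_ : W - (t - 1) = W - t + 1); last ring.
move=> /(_ ltac:(lra) ltac:(lra)) => hr.
apply: le_trans hm; apply: (@le_trans _ _ ((W - t) * (h (t - 1) - h t))).
  by apply: ler_wpM2r; [rewrite subr_ge0 ltW|lra].
by rewrite mulrBr lerBlDr (le_trans hr)// mulrDl mul1r addrC lerD2r ltW.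
Qed.

(* Where the phase [t + 1] comes from: shifting the Fejer kernel by its period
   makes [fejer_diff] non-negative on the support of [h], so that only the
   decrease of [h], which is slow far away from the right end, counts against. *)
Let phase_integral_ge W h : concave_profile W h -> 2 ^+ 17 <= W ->
  h 1 / 256 <= - phase_integral h.
Proof.
move=> hW WM; have [bh h0 hout hc] := hW; have h1 := h0 1.
have W2 : 2 <= W by lra.
have out y : y < 0 \/ W < y -> h y = 0.
  by move=> yW; apply: hout; rewrite negb_and -!ltNge; apply/orP.
rewrite phase_integralE// opprK.
pose i1 (x : R) : R := \1_(`[1 / 4, 3 / 4]%classic) x.
pose i2 (x : R) : R := \1_(`[1, 32]%classic) x.
pose i3 (x : R) : R := \1_(`[32, W / 2]%classic) x.
pose i4 (x : R) : R := \1_(`[W / 2, W + 1]%classic) x.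
have ig0 (a b x : R) : 0 <= \1_(`[a, b]%classic) x :> R by rewrite indicE.
pose lb := steps (h 1 / 64) (h 1 * (4 / W)) (h 1 * (4 / (W * 32 ^+ 2)))
  (h 1 * (8 / W ^+ 2)) W.
have W0 : 0 < W by lra.
(* The gain is [h 1 / 128]. The cut at 32 makes the loss up to the midpoint at most [h 1 / 512]
   apart from terms in [1 / W], and [W >= 2 ^ 17] brings all these terms below [h 1 / 1024]. *)
apply: (@le_trans _ _ (\int[mu]_t lb t)).
  rewrite /lb Rint_steps; last lra.
  have -> : h 1 * (4 / W) * 31 + (h 1 * (4 / (W * 32 ^+ 2)) * (W / 2 - 32) +
      h 1 * (8 / W ^+ 2) * (W / 2 + 1)) =
      h 1 * (1 / 512 + (128 - 1 / 8) / W + 8 / W ^+ 2).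
    by field; rewrite gt_eqF.
  have w0 : 0 <= W^-1 by rewrite invr_ge0 ltW.
  have w1 : 2 ^+ 10 * (2 ^+ 7 * W^-1) <= 1.
    by rewrite mulrA -exprD ler_pdivrMr// mul1r.
  have w2 : W ^- 2 <= W^-1.
    by rewrite lef_pV2 ?posrE ?exprn_gt0// expr2 ler_peMl//; lra.
  rewrite -subr_ge0 (_ : _ - _ = h 1 * (1 / 64 / 2 - (1 / 512 + (128 - 1 / 8) / W + 8 / W ^+ 2) - 1 / 256)); last by field; rewrite gt_eqF.
  apply: mulr_ge0; first exact: h1.
  by move: W^-1 (W ^- 2) w0 w1 w2 => u v w0 w1 w2; clear WM; lra.
have mk := measurable_fejer_diff.
apply: (le_Rint norm1_fin).
- exact: bbs_steps.
- by apply: (bbsM _ mk fejer_diff_norm); apply: bbsB => //; exact: bbs_shift.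
suff pw (t : R) : steps (h 1 / 64) (h 1 * (4 / W)) (h 1 * (4 / (W * 32 ^+ 2)))
  (h 1 * (8 / W ^+ 2)) W t <= (h t - h (t - 1)) * fejer_diff t by exact: pw.
have W64 : 64 <= W by lra.
clear WM lb; rewrite /steps -/(i1 t) -/(i2 t) -/(i3 t) -/(i4 t).
have t1 : 0 <= i1 t by exact: ig0.
have t2 : 0 <= h 1 * (4 / W) * i2 t by rewrite !mulr_ge0 ?invr_ge0 ?ig0// ltW.
have t3 : 0 <= h 1 * (4 / (W * 32 ^+ 2)) * i3 t.
  by rewrite !mulr_ge0 ?invr_ge0 ?ig0// ?mulr_ge0// ltW.
have t4 : 0 <= h 1 * (8 / W ^+ 2) * i4 t.
  by rewrite !mulr_ge0 ?invr_ge0 ?ig0// exprn_ge0// ltW.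
have [tn|tp] := ltP t 0.
  have -> : i1 t = 0 by rewrite /i1 segE [_ && _]negbTE// negb_and -ltNge; lra.
  rewrite (out t); last by left.
  rewrite (out (t - 1)); last by left; lra.
  by rewrite subrr mul0r mulr0; lra.
have k0 := fejer_diff_ge0 tp.
(* For [t < 1] nothing is subtracted from [h t]: this is the only source of gain. *)
have [tl|tg] := ltP t 1.
  rewrite (out (t - 1)) ?subr0; last by left; lra.
  apply: (@le_trans _ _ (h 1 / 64 * i1 t)); first lra.
  rewrite /i1 segE; case: (boolP (_ && _)) => [/andP[ta tb]|_]; last first.
    by rewrite mulr0 mulr_ge0.
  have := profile_ray hW tp (ltW tl) (ltac:(lra) : 1 <= W); rewrite mul1r => hh.
  have := ler_wpM2r k0 hh; have := ler_wpM2l h1 (fejer_diff_ge ta tb).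
  rewrite mulr1; lra.
have -> : i1 t = 0 by rewrite /i1 segE [_ && _]negbTE// negb_and -!ltNge; lra.
rewrite mulr0 sub0r lerNl -mulNr opprB.
have k3 : t ^+ 3 * fejer_diff t <= 1 by apply: fejer_diff_cube_le; lra.
have ht := h0 t; have htm := h0 (t - 1).
have [tw|tw] := leP t (W / 2).
  have hd2 : (h (t - 1) - h t) * fejer_diff t <= h 1 * (4 / W) * (t * fejer_diff t).
    have := ler_wpM2r k0 (profile_decrease hW W2 tg tw); congr (_ <= _).
    by rewrite [4 / W * t * _]mulrC !mulrA.
  rewrite (le_trans hd2)//.
  have [ta|ta] := leP t 32.
    have -> : i2 t = 1 by rewrite /i2 segE tg ta.
    rewrite -[leLHS]addr0 lerD//; last lra.
    rewrite ler_wpM2l ?mulr_ge0 ?invr_ge0//; first exact: ltW.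
    rewrite (le_trans _ k3)// ler_wpM2r// exprS ler_peMr//.
    by rewrite exprn_ege1.
  have -> : i3 t = 1 by rewrite /i3 segE tw ltW.
  rewrite -[leLHS]add0r lerD//.
  rewrite -[leLHS]addr0 lerD//.
  rewrite (_ : h 1 * (4 / (W * 32 ^+ 2)) * 1 = h 1 * (4 / W) * (1 / 32 ^+ 2)); last by field; rewrite gt_eqF.
  rewrite ler_wpM2l ?mulr_ge0 ?invr_ge0//; first exact: ltW.
  have tt : 32 ^+ 2 <= t ^+ 2.
    by rewrite ler_sqr ?nnegrE//; lra.
  have tk : 0 <= t * fejer_diff t by rewrite mulr_ge0.
  have : 32 ^+ 2 * (t * fejer_diff t) <= 1.
    rewrite (le_trans _ k3)// (_ : t ^+ 3 * _ = t ^+ 2 * (t * fejer_diff t)); last ring.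
    by rewrite ler_wpM2r.
  lra.
have [tw1|tw1] := leP t (W + 1); last first.
  rewrite (out t); last by right; lra.
  rewrite (out (t - 1)); last by right; lra.
  by rewrite subrr mul0r; lra.
have -> : i4 t = 1 by rewrite /i4 segE tw1 ltW.
rewrite -[leLHS]add0r lerD//.
rewrite -[leLHS]add0r lerD// mulr1.
(* Beyond the midpoint [h] may drop at once by its maximum, but the kernel is of order [W ^- 3]. *)
have hm : h (t - 1) - h t <= W * h 1.
  by have := profile_max (t - 1) hW W2; lra.
rewrite (le_trans (ler_wpM2r k0 hm))//.
have kW : fejer_diff t <= 8 / W ^+ 3.
  rewrite ler_pdivlMr ?exprn_gt0//.
  have : (W / 2) ^+ 3 <= t ^+ 3 by apply: lerXn2r; rewrite ?nnegrE// ?divr_ge0// ltW.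
  by move=> /(ler_wpM2r k0); lra.
rewrite (_ : h 1 * (8 / W ^+ 2) = W * h 1 * (8 / W ^+ 3)); last by field; rewrite gt_eqF.
by rewrite ler_wpM2l// mulr_ge0// ltW.
Qed.

Lemma energy_ge W h : concave_profile W h -> 2 ^+ 17 <= W ->
  h 1 ^+ 2 <= 2 ^+ 28 * energy h.
Proof.
move=> hW WM; have [bh h0 _ _] := hW.
have [->|hn] := eqVneq (h 1) 0.
  rewrite expr0n mulr_ge0// ?mulr_ge0//; apply: Rintegral_ge0 => d _.
  by rewrite mulr_ge0 ?addr_ge0 ?sqr_ge0// mulr_ge0 ?exprn_even_ge0// indicE.
have h1 : 0 < h 1 by rewrite lt_neqAle eq_sym hn h0.
(* The value [a = 2 ^ 14 / h 1] makes [32 / a] equal to [h 1 / 512], half of the lower bound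
   [h 1 / 256]; the factor [2 ^ 28] results. *)
have ap : 0 < 2 ^+ 14 / h 1 by rewrite divr_gt0// exprn_gt0.
have := phase_integral_le bh ap; have := phase_integral_ge hW WM.
move: (energy h) (phase_integral h) => E S l1 l2.
have := le_trans l1 (le_trans (ler_norm _) _).
rewrite normrN => /(_ _ l2).
rewrite invf_div => l3.
have : h 1 / 2 ^+ 9 <= 2 ^+ 5 * (2 ^+ 14 / h 1 * E) by lra.
move=> /(ler_wpM2l (ltW h1)).
rewrite (_ : h 1 * (2 ^+ 5 * _) = 2 ^+ 19 * E); last by field.
lra.
Qed.

End profile.

(** * Compact convex sets, chords and plane integrals *)

Section sandwich.
Context {R : realType} d (T : measurableType d).
Variable mu : {measure set T -> \bar R}.
Local Open Scope ereal_scope.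

(** Holds for arbitrary sets: the integral is a supremum over simple functions below the integrand
    cut off outside the domain. *)
Lemma ge0_integral_mono (D E : set T) (f : T -> \bar R) : D `<=` E ->
  (forall x, 0 <= f x) -> \int[mu]_(x in D) f x <= \int[mu]_(x in E) f x.
Proof.
move=> DE f0; rewrite !ge0_integralE//; apply: le_ereal_sup => _ /= [h hf <-].
exists h => // x; apply: (le_trans (hf x)); rewrite !patchE.
case: ifPn => [/set_mem/DE xE|_]; first by rewrite mem_set.
by case: ifPn.
Qed.

(* [D] need not be measurable. *)
Lemma integral_sandwich (D E0 E1 : set T) (f : T -> \bar R) :
  measurable E0 -> measurable E1 -> E0 `<=` D -> D `<=` E1 ->
  mu (E1 `\` E0) = 0 -> measurable_fun setT f ->
  \int[mu]_(x in D) f x = \int[mu]_(x in E1) f x.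
Proof.
move=> mE0 mE1 E0D DE1 null mf.
have key (g : T -> \bar R) : measurable_fun setT g -> (forall x, 0 <= g x) ->
    \int[mu]_(x in D) g x = \int[mu]_(x in E1) g x.
  move=> mg g0; apply/eqP; rewrite eq_le; apply/andP; split.
    exact: ge0_integral_mono.
  rewrite (ge0_negligible_integral (N := E1 `\` E0))//; last 2 first.
  - exact: measurableD.
  - exact: measurable_funS mg.
  by rewrite setDD (setIidr (subset_trans E0D DE1)); exact: ge0_integral_mono.
rewrite integralE [RHS]integralE !key//.
- exact: measurable_funeneg.
- exact: measurable_funepos.
Qed.

End sandwich.

(** * Measurability and substitutions in the plane *)

Section plane_topology.
Context {R : realType}.
Notation mu := (@lebesgue_measure R).
Notation mu2 := ((@lebesgue_measure R) \x (@lebesgue_measure R))%E.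
Notation plane := (measurableTypeR R * measurableTypeR R)%type.

Lemma plane_nbhsP (A : set (R * R)) (z : R * R) : nbhs z A <->
  exists2 e : R, 0 < e &
    forall w, `|z.1 - w.1| < e -> `|z.2 - w.2| < e -> A w.
Proof.
split=> [/nbhs_ballP[e /= e0 eA]|[e e0 eA]].
  by exists e => // w w1 w2; apply: eA; split.
by apply/nbhs_ballP; exists e => //= w [w1 w2]; apply: eA.
Qed.

Lemma plane_closureP (A : set (R * R)) (z : R * R) : closure A z <->
  forall e : R, 0 < e -> exists w, [/\ A w, `|z.1 - w.1| < e & `|z.2 - w.2| < e].
Proof.
split=> [zA e e0|zA B /plane_nbhsP[e e0 eB]].
  have /zA[w [Aw [w1 w2]]] : nbhs z [set w | `|z.1 - w.1| < e /\ `|z.2 - w.2| < e].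
    by apply/plane_nbhsP; exists e => // w; split.
  by exists w.
by have [w [Aw w1 w2]] := zA e e0; exists w; split => //; apply: eB.
Qed.

(** Rational boxes form a countable base, and they belong to the product sigma-algebra. *)
Lemma open_plane_measurable (O : set (R * R)) : open O -> measurable (O : set plane).
Proof.
move=> oO.
pose box (a b e : rat) : set plane := ball (ratr a : R) (ratr e : R) `*` ball (ratr b : R) (ratr e : R).
pose F a b e : set plane := if `[< box a b e `<=` O >] then box a b e else set0.
have -> : O = \bigcup_a \bigcup_b \bigcup_e F a b e.
  apply/seteqP; split=> [z Oz|z [a _ [b _ [e _]]]]; last first.
    by rewrite /F; case: asboolP => // h /h.
  have /plane_nbhsP[e e0 eO] : nbhs z O by exact: open_nbhs_nbhs.
  have e40 : 0 < e / 4 by lra.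
  have [q /=] := rat_in_itvoo e40; rewrite in_itv/= => /andP[q0 qe].
  have [a] : exists a : rat, ratr a \in `]z.1 - ratr q, z.1 + ratr q[.
    by apply: rat_in_itvoo; lra.
  rewrite in_itv/= => /andP[a1 a2].
  have [b] : exists b : rat, ratr b \in `]z.2 - ratr q, z.2 + ratr q[.
    by apply: rat_in_itvoo; lra.
  rewrite in_itv/= => /andP[b1 b2].
  exists a => //; exists b => //; exists q => //; rewrite /F ifT; last first.
    apply/asboolP => w [/= w1 w2]; apply: eO.
      by move: w1; rewrite /ball/= !ltr_norml => /andP[? ?]; apply/andP; split; lra.
    by move: w2; rewrite /ball/= !ltr_norml => /andP[? ?]; apply/andP; split; lra.
  by split; rewrite /ball/= ltr_norml; apply/andP; split; lra.
apply: bigcupT_measurable_rat => a; apply: bigcupT_measurable_rat => b.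
apply: bigcupT_measurable_rat => e; rewrite /F; case: asboolP => // _.
by apply: measurableX; exact: measurable_ball.
Qed.

Lemma closed_plane_measurable (A : set (R * R)) : closed A -> measurable (A : set plane).
Proof.
move=> cA; rewrite -[A]setCK; apply: measurableC; apply: open_plane_measurable.
exact: closed_openC.
Qed.

(* Cover the curve by [n] squares of side [O(1/n)]. *)
Lemma lipschitz_curve_null (g : R -> R * R) (L : R) (N : set plane) :
  0 < L ->
  (forall s t, `|(g s).1 - (g t).1| <= `|s - t|) ->
  (forall s t, `|(g s).2 - (g t).2| <= `|s - t|) ->
  measurable N -> N `<=` g @` `[0, L[ -> mu2 N = 0%E.
Proof.
move=> L0 g1 g2 mN Ng.
have bound (n : nat) : (mu2 N <= (4 * L ^+ 2 / n.+1%:R)%:E)%E.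
  pose r := L / n.+1%:R; have r0 : 0 < r by rewrite divr_gt0.
  pose F (i : nat) : set plane :=
    closed_ball (g (i%:R * r)).1 r `*` closed_ball (g (i%:R * r)).2 r.
  have mF i : measurable (F i) by apply: measurableX; exact: measurable_closed_ball.
  have FE i : (mu2 (F i) = (4 * r ^+ 2)%:E)%E.
    rewrite product_measure1E; [|exact: measurable_closed_ball..].
    transitivity ((r *+ 2)%:E * (r *+ 2)%:E)%E.
      by congr (_ * _)%E; apply: lebesgue_measure_closed_ball; exact: ltW.
    by rewrite -EFinM; congr (_%:E); rewrite -[r *+ 2]mulr_natl; ring.
  have NF : N `<=` \big[setU/set0]_(i < n.+1) F i.
    move=> z /Ng[s /=]; rewrite in_itv/= => /andP[s0 sL] <-.
    have [m ms] : exists m : nat, m%:R * r <= s < m.+1%:R * r.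
      exists (Num.truncn (s / r)).
      have sr : 0 <= s / r by rewrite divr_ge0// ltW.
      have := truncn_itv sr; rewrite -ler_pdivlMr// -ltr_pdivrMr//.
    have mn : (m < n.+1)%N.
      case/andP: ms => ms _; rewrite -(ltr_nat R) -(ltr_pM2r r0).
      rewrite (le_lt_trans ms)// (lt_le_trans sL)//.
      by rewrite /r mulrC divfK ?lexx// pnatr_eq0.
    rewrite -bigcup_mkord; exists m => //; rewrite /F.
    have hs : `|m%:R * r - s| <= r.
      move: ms; rewrite -natr1 mulrDl mul1r ler_norml => /andP[? ?].
      by apply/andP; split; lra.
    split; rewrite closed_ballE//= /closed_ball_/=.
      exact: le_trans (g1 _ _) hs.
    exact: le_trans (g2 _ _) hs.
  have := @content_subadditive _ _ _ mu2 N F n.+1 (fun i _ => mF i) mN NF.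
  move/le_trans; apply.
  rewrite (eq_bigr (fun=> (4 * r ^+ 2)%:E)); last by move=> k _; exact: FE.
  rewrite sumEFin lee_fin sumr_const card_ord -[_ *+ n.+1]mulr_natr /r.
  have : n.+1%:R != 0 :> R by rewrite pnatr_eq0.
  move: n.+1%:R => k k0; rewrite [leLHS](_ : _ = 4 * L ^+ 2 / k)//.
  by field.
apply/eqP; rewrite eq_le measure_ge0 andbT; apply/lee_addgt0Pr => e e0.
rewrite add0e; pose n := Num.truncn (4 * L ^+ 2 / e).
apply: (le_trans (bound n)); rewrite lee_fin ler_pdivrMr// [leRHS]mulrC.
by have /ltW := truncnS_gt (4 * L ^+ 2 / e); rewrite ler_pdivrMr.
Qed.

Lemma bbs2_shear (f : R * R -> R) (c s : R) : c != 0 -> bbs2 f ->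
  bbs2 (fun z : plane => f (c^-1 * z.1 - s / c * z.2, z.2)).
Proof.
move=> c0 [mf [B hB]]; split.
  apply: (measurableT_comp mf); apply: measurable_fun_pair => //.
  by apply: measurable_realfun.measurable_funB; apply: measurable_funM.
have B0 : 0 <= B by rewrite (le_trans _ (hB (0, 0)).1).
exists (Num.max B ((`|c| + `|s|) * B)) => -[t y]; split.
  by rewrite le_max (hB _).1.
rewrite {1}/norm2 lt_max => tyB; apply: (hB _).2; rewrite /norm2 /= lt_max.
have [By|yB] := ltP B `|y|; first by rewrite orbT.
rewrite orbF; move: tyB => /orP[|]; rewrite gt_max /= => /andP[h1 h2]; last first.
  by move: h1; rewrite ltNge yB.
rewrite ltNge; apply/negP => hc; move: h2; rewrite ltNge => /negP; apply.
rewrite [X in `|X|](_ : t = c * (c^-1 * t - s / c * y) + s * y :> R); last by field.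
rewrite mulrDl (le_trans (ler_normD _ _))// !normrM.
by rewrite lerD// ler_wpM2l.
Qed.

(** For [u = (c, s)] the points [(c^-1 * t - s / c * y, y)] form the line [dot z u = t]. This is
    Fubini along the lines orthogonal to [u], obtained from one-dimensional substitutions rather
    than from a rotation. *)
Lemma shear_integral (f : R * R -> R) (c s : R) : c != 0 -> bbs2 f ->
  \int[mu2]_z f z = \int[mu]_t (`|c^-1| * \int[mu]_y f (c^-1 * t - s / c * y, y)).
Proof.
move=> c0 bf; have ci0 : c^-1 != 0 by rewrite invr_eq0.
have bF := bbs2_shear s c0 bf.
transitivity (\int[mu]_y (`|c^-1| * \int[mu]_t f (c^-1 * t - s / c * y, y))).
  rewrite Rint_prod2//; apply: eq_Rintegral => y _.
  by rewrite (Rint_affine (- (s / c * y)) ci0 (bbs2_slice2 y bf)).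
rewrite (RintZ norm1_fin); last exact: (bbs2_fubini2 bF).
rewrite (RintZ norm1_fin); last exact: (bbs2_fubini1 bF).
by rewrite (Rint_swap bF).
Qed.

Lemma bbs2_dilation (f : R * R -> R) (k : R) : 0 < k -> bbs2 f ->
  bbs2 (fun z : plane => f (k * z.1, k * z.2)).
Proof.
move=> k0 [mf [B hB]]; split.
  by apply: (measurableT_comp mf); apply: measurable_fun_pair; apply: measurable_funM.
exists (Num.max B (B / k)) => -[x y]; split; first by rewrite le_max (hB _).1.
rewrite {1}/norm2 gt_max => /andP[_ h]; apply: (hB _).2; rewrite /norm2 /=.
by rewrite !normrM (gtr0_norm k0) -maxr_pMr ?ltW// mulrC -ltr_pdivrMr.
Qed.

Lemma dilation_integral (f : R * R -> R) (k : R) : 0 < k -> bbs2 f ->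
  \int[mu2]_z f z = k ^+ 2 * \int[mu2]_z f (k * z.1, k * z.2).
Proof.
move=> k0 bf; have kn : k != 0 by rewrite gt_eqF.
have bF := bbs2_dilation k0 bf.
rewrite (Rint_prod1 bf) (Rint_prod1 bF) (Rint_affine 0 kn (bbs2_fubini1 bf)).
rewrite (gtr0_norm k0) expr2 -mulrA.
congr (_ * _); rewrite -(RintZ norm1_fin); last exact: (bbs2_fubini1 bF).
apply: eq_Rintegral => x _.
rewrite (Rint_affine 0 kn (bbs2_slice1 _ bf)) gtr0_norm//; congr (_ * _).
by apply: eq_Rintegral => y _; rewrite !addr0.
Qed.

Lemma swap_integral (f : R * R -> R) : bbs2 f ->
  \int[mu2]_z f z = \int[mu2]_z f (z.2, z.1).
Proof. by move=> bf; rewrite Rint_prod1// (Rint_prod2 (bbs2_swap bf)). Qed.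

End plane_topology.

(** * Support function and chords of a compact convex set *)

Section planar_body.
Context {R : realType}.
Notation mu := (@lebesgue_measure R).
Notation mu2 := ((@lebesgue_measure R) \x (@lebesgue_measure R))%E.
Notation plane := (measurableTypeR R * measurableTypeR R)%type.

Definition perp (u : R * R) : R * R := (- u.2, u.1).

Definition compact_convex (K : set (R * R)) := [/\ closed K,
  exists D, forall z, K z -> `|z.1| <= D /\ `|z.2| <= D &
  forall p q t, K p -> K q -> 0 <= t -> t <= 1 ->
    K ((1 - t) * p.1 + t * q.1, (1 - t) * p.2 + t * q.2)].

Lemma convex_comb_lt (t a b e : R) : 0 <= t -> t <= 1 -> `|a| < e -> `|b| < e ->
  `|(1 - t) * a + t * b| < e.
Proof.
move=> t0 t1 ae be; have : Num.max `|a| `|b| < e by rewrite gt_max ae be.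
apply: le_lt_trans; set m := Num.max _ _.
have am : `|a| <= m by rewrite le_max lexx.
have bm : `|b| <= m by rewrite le_max lexx orbT.
rewrite (le_trans (ler_normD _ _))// !normrM (ger0_norm t0) ger0_norm ?subr_ge0//.
by rewrite (_ : m = (1 - t) * m + t * m); [rewrite lerD// ler_wpM2l// subr_ge0|ring].
Qed.

Lemma closure_compact_convex (C : set (R * R)) : convex_body C ->
  compact_convex (closure C).
Proof.
move=> [bC cC _]; split; first exact: closed_closure.
- have [M [_ /(_ (M + 1))]] := bC; rewrite ltrDl => /(_ ltr01) hM.
  exists (M + 2) => z /plane_closureP /(_ 1 ltr01)[w [/hM /= wM w1 w2]].
  have : `|w.1| <= M + 1 /\ `|w.2| <= M + 1.
    by split; rewrite (le_trans _ wM)// prod_normE le_max lexx ?orbT.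
  move=> [w3 w4]; split.
    by rewrite -[z.1](subrK w.1) (le_trans (ler_normD _ _))//; lra.
  by rewrite -[z.2](subrK w.2) (le_trans (ler_normD _ _))//; lra.
- move=> p q t /plane_closureP pC /plane_closureP qC t0 t1.
  apply/plane_closureP => e e0.
  have [p' [Cp p1 p2]] := pC e e0; have [q' [Cq q1 q2]] := qC e e0.
  exists ((1 - t) * p'.1 + t * q'.1, (1 - t) * p'.2 + t * q'.2); split => /=.
  + have k0 : 0 <= 1 - t by rewrite subr_ge0.
    have k1 : 1 - t <= 1 by rewrite lerBlDr lerDl.
    have := cC p' q' (Itv01 k0 k1) (mem_set Cp) (mem_set Cq).
    move/set_mem; congr C; rewrite /conv/= /unstable.onem subKr.
    by [].
  + rewrite (_ : _ - _ = (1 - t) * (p.1 - p'.1) + t * (q.1 - q'.1)); last ring.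
    exact: convex_comb_lt.
  + rewrite (_ : _ - _ = (1 - t) * (p.2 - p'.2) + t * (q.2 - q'.2)); last ring.
    exact: convex_comb_lt.
Qed.

Lemma compact_convex_compact K : compact_convex K -> compact K.
Proof.
move=> [cK [D KD] _].
apply: (@subclosed_compact _ K (`[- D, D] `*` `[- D, D])) => //.
  by apply: compact_setX; exact: segment_compact.
by move=> z /KD[z1 z2]; split; rewrite /= in_itv/= -ler_norml.
Qed.

Lemma dot_continuous (u : R * R) : continuous (fun z : R * R => dot z u).
Proof.
move=> z; apply: cvgD; apply: cvgM; (try exact: cvg_cst).
- exact: cvg_fst.
- exact: cvg_snd.
Qed.

Lemma dotDl (x y u : R * R) : dot (x + y) u = dot x u + dot y u.
Proof. by rewrite /dot /=; ring. Qed.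

Lemma dotNl (x u : R * R) : dot (- x) u = - dot x u.
Proof. by rewrite /dot /=; ring. Qed.

Lemma dotBl (x y u : R * R) : dot (x - y) u = dot x u - dot y u.
Proof. by rewrite dotDl dotNl. Qed.

Lemma dot_conv (p q u : R * R) (t : R) :
  dot ((1 - t) * p.1 + t * q.1, (1 - t) * p.2 + t * q.2) u =
  (1 - t) * dot p u + t * dot q u.
Proof. by rewrite /dot /=; ring. Qed.

Lemma dot_min (A : set (R * R)) (u : R * R) : compact A -> A !=set0 ->
  exists2 p, A p & forall z, A z -> dot p u <= dot z u.
Proof.
move=> cA A0; have [|p pA pm] := @compact_EVT_min _ R (fun z => dot z u) A A0 cA.
  by apply: continuous_subspaceT; exact: dot_continuous.
by exists p; [exact: set_mem|move=> z zA; apply: pm; exact: mem_set].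
Qed.

(** The support function with an infimum in place of the usual supremum, to match [normals]:
    directions are inner normals. *)
Definition supp (K : set (R * R)) (u : R * R) : R := inf [set dot a u | a in K].

Lemma dot_bounded (D : R) (u z : R * R) :
  `|z.1| <= D -> `|z.2| <= D -> `|dot z u| <= D * (`|u.1| + `|u.2|).
Proof.
move=> z1 z2; rewrite /dot (le_trans (ler_normD _ _))// !normrM mulrDr.
by rewrite lerD// ler_wpM2r.
Qed.

Lemma supp_attained K u : compact_convex K -> K !=set0 ->
  exists2 p, K p & dot p u = supp K u.
Proof.
move=> cK K0; have [p Kp pm] := dot_min u (compact_convex_compact cK) K0.
exists p => //; apply/eqP; rewrite eq_le; apply/andP; split.
  apply: lb_le_inf; first by exists (dot p u), p.
  by move=> _ [z Kz <-]; exact: pm.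
by apply: ge_inf; [exists (dot p u) => _ [z Kz <-]; exact: pm|exists p].
Qed.

Lemma supp_le K u z : compact_convex K -> K z -> supp K u <= dot z u.
Proof.
move=> cK Kz; have K0 : K !=set0 by exists z.
have [p Kp pm] := dot_min u (compact_convex_compact cK) K0.
by apply: ge_inf; [exists (dot p u) => _ [w Kw <-]; exact: pm|exists z].
Qed.

Lemma supp_closure (C : set (R * R)) u : convex_body C ->
  supp (closure C) u = supp C u.
Proof.
move=> bC; have cK := closure_compact_convex bC.
have [z Cz] : C !=set0 by have [_ _ [z /interior_subset Cz]] := bC; exists z.
have lbC : has_lbound [set dot a u | a in C].
  exists (supp (closure C) u) => _ [w Cw <-]; apply: supp_le => //.
  exact: subset_closure.
apply/eqP; rewrite eq_le; apply/andP; split.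
  apply: lb_le_inf; first by exists (dot z u), z.
  by move=> _ [w Cw <-]; apply: supp_le => //; exact: subset_closure.
have [|p pC <-] := supp_attained u cK; first by exists z; exact: subset_closure.
apply/ler_addgt0Pr => e e0.
have k0 : 0 < `|u.1| + `|u.2| + 1 by rewrite ltr_wpDl ?addr_ge0.
move/plane_closureP: pC => /(_ (e / (`|u.1| + `|u.2| + 1)) (divr_gt0 e0 k0)).
move=> [w [Cw w1 w2]]; have : inf [set dot a u | a in C] <= dot w u by apply: ge_inf => //; exists w.
move/le_trans; apply; rewrite -lerBlDl -dotBl (le_trans (ler_norm _))//.
apply: (le_trans (dot_bounded (D := e / (`|u.1| + `|u.2| + 1)) _ _ _)).
- by rewrite distrC ltW.
- by rewrite distrC ltW.
- by rewrite mulrAC ler_pdivrMr// ler_wpM2l ?(ltW e0)// lerDl.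
Qed.

(** The length of the section [dot z u = t], as a supremum of differences along the line; off the
    body it is 0, the supremum of the empty set. *)
Definition chord (K : set (R * R)) (u : R * R) (t : R) : R :=
  sup [set v | exists p q, [/\ K p, K q, dot p u = t, dot q u = t &
    v = dot (q - p) (perp u)]].

Lemma chord_attained K u t : compact_convex K -> (exists2 z, K z & dot z u = t) ->
  exists p q, [/\ K p, K q, dot p u = t, dot q u = t &
    dot (q - p) (perp u) = chord K u t /\
    forall z, K z -> dot z u = t ->
      dot p (perp u) <= dot z (perp u) /\ dot z (perp u) <= dot q (perp u)].
Proof.
move=> cK [z Kz zt]; pose A := K `&` [set z | dot z u = t].
have cA : compact A.
  apply: (@subclosed_compact _ A K) => //; last 2 first.
  - exact: compact_convex_compact.
  - by move=> w [].
  apply: closedI; first by have [] := cK.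
  apply: (@preimage_closed _ _ (fun z => dot z u) [set x | x = t]).
  - by move=> w _; exact: dot_continuous.
  - exact: closed_eq.
have A0 : A !=set0 by exists z.
have [p [Kp pt] pm] := dot_min (perp u) cA A0.
have [q [Kq qt] qm] := dot_min (- perp u) cA A0.
have qm' w : A w -> dot w (perp u) <= dot q (perp u).
  by move/qm; rewrite /dot /=; lra.
exists p, q; split => //; split; last by move=> w Kw wt; split; [apply: pm|apply: qm'].
rewrite /chord; set B := (X in sup X).
have ubB : ubound B (dot (q - p) (perp u)).
  move=> _ [p' [q' [Kp' Kq' pt' qt' ->]]]; rewrite !dotBl lerB//.
    by apply: qm'.
  by apply: pm.
have Bqp : B (dot (q - p) (perp u)) by exists p, q.
apply/eqP; rewrite eq_le; apply/andP; split.
  by apply: ub_le_sup => //; exists (dot (q - p) (perp u)).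
by apply: ge_sup => //; exists (dot (q - p) (perp u)).
Qed.

Lemma chord_out K u t : (forall z, K z -> dot z u <> t) -> chord K u t = 0.
Proof.
move=> out; rewrite /chord (_ : [set v | _] = set0) ?sup0//.
by apply/seteqP; split => // v [p [q [/out pt _ /pt]]].
Qed.

Lemma chord_ge K u t p q : compact_convex K -> K p -> K q -> dot p u = t ->
  dot q u = t -> dot (q - p) (perp u) <= chord K u t.
Proof.
move=> cK Kp Kq pt qt.
have [|p' [q' [_ _ _ _ [<- h]]]] := chord_attained (t := t) (u := u) cK; first by exists p.
by rewrite !dotBl lerB//; [have [] := h q Kq qt|have [] := h p Kp pt].
Qed.

Lemma chord_ge0 K u t : compact_convex K -> 0 <= chord K u t.
Proof.
move=> cK; have [[z Kz zt]|out] := pselect (exists2 z, K z & dot z u = t).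
  by rewrite (le_trans _ (chord_ge cK Kz Kz zt zt))// subrr /dot /= !mul0r addr0.
by rewrite chord_out// => z Kz zt; apply: out; exists z.
Qed.

Lemma chord_pos_line K u t : chord K u t != 0 -> exists2 z, K z & dot z u = t.
Proof.
move=> h; apply: contrapT => h'; move/eqP: h; apply; apply: chord_out => z Kz zt.
by apply: h'; exists z.
Qed.

(* Convex combinations of the end points of two parallel chords bound a segment
   of the intermediate section. *)
Lemma chord_concave K u x y z : compact_convex K ->
  (exists2 p, K p & dot p u = x) -> (exists2 p, K p & dot p u = z) ->
  x <= y -> y <= z ->
  chord K u x * (z - y) + chord K u z * (y - x) <= chord K u y * (z - x).
Proof.
move=> cK hx hz xy yz; have [_ _ cvx] := cK.
have [xz|xz] := ltP x z; last first.
  have -> : z = x by lra.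
  have -> : y = x by lra.
  by rewrite !subrr !mulr0 addr0.
have [p [q [Kp Kq px qx [<- _]]]] := chord_attained cK hx.
have [p' [q' [Kp' Kq' pz qz [<- _]]]] := chord_attained cK hz.
have zx : 0 < z - x by lra.
pose t := (y - x) / (z - x).
have t0 : 0 <= t by rewrite divr_ge0//; lra.
have t1 : t <= 1 by rewrite ler_pdivrMr//; lra.
have tz : t * (z - x) = y - x by rewrite divfK// gt_eqF.
have ty : (1 - t) * x + t * z = y by rewrite -[RHS](subrK x) -tz; ring.
have := chord_ge (u := u) (t := y) cK (cvx _ _ _ Kp Kp' t0 t1) (cvx _ _ _ Kq Kq' t0 t1).
rewrite !dot_conv px pz qx qz => /(_ ty ty) /(ler_wpM2r (ltW zx)).
apply: le_trans; rewrite [leRHS](_ : _ = dot (q - p) (perp u) * ((z - x) - t * (z - x)) +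
   dot (q' - p') (perp u) * (t * (z - x))); last by rewrite /dot /=; ring.
by rewrite tz (_ : z - x - (y - x) = z - y); [|ring].
Qed.

Lemma supp_opp_ge K u z : compact_convex K -> K z -> dot z u <= - supp K (- u).
Proof.
move=> cK Kz; have := supp_le (- u) cK Kz; rewrite lerNr; congr (_ <= _).
by rewrite /dot /=; ring.
Qed.

Lemma line_nonempty K u t : compact_convex K -> K !=set0 ->
  supp K u <= t -> t <= - supp K (- u) -> exists2 z, K z & dot z u = t.
Proof.
move=> cK K0 t0 t1; have [_ _ cvx] := cK.
have [p Kp pt] := supp_attained u cK K0.
have [q Kq qt] := supp_attained (- u) cK K0.
have qt' : dot q u = - supp K (- u) by rewrite -qt /dot /=; ring.
have [pq|pq] := ltP (supp K u) (- supp K (- u)); last first.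
  by exists p => //; rewrite pt; lra.
pose k := (t - supp K u) / (- supp K (- u) - supp K u).
have pq0 : 0 < - supp K (- u) - supp K u by lra.
have k0 : 0 <= k by rewrite divr_ge0//; lra.
have k1 : k <= 1 by rewrite ler_pdivrMr//; lra.
have kE : k * (- supp K (- u) - supp K u) = t - supp K u by rewrite divfK// gt_eqF.
exists ((1 - k) * p.1 + k * q.1, (1 - k) * p.2 + k * q.2); first exact: cvx.
by rewrite dot_conv pt qt' -[RHS](subrK (supp K u)) -kE; ring.
Qed.

Definition unit_dir (u : R * R) := u.1 ^+ 2 + u.2 ^+ 2 = 1.

Lemma bbs2_compact_convex K : compact_convex K -> bbs2 (\1_K : plane -> R).
Proof.
move=> [cK [D KD] _]; apply: (bbs_indic (M := D)); first exact: closed_plane_measurable.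
by move=> z /KD[z1 z2]; rewrite /norm2 ge_max z1 z2.
Qed.

(** The line is parametrised by the ordinate, one unit of which corresponds to the length
    [|u.1^-1|]. *)
Lemma section_length K u t : compact_convex K -> unit_dir u -> u.1 != 0 ->
  `|u.1^-1| * \int[mu]_y \1_K (u.1^-1 * t - u.2 / u.1 * y, y) = chord K u t.
Proof.
move=> cK u1 c0; have [_ _ cvx] := cK.
pose line y : R * R := (u.1^-1 * t - u.2 / u.1 * y, y).
have lineu y : dot (line y) u = t by rewrite /line /dot /=; field.
have lineE z : dot z u = t -> z = line z.2.
  case: z => a b; rewrite /dot /line /= => <-; congr pair; field.
  by [].
have perpE z : dot z u = t -> dot z (perp u) = z.2 / u.1 - u.2 / u.1 * t.
  move=> zt; rewrite {1}(lineE _ zt) /line /dot /perp /=.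
  have -> : z.2 / u.1 = z.2 * (u.1 ^+ 2 + u.2 ^+ 2) / u.1 by rewrite u1 mulr1.
  by field.
have [[z Kz zt]|out] := pselect (exists2 z, K z & dot z u = t); last first.
  rewrite chord_out; last by move=> z Kz zt; apply: out; exists z.
  rewrite Rint0_eq ?mulr0// => y; rewrite indicE memNset// => Ky.
  by apply: out; exists (line y).
have [|p [q [Kp Kq pt qt [<- pq]]]] := chord_attained (t := t) (u := u) cK.
  by exists z.
have seg (a b : R * R) : K a -> K b -> dot a u = t -> dot b u = t -> a.2 <= b.2 ->
    (forall w, K w -> dot w u = t -> a.2 <= w.2 /\ w.2 <= b.2) ->
    \int[mu]_y \1_K (line y) = b.2 - a.2.
  move=> Ka Kb at_ bt ab h; rewrite -Rint_segment//; apply: eq_Rintegral => y _.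
  rewrite segE indicE; congr (_%:R); congr nat_of_bool.
  apply/idP/idP => [/set_mem Ky|/andP[ay yb]].
    by have /= [-> ->] := h _ Ky (lineu y).
  apply/mem_set; have [ab'|ba] := ltP a.2 b.2; last first.
    have -> : y = a.2 by lra.
    by rewrite -lineE.
  have ab0 : 0 < b.2 - a.2 by lra.
  pose k := (y - a.2) / (b.2 - a.2).
  have k0 : 0 <= k by rewrite divr_ge0//; lra.
  have k1 : k <= 1 by rewrite ler_pdivrMr//; lra.
  have kE : k * (b.2 - a.2) = y - a.2 by rewrite divfK// gt_eqF.
  have yE : (1 - k) * a.2 + k * b.2 = y by rewrite -[RHS](subrK a.2) -kE; ring.
  have := cvx a b k Ka Kb k0 k1; rewrite yE.
  have -> : a.1 = u.1^-1 * t - u.2 / u.1 * a.2 by have /(congr1 fst) := lineE _ at_.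
  have -> : b.1 = u.1^-1 * t - u.2 / u.1 * b.2 by have /(congr1 fst) := lineE _ bt.
  congr K; congr pair; rewrite -[in RHS]yE; ring.
have pqE : dot (q - p) (perp u) = (q.2 - p.2) / u.1.
  by rewrite dotBl !perpE//; ring.
have pq' w : K w -> dot w u = t -> p.2 / u.1 <= w.2 / u.1 /\ w.2 / u.1 <= q.2 / u.1.
  by move=> Kw wt; have := pq w Kw wt; rewrite !perpE// !lerD2r.
(* The sign of [u.1] decides which end of the chord has the smaller ordinate. *)
rewrite pqE; have [u0|u0|] := ltgtP 0 u.1; last by move=> u0; rewrite -u0 eqxx in c0.
  have pq2 w : K w -> dot w u = t -> p.2 <= w.2 /\ w.2 <= q.2.
    by move=> Kw wt; have := pq' w Kw wt; rewrite !ler_pM2r ?invr_gt0.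
  rewrite (seg p q)//; last by have [] := pq2 _ Kp pt; have [] := pq2 _ Kq qt; lra.
  by rewrite gtr0_norm ?invr_gt0// mulrC.
have pq2 w : K w -> dot w u = t -> q.2 <= w.2 /\ w.2 <= p.2.
  by move=> Kw wt; have := pq' w Kw wt; rewrite !ler_nM2r ?invr_lt0// => -[].
rewrite (seg q p)//; last by have [] := pq2 _ Kp pt; have [] := pq2 _ Kq qt; lra.
by rewrite ltr0_norm ?invr_lt0//; ring.
Qed.

Lemma bbs2_indic_dot K u (g : R -> R) : compact_convex K -> measurable_fun setT g ->
  (forall x, `|g x| <= 1) -> bbs2 (fun z => \1_K z * g (dot z u)).
Proof.
move=> cK mg g1; apply: (bbsM (bbs2_compact_convex cK) (K := 1)) => //.
apply: (measurableT_comp mg).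
by apply: measurable_realfun.measurable_funD; apply: measurable_funM.
Qed.

(** The reflection that settles [u.1 = 0]: the swapped direction has a non-zero first coordinate. *)
Let swap_set (K : set (R * R)) : set (R * R) := [set z | K (z.2, z.1)].

Let swap_compact_convex K : compact_convex K -> compact_convex (swap_set K).
Proof.
move=> [cK [D KD] cvx]; split.
- move=> z /plane_closureP h; apply: (cK (z.2, z.1)).
  apply/plane_closureP => e e0; have [w [Kw w1 w2]] := h e e0.
  by exists (w.2, w.1).
- by exists D => z /KD[].
- by move=> p q t Kp Kq t0 t1; have := cvx _ _ _ Kp Kq t0 t1.
Qed.

Let swap_chord K u t : chord (swap_set K) (u.2, u.1) t = chord K u t.
Proof.
rewrite /chord; congr sup; apply/seteqP; split => v [p [q [Kp Kq pt qt ->]]].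
  (* A reflection reverses the orientation, hence the exchange of the two ends. *)
  exists (q.2, q.1), (p.2, p.1); split => //.
  - by rewrite -qt /dot /=; ring.
  - by rewrite -pt /dot /=; ring.
  - by rewrite /dot /=; ring.
exists (q.2, q.1), (p.2, p.1); rewrite /swap_set /= -!surjective_pairing; split => //.
- by rewrite -qt /dot /=; ring.
- by rewrite -pt /dot /=; ring.
- by rewrite /dot /=; ring.
Qed.

Let marginal_aux K u : compact_convex K -> unit_dir u -> u.1 != 0 ->
  bbsR (chord K u) /\
  forall g : R -> R, measurable_fun setT g -> (forall x, `|g x| <= 1) ->
  \int[mu2]_z (\1_K z * g (dot z u)) = \int[mu]_t (chord K u t * g t).
Proof.
move=> cK u1 c0; split.
  have := bbsZ `|u.1^-1| (bbs2_fubini1 (bbs2_shear u.2 c0 (bbs2_compact_convex cK))).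
  by congr bbs; apply/funext => t; exact: section_length.
move=> g mg g1; rewrite (shear_integral u.2 c0 (bbs2_indic_dot u cK mg g1)).
apply: eq_Rintegral => t _; rewrite -section_length// -[RHS]mulrA.
congr (_ * _); rewrite [RHS]mulrC -(RintZ norm1_fin); last first.
  exact: (bbs2_slice1 t (bbs2_shear u.2 c0 (bbs2_compact_convex cK))).
apply: eq_Rintegral => y _; rewrite mulrC; congr (g _ * _).
by rewrite /dot /=; field.
Qed.

(** The chord function is the density of the image of the area on [K] under [dot _ u]; this carries
    plane transforms over to the line. *)
Lemma marginal K u : compact_convex K -> unit_dir u ->
  bbsR (chord K u) /\
  forall g : R -> R, measurable_fun setT g -> (forall x, `|g x| <= 1) ->
  \int[mu2]_z (\1_K z * g (dot z u)) = \int[mu]_t (chord K u t * g t).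
Proof.
move=> cK u1; have [c0|c0] := eqVneq u.1 0; last exact: marginal_aux.
have s0 : u.2 != 0.
  by apply/eqP => s0; move/eqP: u1; rewrite c0 s0 expr0n addr0 eq_sym oner_eq0.
have [|//|bc h] := @marginal_aux (swap_set K) (u.2, u.1) (swap_compact_convex cK).
  by rewrite /unit_dir /= addrC.
have cE : chord (swap_set K) (u.2, u.1) = chord K u.
  by apply/funext => t; exact: swap_chord.
rewrite cE in bc h; split => // g mg g1; rewrite -(h g mg g1).
rewrite (swap_integral (bbs2_indic_dot u cK mg g1)).
apply: eq_Rintegral => z _.
by have -> : dot (z.2, z.1) u = dot z (u.2, u.1) by rewrite /dot /= addrC.
Qed.

(** Depth is measured in units of [l], later the inverse of the frequency, so that the estimates on
    profiles apply at distance 1 from the ends. *)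
Lemma chord_profile K u l : compact_convex K -> K !=set0 -> unit_dir u -> 0 < l ->
  concave_profile ((- supp K (- u) - supp K u) / l)
    (fun x => chord K u (supp K u + l * x)).
Proof.
move=> cK K0 u1 l0; split.
- have := bbs_affine (supp K u) (lt0r_neq0 l0) (marginal cK u1).1.
  by congr bbs; apply/funext => x; rewrite addrC.
- by move=> x; exact: chord_ge0.
- move=> x xW; apply: chord_out => z Kz zx; move/negP: xW; apply.
  have := supp_le u cK Kz; have := supp_opp_ge u cK Kz; rewrite zx => h1 h2.
  apply/andP; split; first by rewrite -(pmulr_rge0 _ l0); lra.
  by rewrite ler_pdivlMr//; lra.
- move=> x y z x0 xy yz; rewrite ler_pdivlMr// => zW.
  have h := @chord_concave K u (supp K u + l * x) (supp K u + l * y) (supp K u + l * z) cK.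
  have xl : l * x <= l * y by rewrite ler_pM2l.
  have yl : l * y <= l * z by rewrite ler_pM2l.
  have x0l : 0 <= l * x by rewrite mulr_ge0// ltW.
  rewrite -(ler_pM2l l0); move: h => /(_ _ _ _ _); have := line_nonempty (u := u) cK K0.
  move=> hl /(_ ltac:(apply: hl; lra) ltac:(apply: hl; lra) ltac:(lra) ltac:(lra)).
  by congr (_ <= _); ring.
Qed.

End planar_body.

(** * The energy in a fixed direction *)

Section boundary_curve.
Context {R : realType}.
Implicit Types (C : set (R * R)) (L : R) (gamma : R -> R * R).

Lemma abs_fst_enorm (z : R * R) : `|z.1| <= enorm z.
Proof.
rewrite -sqrtr_sqr ler_wsqrtr// /dot -!expr2.
by rewrite lerDl sqr_ge0.
Qed.

Lemma abs_snd_enorm (z : R * R) : `|z.2| <= enorm z.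
Proof.
rewrite -sqrtr_sqr ler_wsqrtr// /dot -!expr2.
by rewrite lerDr sqr_ge0.
Qed.

Lemma unit_dir_le1 (u : R * R) : unit_dir u -> `|u.1| <= 1 /\ `|u.2| <= 1.
Proof.
move=> u1; split; rewrite -(ler_pXn2r (_ : 0 < 2)%N) ?nnegrE// expr1n real_normK ?num_real//
  -u1 ?lerDl ?lerDr sqr_ge0//.
Qed.

Lemma unit_uvec (theta : R) : unit_dir (uvec theta).
Proof. exact: cos2Dsin2. Qed.

Lemma unit_perp (u : R * R) : unit_dir u -> unit_dir (perp u).
Proof. by rewrite /unit_dir /= sqrrN addrC. Qed.

Lemma dot_unit_bound (D : R) (u z : R * R) : unit_dir u -> `|z.1| <= D -> `|z.2| <= D ->
  `|dot z u| <= 2 * D.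
Proof.
move=> /unit_dir_le1[u1 u2] z1 z2; rewrite /dot (le_trans (ler_normD _ _))// !normrM.
by rewrite mulr_natl mulr2n lerD// -[leRHS]mulr1 ler_pM.
Qed.

Lemma dot_uvec_lipschitz (D : R) (z : R * R) s t : `|z.1| <= D -> `|z.2| <= D ->
  `|dot z (uvec s) - dot z (uvec t)| <= 2 * D * `|s - t|.
Proof.
move=> z1 z2; rewrite /dot /= (_ : _ - _ = z.1 * (cos s - cos t) + z.2 * (sin s - sin t)).
  rewrite (le_trans (ler_normD _ _))// !normrM -mulrA mulr_natl mulr2n.
  by rewrite lerD// ler_pM// ?cos_lipschitz ?sin_lipschitz.
by ring.
Qed.

Lemma body_closure_neq0 C : convex_body C -> closure C !=set0.
Proof.
by move=> [_ _ [z /interior_subset Cz]]; exists z; exact: subset_closure.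
Qed.

Lemma enormN (z : R * R) : enorm (- z) = enorm z.
Proof. by rewrite /enorm /dot /= !mulrNN. Qed.

(** The chord between two points is an inscribed polygon with one side. *)
Lemma arc_length_lipschitz C L gamma s t : arc_length_param C L gamma ->
  enorm (gamma s - gamma t) <= `|s - t|.
Proof.
move=> [_ _ _ _ len]; wlog ts : s t / t < s.
  move=> H; have [/H //|st|->] := ltgtP t s; last first.
    by rewrite !subrr normr0 /enorm /dot /= mul0r addr0 sqrtr0.
  by rewrite -enormN opprB distrC; exact: H.
have := len t s (ltW ts) => h.
have -> : `|s - t| = s - t by rewrite gtr0_norm// subr_gt0.
rewrite -lee_fin -h; apply: ereal_sup_ubound.
exists [:: s]; first exact: itv_partition1.
by rewrite /polygonal_length /= big_nat1.
Qed.

End boundary_curve.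

Lemma chord_opp {R : realType} (K : set (R * R)) u t : chord K (- u) (- t) = chord K u t.
Proof.
have dotrN (x : R * R) : dot x (- u) = - dot x u by rewrite /dot /=; ring.
have perpN (x : R * R) : dot x (perp (- u)) = - dot x (perp u) by rewrite /dot /=; ring.
congr sup; apply/seteqP; split => _ [p [q [Kp Kq pt qt ->]]]; exists q, p.
  by move: pt qt; rewrite !dotrN perpN !dotBl => /oppr_inj-> /oppr_inj->; split => //; ring.
by split => //; rewrite ?dotrN ?perpN ?pt ?qt// !dotBl; ring.
Qed.

(** * From the plane transform to the chord profile *)

Section fourier_profile.
Context {R : realType}.
Notation mu := (@lebesgue_measure R).
Notation mu2 := ((@lebesgue_measure R) \x (@lebesgue_measure R))%E.
Notation plane := (measurableTypeR R * measurableTypeR R)%type.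
Variables (C : set (R * R)) (L : R) (gamma : R -> R * R).
Hypotheses (bC : convex_body C) (aC : arc_length_param C L gamma).
Let K := closure C.
Let cK : compact_convex K := closure_compact_convex bC.

Let K0 : K !=set0 := body_closure_neq0 bC.

Let preim (k : R) (A : set (R * R)) : set plane := [set z | A (k * z.1, k * z.2)].

Let measurable_preim k A : measurable (A : set plane) -> measurable (preim k A).
Proof.
move=> mA; rewrite -[preim k A]setTI.
have mf : measurable_fun setT (fun z : plane => (k * z.1, k * z.2) : plane).
  by apply: measurable_fun_pair; apply: measurable_funM.
exact: mf.
Qed.

Let dilateE k : k != 0 -> dilate k = preim k^-1 :> (set (R * R) -> set (R * R)).
Proof.
move=> k0; apply/funext => A; apply/seteqP; split => [_ [z Az <-]|z Az].
  by rewrite /preim /= !mulrA mulVf// !mul1r -surjective_pairing.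
exists (k^-1 * z.1, k^-1 * z.2) => //.
by rewrite /GRing.scale /= /scale_pair/= /GRing.scale/= !mulrA mulfV// !mul1r -surjective_pairing.
Qed.

Let Rint_dilate k (f : R * R -> R) : 0 < k ->
  measurable_fun setT (f : plane -> R) ->
  \int[mu2]_(z in dilate k C) f z = \int[mu2]_(z in preim k^-1 K) f z.
Proof.
move=> k0 mf; rewrite /Rintegral; congr fine.
have kn : k != 0 by rewrite gt_eqF.
have mE1 : measurable (preim k^-1 K).
  by apply: measurable_preim; apply: closed_plane_measurable; exact: closed_closure.
have mE0 : measurable (preim k^-1 (interior C)).
  by apply: measurable_preim; apply: open_plane_measurable; exact: open_interior.
apply: (integral_sandwich (E0 := preim k^-1 (interior C))) => //.
- by rewrite dilateE// => z /interior_subset.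
- by rewrite dilateE// => z Cz; exact: subset_closure.
- have [L0 per inj img _] := aC.
  (* The boundary of the dilate, traversed over [[0, k * L[], is again 1-Lipschitz in each
     coordinate. *)
  have scale (h : R -> R) : (forall s t, `|h s - h t| <= `|s - t|) ->
      forall s t, `|k * h (s / k) - k * h (t / k)| <= `|s - t|.
    move=> hL s t; rewrite -mulrBr normrM gtr0_norm// mulrC -ler_pdivlMr//.
    by rewrite (le_trans (hL _ _))// -mulrBl normrM [`|k^-1|]gtr0_norm ?invr_gt0.
  apply: (@lipschitz_curve_null _ (fun s => (k * (gamma (s / k)).1, k * (gamma (s / k)).2)) (k * L)).
  + exact: mulr_gt0.
  + by apply: (scale (fun s => (gamma s).1)) => s t; exact: le_trans (abs_fst_enorm _) (arc_length_lipschitz s t aC).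
  + by apply: (scale (fun s => (gamma s).2)) => s t; exact: le_trans (abs_snd_enorm _) (arc_length_lipschitz s t aC).
  + exact: measurableD.
  + move=> z [Kz Cz].
    have : bdry C (k^-1 * z.1, k^-1 * z.2) by split.
    rewrite -img => -[s sL gs]; exists (k * s).
      move: sL; rewrite /= !in_itv/= => /andP[s0 sL].
      by rewrite mulr_ge0 ?(ltW k0)// ltr_pM2l.
    by rewrite mulrAC mulfV// mul1r gs /= !mulrA mulfV// !mul1r -surjective_pairing.
- exact/measurable_EFinP.
Qed.

Let Rint_dilate_dot k (g : R -> R) (v : R * R) : 0 < k -> measurable_fun setT g ->
  (forall x, `|g x| <= 1) ->
  \int[mu2]_(z in dilate k C) g (dot z v) =
  k ^+ 2 * \int[mu2]_z (\1_K z * g (k * dot z v)).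
Proof.
move=> k0 mg g1.
have md : measurable_fun setT (fun z : plane => g (dot z v)).
  apply: (measurableT_comp mg).
  by apply: measurable_realfun.measurable_funD; apply: measurable_funM.
rewrite Rint_dilate// Rintegral_indic.
have kn : k != 0 by rewrite gt_eqF.
have bf : bbs2 (fun z => \1_(preim k^-1 K) z * g (dot z v)).
  have k'0 : 0 < k^-1 by rewrite invr_gt0.
  have b0 : bbs2 (\1_(preim k^-1 K) : plane -> R).
    exact: (bbs2_dilation k'0 (bbs2_compact_convex cK)).
  exact: (bbsM b0 md (fun z => g1 _)).
rewrite (dilation_integral k0 bf); congr (_ * _); apply: eq_Rintegral => z _.
rewrite (_ : dot (k * z.1, k * z.2) v = k * dot z v); last by rewrite /dot /=; ring.
have zE : ((k * z.1, k * z.2) \in preim k^-1 K) = (z \in K).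
  apply/idP/idP => /set_mem h; apply/mem_set; move: h.
    by rewrite /preim /= !mulKf// -surjective_pairing.
  by rewrite /preim /= !mulKf// -surjective_pairing.
by rewrite !indicE zE.
Qed.

Definition cos_int (k : R) (u : R * R) := \int[mu2]_z (\1_K z * cos (k * dot z u)).
Definition sin_int (k : R) (u : R * R) := \int[mu2]_z (\1_K z * sin (k * dot z u)).

Let mcos k : measurable_fun setT (fun t : R => cos (k * t)).
Proof.
have := measurable_cos_affine k 0; congr measurable_fun.
by apply/funext => t; rewrite addr0.
Qed.

Let msin k : measurable_fun setT (fun t : R => sin (k * t)).
Proof.
have := measurable_sin_affine k 0; congr measurable_fun.
by apply/funext => t; rewrite addr0.
Qed.

Let ncos (x : R) : `|cos x| <= 1. Proof. by rewrite ler_norml cos_geN1 cos_le1. Qed.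
Let nsin (x : R) : `|sin x| <= 1. Proof. by rewrite ler_norml sin_geN1 sin_le1. Qed.

(** Moving the origin to the supporting line multiplies the transform by a phase, which the modulus
    does not see; the change of unit gives the factor [l ^+ 2]. *)
Let cos_sin_int u k l d : unit_dir u -> 0 < l -> k * l = 2 * pi * d ->
  let h := fun x => chord K u (supp K u + l * x) in
  cos_int k u ^+ 2 + sin_int k u ^+ 2 =
  l ^+ 2 * (cos_transform h d ^+ 2 + sin_transform h d ^+ 2).
Proof.
move=> u1 l0 kl h; have [bc mar] := marginal cK u1.
set a := supp K u.
have bh : bbsR h by have [] := chord_profile cK K0 u1 l0.
have ln := lt0r_neq0 l0.
have bhc : bbsR (fun x => h x * cos (2 * pi * d * x)) by apply: (bbsM bh (mcos _)).
have bhs : bbsR (fun x => h x * sin (2 * pi * d * x)) by apply: (bbsM bh (msin _)).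
have -> : cos_int k u = l * (cos (k * a) * cos_transform h d - sin (k * a) * sin_transform h d).
  rewrite /cos_int (mar (fun t => cos (k * t)))//.
  have b1 : bbsR (fun t => chord K u t * cos (k * t)) by exact: (bbsM bc (mcos _)).
  rewrite (Rint_affine a ln b1) gtr0_norm//; congr (_ * _).
  rewrite -(RintZ norm1_fin (cos (k * a)) bhc) -(RintZ norm1_fin (sin (k * a)) bhs).
  rewrite -(RintB norm1_fin (bbsZ _ bhc) (bbsZ _ bhs)).
  apply: eq_Rintegral => x _; rewrite /h.
  by rewrite (addrC (l * x)) mulrDr mulrA kl cosD; ring.
have -> : sin_int k u = l * (sin (k * a) * cos_transform h d + cos (k * a) * sin_transform h d).
  rewrite /sin_int (mar (fun t => sin (k * t)))//.
  have b1 : bbsR (fun t => chord K u t * sin (k * t)) by exact: (bbsM bc (msin _)).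
  rewrite (Rint_affine a ln b1) gtr0_norm//; congr (_ * _).
  rewrite -(RintZ norm1_fin (sin (k * a)) bhc) -(RintZ norm1_fin (cos (k * a)) bhs).
  rewrite -(RintD norm1_fin (bbsZ _ bhc) (bbsZ _ bhs)).
  apply: eq_Rintegral => x _; rewrite /h.
  by rewrite (addrC (l * x)) mulrDr mulrA kl sinD; ring.
move: (cos_transform h d) (sin_transform h d) => A B.
have := cos2Dsin2 (k * a); move: (cos _) (sin _) => x y xy.
transitivity (l ^+ 2 * ((x ^+ 2 + y ^+ 2) * (A ^+ 2 + B ^+ 2))); first by ring.
by rewrite xy mul1r.
Qed.

Definition radial_energy (rho theta : R) := \int[mu]_(delta in `[0, 1])
  (Normc.normc (fourier_indic (dilate delta C) (rho *: uvec theta))) ^+ 2.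

Let normc_fourier rho theta delta : 0 < delta ->
  Normc.normc (fourier_indic (dilate delta C) (rho *: uvec theta)) ^+ 2 =
  delta ^+ 4 * (cos_int (2 * pi * rho * delta) (uvec theta) ^+ 2 +
                sin_int (2 * pi * rho * delta) (uvec theta) ^+ 2).
Proof.
move=> d0; rewrite /Normc.normc /fourier_indic /cintegral.
rewrite sqr_sqrtr; last by rewrite addr_ge0// sqr_ge0.
have e (x : R * R) : - (2 * pi * dot x (rho *: uvec theta)) =
    - (2 * pi * rho) * dot x (uvec theta).
  by rewrite /dot /GRing.scale /= /scale_pair /GRing.scale /=; ring.
have -> : \int[mu2]_(x in dilate delta C) complex.Re (cis (- (2 * pi * dot x (rho *: uvec theta)))) =
    delta ^+ 2 * cos_int (2 * pi * rho * delta) (uvec theta).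
  under eq_Rintegral do rewrite /= e.
  rewrite (@Rint_dilate_dot delta (fun t => cos (- (2 * pi * rho) * t)))//.
  congr (_ * _); apply: eq_Rintegral => z _; congr (_ * _).
  by rewrite mulNr cosN mulrA.
have -> : \int[mu2]_(x in dilate delta C) complex.Im (cis (- (2 * pi * dot x (rho *: uvec theta)))) =
    delta ^+ 2 * - sin_int (2 * pi * rho * delta) (uvec theta).
  under eq_Rintegral do rewrite /= e.
  rewrite (@Rint_dilate_dot delta (fun t => sin (- (2 * pi * rho) * t)))//.
  have bs : bbs2 (fun z => \1_K z * sin (2 * pi * rho * delta * dot z (uvec theta))).
    exact: (bbs2_indic_dot _ cK (msin _)).
  rewrite -(RintN norm2_fin bs).
  congr (_ * _); apply: eq_Rintegral => z _.
  by rewrite mulNr sinN mulrN mulrA.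
by ring.
Qed.

Lemma radial_energyE rho theta : 0 < rho ->
  radial_energy rho theta =
  \int[mu]_delta (\1_(`[0, 1]%classic) delta * delta ^+ 4 *
     (cos_int (2 * pi * rho * delta) (uvec theta) ^+ 2 +
      sin_int (2 * pi * rho * delta) (uvec theta) ^+ 2)) /\
  bbsR (fun delta => \1_(`[0, 1]%classic) delta * delta ^+ 4 *
     (cos_int (2 * pi * rho * delta) (uvec theta) ^+ 2 +
      sin_int (2 * pi * rho * delta) (uvec theta) ^+ 2)).
Proof.
move=> r0; set u := uvec theta.
have l0 : 0 < rho^-1 by rewrite invr_gt0.
pose h x := chord K u (supp K u + rho^-1 * x).
have bh : bbsR h by have [] := chord_profile cK K0 (unit_uvec theta) l0.
have b : bbsR (fun delta => \1_(`[0, 1]%classic) delta * delta ^+ 4 *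
     (cos_int (2 * pi * rho * delta) u ^+ 2 + sin_int (2 * pi * rho * delta) u ^+ 2)).
  have := bbsZ (rho^-1 ^+ 2) (energy_bbs bh); congr bbs.
  apply/funext => d; rewrite (cos_sin_int (d := d) (unit_uvec theta) l0).
    by rewrite /h; ring.
  by rewrite mulrAC mulfK// gt_eqF.
split => //.
have seg d : 0 < d -> d <= 1 ->
    Normc.normc (fourier_indic (dilate d C) (rho *: u)) ^+ 2 =
    \1_(`[0, 1]%classic) d * d ^+ 4 *
      (cos_int (2 * pi * rho * d) u ^+ 2 + sin_int (2 * pi * rho * d) u ^+ 2).
  by move=> d0 d1; rewrite normc_fourier// segE d1 (ltW d0) mul1r.
have bi := bbs_integrable norm1_fin b.
(* [normc_fourier] holds for positive dilations: the end point 0 is dropped before rewriting and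
   restored afterwards. *)
rewrite /radial_energy -Rintegral_itv_obnd_cbnd; last first.
  apply: eq_integrable (integrableS _ _ _ bi) => //= d.
  by rewrite inE/= in_itv/= => /andP[d0 d1]; rewrite -seg.
rewrite (@eq_Rintegral _ _ _ mu `]0, 1] (fun d => \1_(`[0, 1]%classic) d * d ^+ 4 *
  (cos_int (2 * pi * rho * d) u ^+ 2 + sin_int (2 * pi * rho * d) u ^+ 2))); last first.
  by move=> d; rewrite inE/= in_itv/= => /andP[d0 d1]; rewrite -seg.
rewrite Rintegral_itv_obnd_cbnd; last exact: (integrableS _ _ _ bi).
rewrite Rintegral_indic//; apply: eq_Rintegral => d _.
by rewrite !mulrA; congr (_ * _ * _); rewrite indicE -natrM mulnb andbb.
Qed.

Lemma radial_energy_profile rho theta : 0 < rho ->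
  radial_energy rho theta =
  rho ^- 2 * energy (fun x => chord K (uvec theta) (supp K (uvec theta) + rho^-1 * x)).
Proof.
move=> r0; rewrite (radial_energyE _ r0).1 /energy.
have l0 : 0 < rho^-1 by rewrite invr_gt0.
set h := fun x : R => _.
have bh : bbsR h by have [] := chord_profile cK K0 (unit_uvec theta) l0.
rewrite -(RintZ norm1_fin _ (energy_bbs bh)); apply: eq_Rintegral => d _.
rewrite (cos_sin_int (d := d) (unit_uvec theta) l0).
  by rewrite /h exprVn; ring.
by rewrite mulrAC mulfK// gt_eqF.
Qed.

Lemma cos_int_lipschitz : exists2 M, 0 <= M & forall k s t, 
  [/\ `|cos_int k (uvec s)| <= M, `|sin_int k (uvec s)| <= M,
   `|cos_int k (uvec s) - cos_int k (uvec t)| <= M * `|k| * `|s - t| &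
   `|sin_int k (uvec s) - sin_int k (uvec t)| <= M * `|k| * `|s - t| ].
Proof.
have [_ [D KD] _] := cK.
have b1 := bbs2_compact_convex cK.
have [z0 Kz0] := K0.
have D0 : 0 <= D by have [+ _] := KD _ Kz0; exact: le_trans.
have m0 : 0 <= \int[mu2]_z \1_K z.
  by apply: Rintegral_ge0 => z _; rewrite indicE.
have aux (g : R -> R) (k s t : R) : measurable_fun setT g -> (forall x : R, `|g x| <= 1) ->
    (forall x y : R, `|g x - g y| <= `|x - y|) -> measurable_fun setT (fun t : R => g (k * t)) ->
    `|\int[mu2]_z (\1_K z * g (k * dot z (uvec s)))| <= \int[mu2]_z \1_K z /\
    `|\int[mu2]_z (\1_K z * g (k * dot z (uvec s))) -
      \int[mu2]_z (\1_K z * g (k * dot z (uvec t)))| <=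
    2 * D * `|k| * `|s - t| * \int[mu2]_z \1_K z.
  move=> mg g1 gl mgk.
  have bs := bbs2_indic_dot (uvec s) cK mgk (fun x => g1 (k * x)).
  have bt := bbs2_indic_dot (uvec t) cK mgk (fun x => g1 (k * x)).
  split.
    apply: (le_trans (le_norm_Rint norm2_fin bs)).
    apply: (le_Rint norm2_fin (bbs_norm bs) b1) => z.
    by rewrite normrM [`|\1_K z|]ger0_norm// ler_piMr.
  rewrite -(RintB norm2_fin bs bt) -(RintZ norm2_fin _ b1).
  apply: (le_trans (le_norm_Rint norm2_fin (bbsB bs bt))).
  apply: (le_Rint norm2_fin (bbs_norm (bbsB bs bt)) (bbsZ _ b1)) => z.
  rewrite -mulrBr normrM [`|\1_K z|]ger0_norm// indicE.
  case: (boolP (z \in K)) => [/set_mem Kz|_]; last by rewrite mul0r mulr0.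
  rewrite mul1r mulr1 (le_trans (gl _ _))// -mulrBr normrM.
  rewrite [2 * D * _]mulrC -mulrA ler_wpM2l//.
  have [z1 z2] := KD _ Kz.
  exact: dot_uvec_lipschitz.
set m := \int[mu2]_z \1_K z in m0 aux *.
exists (m + 2 * D * m); first by rewrite addr_ge0// !mulr_ge0.
have mc : measurable_fun setT (@cos R).
  by have := mcos 1; congr measurable_fun; apply/funext => t; rewrite mul1r.
have ms : measurable_fun setT (@sin R).
  by have := msin 1; congr measurable_fun; apply/funext => t; rewrite mul1r.
move=> k s t.
have [c1 c2] := aux _ k s t mc ncos (@cos_lipschitz R) (mcos k).
have [s1 s2] := aux _ k s t ms nsin (@sin_lipschitz R) (msin k).
have dm : 0 <= 2 * D * m by rewrite !mulr_ge0.
have w x : x <= 2 * D * `|k| * `|s - t| * m -> x <= (m + 2 * D * m) * `|k| * `|s - t|.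
  move=> /le_trans; apply; rewrite -subr_ge0.
  rewrite (_ : _ - _ = m * (`|k| * `|s - t|)); last by ring.
  by rewrite !mulr_ge0.
have w0 x : x <= m -> x <= m + 2 * D * m by move=> /le_trans; apply; rewrite lerDl.
by split; [exact: w0|exact: w0|exact: w|exact: w].
Qed.

(** Makes the energy measurable and locally bounded in the angle, as integration over a window
    requires. *)
Lemma radial_energy_lipschitz rho : 0 < rho ->
  exists M, forall s t, `|radial_energy rho s - radial_energy rho t| <= M * `|s - t|.
Proof.
move=> r0; have [M M0 H] := cos_int_lipschitz.
exists (4 * M ^+ 2 * (2 * pi * rho)) => s t.
have [-> bs] := radial_energyE s r0; have [-> bt] := radial_energyE t r0.
have pi0 := pi_ge0 R.
rewrite -(RintB norm1_fin bs bt); apply: (le_trans (le_norm_Rint norm1_fin (bbsB bs bt))).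
rewrite (_ : _ * `|s - t| = 4 * M ^+ 2 * (2 * pi * rho) * `|s - t| * (1 - 0)); last by ring.
apply: Rint_le_segment => //; first exact: bbs_norm (bbsB bs bt).
move=> d; rewrite segE; case: (boolP ((0 <= d) && (d <= 1))) => [/andP[d0 d1]|_]; last first.
  by rewrite !mul0r subrr normr0 mulr0.
rewrite /= mulr1 mul1r -mulrBr normrM ger0_norm ?exprn_ge0//.
have [a1 b1 ab1 bb1] := H (2 * pi * rho * d) s t.
have [a2 b2 _ _] := H (2 * pi * rho * d) t t.
set e := M * `|2 * pi * rho * d| * `|s - t| in ab1 bb1.
have e0 : 0 <= e by rewrite !mulr_ge0.
have sq (a b : R) : `|a| <= M -> `|b| <= M -> `|a - b| <= e -> `|a ^+ 2 - b ^+ 2| <= 2 * M * e.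
  move=> aM bM abe; rewrite subr_sqr normrM mulrC ler_pM//.
  by rewrite (le_trans (ler_normD _ _))//; lra.
apply: (@le_trans _ _ (1 * (4 * M * e))); last first.
  rewrite mul1r /e ger0_norm; last by rewrite !mulr_ge0// ltW.
  rewrite -subr_ge0 (_ : _ - _ = 4 * M ^+ 2 * (2 * pi * rho) * `|s - t| * (1 - d)); last by ring.
  by rewrite !mulr_ge0// ?exprn_ge0 ?subr_ge0// ltW.
apply: ler_pM => //; first exact: exprn_ge0.
  by rewrite exprn_ile1.
rewrite opprD addrACA (le_trans (ler_normD _ _))//.
have := sq _ _ a1 a2 ab1; have := sq _ _ b1 b2 bb1; lra.
Qed.

Lemma uvecDpi (theta : R) : uvec (theta + pi) = - uvec theta.
Proof. by rewrite /uvec cosDpi sinDpi. Qed.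

(** The transforms of a real function at opposite frequencies are conjugate. *)
Lemma radial_energyDpi rho theta : 0 < rho ->
  radial_energy rho (theta + pi) = radial_energy rho theta.
Proof.
move=> r0; rewrite !(radial_energyE _ r0).1; apply: eq_Rintegral => d _.
congr (_ * (_ ^+ 2 + _)).
  apply: eq_Rintegral => z _; congr (_ * _); rewrite uvecDpi -cosN; congr (cos _).
  by rewrite /dot /=; ring.
rewrite -[RHS]sqrrN; congr (_ ^+ 2).
have bs : bbs2 (fun z => \1_K z * sin (2 * pi * rho * d * dot z (uvec theta))).
  exact: (bbs2_indic_dot _ cK (msin _)).
rewrite /sin_int -(RintN norm2_fin bs); apply: eq_Rintegral => z _.
rewrite uvecDpi -mulrN -sinN; congr (_ * sin _).
by rewrite /dot /=; ring.
Qed.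

Lemma radial_energy_ge0 rho theta : 0 <= radial_energy rho theta.
Proof. by apply: Rintegral_ge0 => d _; exact: sqr_ge0. Qed.

Let width u := - supp K (- u) - supp K u.

Definition cap_chord (lambda theta : R) :=
  chord K (uvec theta) (supp K (uvec theta) + lambda).

Lemma radial_energy_le lambda theta : 0 < lambda ->
  2 * lambda <= width (uvec theta) ->
  radial_energy lambda^-1 theta <=
  16 * lambda ^+ 2 * (cap_chord lambda theta ^+ 2 + cap_chord lambda (theta + pi) ^+ 2).
Proof.
move=> l0 wl; rewrite radial_energy_profile ?invr_gt0// exprVn !invrK.
have hW := chord_profile cK K0 (unit_uvec theta) l0.
set h := fun x : R => _ in hW *; set W := _ / lambda in hW.
have W2 : 2 <= W by rewrite /W ler_pdivlMr.
have := energy_le hW W2.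
have -> : h 1 = cap_chord lambda theta by rewrite /h mulr1.
(* Distance 1 from the far end of the profile is depth [lambda] below the opposite supporting
   line. *)
have -> : h (W - 1) = cap_chord lambda (theta + pi).
  rewrite /h /cap_chord uvecDpi mulrBr mulr1 /W mulrCA mulfV ?gt_eqF// mulr1.
  rewrite (_ : _ + (_ - lambda) = - (supp K (- uvec theta) + lambda)); last by ring.
  by rewrite -(chord_opp K (- _)) opprK.
move: (cap_chord _ _) (cap_chord _ _) => a b hE.
rewrite -[leRHS]mulrA [leRHS]mulrCA ler_wpM2l ?sqr_ge0// (le_trans hE)//.
have := sqr_ge0 (a - b); nra.
Qed.

(** Only one of the two chords is recovered here; the other one will come from the direction
    [theta + pi], which has the same energy. *)
Lemma radial_energy_ge lambda theta : 0 < lambda ->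
  2 ^+ 17 * lambda <= width (uvec theta) ->
  lambda ^+ 2 * cap_chord lambda theta ^+ 2 <= 2 ^+ 28 * radial_energy lambda^-1 theta.
Proof.
move=> l0 wl; rewrite radial_energy_profile ?invr_gt0// exprVn !invrK.
have hW := chord_profile cK K0 (unit_uvec theta) l0.
set h := fun x : R => _ in hW *; set W := _ / lambda in hW.
have W2 : 2 ^+ 17 <= W by rewrite /W ler_pdivlMr.
have := energy_ge hW W2.
have -> : h 1 = cap_chord lambda theta by rewrite /h mulr1.
move=> hE; rewrite [leRHS]mulrCA; by apply: ler_wpM2l => //; exact: sqr_ge0.
Qed.

End fourier_profile.

(** * The boundary curve *)

Section body_interior.
Context {R : realType}.
Variable C : set (R * R).
Hypothesis bC : convex_body C.
Let K := closure C.
Let cK : compact_convex K := closure_compact_convex bC.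

Lemma body_conv (p q : R * R) (t : R) : C p -> C q -> 0 <= t -> t <= 1 ->
  C ((1 - t) * p.1 + t * q.1, (1 - t) * p.2 + t * q.2).
Proof.
move=> Cp Cq t0 t1; have [_ cC _] := bC.
have k0 : 0 <= 1 - t by rewrite subr_ge0.
have k1 : 1 - t <= 1 by rewrite lerBlDr lerDl.
have := cC p q (Itv01 k0 k1) (mem_set Cp) (mem_set Cq).
by move/set_mem; congr C; rewrite /conv/= /unstable.onem subKr.
Qed.

(** A point near the combination is still a combination of a point [y'] of [C] close to [y] and of a
    second point; solving for the latter shows that it stays in the ball around [c]. *)
Lemma interior_conv (c y : R * R) (t : R) : C° c -> K y -> 0 <= t -> t < 1 ->
  C° ((1 - t) * c.1 + t * y.1, (1 - t) * c.2 + t * y.2).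
Proof.
move=> /plane_nbhsP[e e0 eC] /plane_closureP yC t0 t1.
have d0 : 0 < 1 - t by rewrite subr_gt0.
have de : 0 < (1 - t) * (e / 2) by rewrite mulr_gt0// divr_gt0.
have [y' [Cy' y1 y2]] := yC _ de.
apply/plane_nbhsP; exists ((1 - t) * (e / 2)) => // w /= w1 w2.
have key (a b b' v : R) : `|b - b'| < (1 - t) * (e / 2) ->
    `|(1 - t) * a + t * b - v| < (1 - t) * (e / 2) ->
    `|a - (v - t * b') / (1 - t)| < e.
  move=> hb hv; rewrite -(ltr_pM2l d0) -[X in X * `|_|]gtr0_norm// -normrM.
  rewrite mulrBr mulrCA mulfV ?gt_eqF// mulr1.
  rewrite (_ : _ - _ = ((1 - t) * a + t * b - v) + t * (b' - b)); last by ring.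
  rewrite (le_lt_trans (ler_normD _ _))// normrM ger0_norm// [`|b' - _|]distrC.
  have : t * `|b - b'| <= `|b - b'| by rewrite ler_piMl// ltW.
  by move: hb hv; lra.
have := body_conv (eC ((w.1 - t * y'.1) / (1 - t), (w.2 - t * y'.2) / (1 - t))
  (key _ _ _ _ y1 w1) (key _ _ _ _ y2 w2)) Cy' t0 (ltW t1).
by rewrite /= !mulrA ![(1 - t) * _]mulrC !mulfK ?gt_eqF// !subrK -surjective_pairing.
Qed.

(** [w] lies strictly between the interior point [c] and a point of [K]. This is the test by which
    points are shown not to be on the boundary. *)
Lemma interior_extend (c w : R * R) (tau : R) : C° c -> 0 < tau ->
  K (w.1 + tau * (w.1 - c.1), w.2 + tau * (w.2 - c.2)) -> C° w.
Proof.
move=> Cc t0 Kw; have s0 : 0 < 1 + tau by rewrite addr_gt0.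
have := interior_conv Cc Kw (t := (1 + tau)^-1); rewrite invr_ge0 (ltW s0) invf_lt1//.
rewrite ltrDl => /(_ isT t0); congr (C° _); rewrite [RHS]surjective_pairing /=.
by congr (_, _); field; rewrite gt_eqF.
Qed.

Lemma bdry_closure w : bdry C w -> K w. Proof. by case. Qed.

Lemma exists_interior : exists c, C° c.
Proof. by have [_ _ [c Cc]] := bC; exists c. Qed.

Lemma interior_push (c : R * R) : C° c ->
  exists2 d, 0 < d & forall u, unit_dir u -> C° (c.1 - d * u.1, c.2 - d * u.2).
Proof.
move=> Cc; have /plane_nbhsP[d d0 dC] : nbhs c C°.
  by apply: open_nbhs_nbhs; split => //; exact: open_interior.
exists (d / 2); first exact: divr_gt0.
have h (u v : R) : `|v| <= 1 -> `|u - (u - d / 2 * v)| < d.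
  move=> v1; rewrite opprB addrC subrK normrM gtr0_norm ?divr_gt0//.
  by apply: (@le_lt_trans _ _ (d / 2 * 1)); [rewrite ler_wpM2l// ltW// divr_gt0|lra].
by move=> u /unit_dir_le1[u1 u2]; apply: dC; exact: h.
Qed.

(** The last point of the ray that belongs to the closure is on the boundary. *)
Lemma interior_bdry_ray (c v : R * R) : C° c -> v != 0 ->
  exists2 t, 0 < t & bdry C (c.1 + t * v.1, c.2 + t * v.2).
Proof.
move=> Cc v0.
have vn : 0 < Num.max `|v.1| `|v.2|.
  rewrite lt_max !normr_gt0 -negb_and; apply: contra v0 => /andP[/eqP a /eqP b].
  by apply/eqP; rewrite [v]surjective_pairing a b.
set N := Num.max _ _ in vn.
have v1N : `|v.1| <= N by rewrite le_max lexx.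
have v2N : `|v.2| <= N by rewrite le_max lexx orbT.
pose A := [set t : R | 0 <= t /\ K (c.1 + t * v.1, c.2 + t * v.2)].
have KC : K c by apply: subset_closure; exact: interior_subset.
have A0 : A 0 by split => //; rewrite !mul0r !addr0 -surjective_pairing.
have [_ [D KD] _] := cK.
have Aub : ubound A (2 * D / N).
  move=> t [t0 Kt]; have [k1 k2] := KD _ Kt; have [c1 c2] := KD _ KC.
  rewrite ler_pdivlMr//.
  have h (a b : R) : `|a| <= D -> `|a + t * b| <= D -> t * `|b| <= 2 * D.
    move=> ha hb; rewrite -{1}(ger0_norm t0) -normrM.
    by have := ler_normB (a + t * b) a; rewrite addrAC subrr add0r; lra.
  have [N1|N2] : N = `|v.1| \/ N = `|v.2|.
    by rewrite /N; case: leP; [right|left].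
  - by rewrite N1; exact: h c1 k1.
  - by rewrite N2; exact: h c2 k2.
have hA : has_sup A by split; [exists 0|exists (2 * D / N)].
have sA : A (sup A).
  split; first exact: sup_ubound hA.2 _ A0.
  apply/plane_closureP => e e0.
  have eN : 0 < e / 2 / N by rewrite divr_gt0// divr_gt0.
  have [t At] := sup_adherent eN hA => tl.
  have tu := sup_ubound hA.2 At.
  have [t0 /plane_closureP Kt] := At.
  have [|w [Cw w1 w2]] := Kt (e / 2); first by rewrite divr_gt0.
  exists w; split => //=.
    rewrite (_ : _ - _ = (c.1 + t * v.1 - w.1) + (sup A - t) * v.1); last by ring.
    rewrite (le_lt_trans (ler_normD _ _))// normrM ger0_norm ?subr_ge0//.
    have : (sup A - t) * `|v.1| <= (sup A - t) * N by rewrite ler_wpM2l// subr_ge0.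
    have : (sup A - t) * N < e / 2 by rewrite -ltr_pdivlMr//; lra.
    by move: w1 => /=; lra.
  rewrite (_ : _ - _ = (c.2 + t * v.2 - w.2) + (sup A - t) * v.2); last by ring.
  rewrite (le_lt_trans (ler_normD _ _))// normrM ger0_norm ?subr_ge0//.
  have : (sup A - t) * `|v.2| <= (sup A - t) * N by rewrite ler_wpM2l// subr_ge0.
  have : (sup A - t) * N < e / 2 by rewrite -ltr_pdivlMr//; lra.
  by move: w2 => /=; lra.
have push t : 0 <= t -> C° (c.1 + t * v.1, c.2 + t * v.2) -> t < sup A.
  move=> t0 /plane_nbhsP[e e0 eC].
  have d0 : 0 < e / 2 / N by rewrite divr_gt0// divr_gt0.
  have dN : e / 2 / N * N < e by rewrite divfK ?gt_eqF//; lra.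
  apply: (@lt_le_trans _ _ (t + e / 2 / N)); first by rewrite ltrDl.
  apply: (sup_ubound hA.2); split; first by rewrite addr_ge0// ltW.
  have h (a b : R) : `|b| <= N -> `|a + t * b - (a + (t + e / 2 / N) * b)| < e.
    move=> bN; rewrite (_ : _ - _ = - (e / 2 / N * b)); last by ring.
    rewrite normrN normrM gtr0_norm//; apply: le_lt_trans dN.
    by rewrite ler_wpM2l// ltW.
  by apply: subset_closure; apply: eC => /=; exact: h.
have s0 : 0 < sup A by apply: push => //; rewrite !mul0r !addr0 -surjective_pairing.
exists (sup A) => //; split; first by case: sA.
by move=> /(push _ (ltW s0)); rewrite ltxx.
Qed.

End body_interior.

(** * Boundary arcs between points touched from below *)

Section lower_arcs.
Context {R : realType}.

(** The hypotheses put [(p, q)] in the cone [|q| <= p], away from 0, and [(xi, eta)] in the open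
    cone of steep upward vectors; such a pair is positively oriented. *)
Lemma steep_cross (p q k S xi eta : R) : `|S| <= 1 -> q <= - S * p -> 0 < q + k * p ->
  `|k| <= 1 -> 0 <= p -> `|xi| < eta -> 0 < p * eta - q * xi.
Proof.
move=> S1 qS qk k1 p0 xe.
have pp : 0 < p.
  rewrite lt_neqAle p0 andbT; apply/eqP => p00; move: qS qk.
  by rewrite -p00 !mulr0 addr0 => /le_lt_trans /[apply]; rewrite ltxx.
have qp : `|q| <= p.
  have : `|S * p| <= p by rewrite normrM (ger0_norm p0) ler_piMl.
  have : `|k * p| <= p by rewrite normrM (ger0_norm p0) ler_piMl.
  by rewrite !ler_norml => /andP[? ?] /andP[? ?]; apply/andP; split; lra.
rewrite subr_gt0 (@le_lt_trans _ _ (p * `|xi|)) ?ltr_pM2l//.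
by rewrite (le_trans (ler_norm _))// normrM ler_wpM2r.
Qed.

(* A point [w2] steeply above [w1], both on or below the chord from [z] to [z'],
   lies in the triangle [z z' w1], off its two lower sides. *)
Lemma steep_triangle (x0 y0 x1 y1 X1 Y1 X2 Y2 T T' : R) :
  x0 < x1 -> `|T| <= 1 -> `|T'| <= 1 ->
  y0 + T * x0 <= y1 + T * x1 -> y1 + T' * x1 <= y0 + T' * x0 ->
  y0 + T * x0 <= Y1 + T * X1 -> y1 + T' * x1 <= Y1 + T' * X1 ->
  0 <= (y1 - y0) * (X2 - x0) - (Y2 - y0) * (x1 - x0) ->
  `|X2 - X1| < Y2 - Y1 ->
  [/\ 0 < (y1 - y0) * (X1 - x0) - (Y1 - y0) * (x1 - x0),
      0 < (x1 - X1) * (Y2 - Y1) - (y1 - Y1) * (X2 - X1) &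
      0 < (X1 - x0) * (Y2 - Y1) + (y0 - Y1) * (X2 - X1)].
Proof.
move=> x01 T1 T'1 t0 t1 u0 u1 l2 steep.
set xi := X2 - X1 in steep *; set eta := Y2 - Y1 in steep *.
have s1 : `|y1 - y0| <= x1 - x0.
  rewrite ler_norml; move: T1 T'1; rewrite !ler_norml => /andP[Ta Tb] /andP[T'a T'b].
  have : T * (x1 - x0) <= 1 * (x1 - x0) by rewrite ler_wpM2r// subr_ge0 ltW.
  have : -1 * (x1 - x0) <= T' * (x1 - x0) by rewrite ler_wpM2r// subr_ge0 ltW.
  by move=> h1 h2; apply/andP; split; lra.
have d0 : 0 < x1 - x0 by rewrite subr_gt0.
have l1 : 0 < (y1 - y0) * (X1 - x0) - (Y1 - y0) * (x1 - x0).
  have a1 : (y1 - y0) * xi <= (x1 - x0) * `|xi|.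
    by rewrite (le_trans (ler_norm _))// normrM ler_wpM2r.
  have a2 : (x1 - x0) * `|xi| < (x1 - x0) * eta by rewrite ltr_pM2l.
  by move: l2; rewrite /xi /eta in a1 a2 *; lra.
pose k := (y1 - y0) / (x1 - x0).
have kE : k * (x1 - x0) = y1 - y0 by rewrite divfK// gt_eqF.
have k1 : `|k| <= 1.
  by rewrite normrM normfV (gtr0_norm d0) ler_pdivrMr// mul1r.
have below : Y1 < y0 + k * (X1 - x0).
  rewrite -(ltr_pM2r d0) mulrDl mulrAC kE; lra.
have X1r : X1 <= x1.
  rewrite leNgt; apply/negP => h.
  have : (T' + k) * (X1 - x1) <= 0.
    rewrite mulr_le0_ge0// ?subr_ge0 ?(ltW h)// -(pmulr_lle0 _ d0) mulrDl kE; lra.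
  move: below u1 kE; lra.
have X1l : x0 <= X1.
  rewrite leNgt; apply/negP => h.
  have : (T + k) * (X1 - x0) <= 0.
    rewrite mulr_ge0_le0// ?subr_le0 ?(ltW h)// -(pmulr_lge0 _ d0) mulrDl kE; lra.
  move: below u0; lra.
split => //.
- apply: (@steep_cross _ _ (- k) T'); rewrite ?normrN ?subr_ge0//; lra.
- rewrite -[_ * xi]opprK -mulrN; apply: (@steep_cross _ _ k (- T)); rewrite ?normrN ?subr_ge0//; lra.
Qed.

(** For an affine coordinate equal to [b] at the origin of a ray and to [a] at a point of it: it
    stays non-negative a little beyond that point, either because [a > 0] or because it does not
    decrease along the ray. *)
Lemma small_step (a b : R) : 0 < a \/ (0 <= a /\ b <= 0) ->
  exists2 t0, 0 < t0 & forall t, 0 <= t -> t <= t0 -> 0 <= a + t * (a - b).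
Proof.
move=> [a0|[a0 b0]]; last first.
  by exists 1 => // t t0 _; rewrite addr_ge0// mulr_ge0// subr_ge0 (le_trans b0).
have d0 : 0 < 1 + `|a - b| by rewrite ltr_pwDl.
exists (a / (1 + `|a - b|)); first exact: divr_gt0.
move=> t t0; rewrite ler_pdivlMr// => ta.
have : - (t * (a - b)) <= t * `|a - b|.
  by rewrite -mulrN ler_wpM2l// -normrN ler_norm.
by move: ta; lra.
Qed.

Lemma continuous_constant_sign (f : R -> R) (u v : R) : continuous f ->
  (forall t, u < t -> t < v -> f t != 0) ->
  (forall t, u < t -> t < v -> 0 < f t) \/ (forall t, u < t -> t < v -> f t < 0).
Proof.
move=> cf f0.
have [[t1 [u1 v1 f1]]|h] := pselect (exists t, [/\ u < t, t < v & 0 < f t]); last first.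
  right=> t ut tv; rewrite lt_neqAle f0//= leNgt; apply/negP => ft.
  by apply: h; exists t.
left=> t2 u2 v2; rewrite lt_neqAle eq_sym f0//= leNgt; apply/negP => f2.
have ivt a b : u < a -> b < v -> a <= b -> Num.min (f a) (f b) <= 0 <= Num.max (f a) (f b) -> False.
  move=> ua bv ab h; have [|c] := IVT ab _ h; first exact: continuous_subspaceT.
  rewrite in_itv/= => /andP[ac cb] fc; have := f0 c (lt_le_trans ua ac) (le_lt_trans cb bv).
  by rewrite fc eqxx.
have [t12|t21] := leP t1 t2.
  by apply: (ivt t1 t2) => //; rewrite ge_min le_max (ltW f1) (ltW f2) orbT.
by apply: (ivt t2 t1) => //; [exact: ltW|rewrite ge_min le_max (ltW f1) (ltW f2) orbT].
Qed.

Variables (C : set (R * R)) (L : R) (gamma : R -> R * R) (e : R * R).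
Hypotheses (bC : convex_body C) (aC : arc_length_param C L gamma) (ue : unit_dir e).
Let K := closure C.
Let cK : compact_convex K := closure_compact_convex bC.
Let X (z : R * R) := dot z (perp e).
Let Y (z : R * R) := dot z e.

Lemma frame_inj z w : X z = X w -> Y z = Y w -> z = w.
Proof.
move=> hX hY.
have h1 (p : R * R) : p = (Y p * e.1 - X p * e.2, Y p * e.2 + X p * e.1).
  rewrite [LHS]surjective_pairing /X /Y /dot /=; congr (_, _).
    transitivity (p.1 * (e.1 ^+ 2 + e.2 ^+ 2)); last by ring.
    by rewrite ue mulr1.
  transitivity (p.2 * (e.1 ^+ 2 + e.2 ^+ 2)); last by ring.
  by rewrite ue mulr1.
by rewrite (h1 z) (h1 w) hX hY.
Qed.

Lemma frame_enorm z : enorm z ^+ 2 = X z ^+ 2 + Y z ^+ 2.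
Proof.
rewrite sqr_sqrtr; last by rewrite /dot -!expr2 addr_ge0// sqr_ge0.
transitivity (dot z z * (e.1 ^+ 2 + e.2 ^+ 2)); last by rewrite /X /Y /dot /=; ring.
by rewrite ue mulr1.
Qed.

Let enorm_ge0 (z : R * R) : 0 <= enorm z. Proof. exact: sqrtr_ge0. Qed.

Lemma frame_enorm_le z : enorm z <= `|X z| + `|Y z|.
Proof.
rewrite -ler_sqr ?nnegrE ?addr_ge0// frame_enorm.
rewrite -[X z ^+ 2]real_normK ?num_real// -[Y z ^+ 2]real_normK ?num_real// sqrrD.
by rewrite addrAC lerDl mulrn_wge0// mulr_ge0.
Qed.

Lemma frame_X_enorm z : `|X z| <= enorm z.
Proof.
by rewrite -ler_sqr ?nnegrE// frame_enorm real_normK ?num_real// lerDl sqr_ge0.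
Qed.

Lemma frame_Y_enorm z : `|Y z| <= enorm z.
Proof.
by rewrite -ler_sqr ?nnegrE// frame_enorm real_normK ?num_real// lerDr sqr_ge0.
Qed.

(** [T] is the slope parameter of a supporting line at [z], whose normal [e + T * perp e] is within
    [pi / 4] of [e]. *)
Definition touch (z : R * R) := exists2 T, `|T| <= 1 &
  forall w, K w -> dot z e + T * dot z (perp e) <= dot w e + T * dot w (perp e).

Let XB z w : X (z - w) = X z - X w. Proof. exact: dotBl. Qed.
Let YB z w : Y (z - w) = Y z - Y w. Proof. exact: dotBl. Qed.

Let conv3 (p q r : R * R) (a b c : R) : K p -> K q -> K r ->
  0 <= a -> 0 <= b -> 0 <= c -> a + b + c = 1 ->
  K (a * p.1 + b * q.1 + c * r.1, a * p.2 + b * q.2 + c * r.2).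
Proof.
move=> Kp Kq Kr a0 b0 c0 abc; have [_ _ cvx] := cK.
have [ab0|ab0] := eqVneq (a + b) 0.
  have a00 : a = 0 by lra.
  have b00 : b = 0 by lra.
  have -> : c = 1 by lra.
  by rewrite a00 b00 !mul0r !mul1r !add0r -surjective_pairing.
have abp : 0 < a + b by rewrite lt_neqAle eq_sym ab0 addr_ge0.
have t1 : b / (a + b) <= 1 by rewrite ler_pdivrMr// mul1r lerDr.
have c1 : c <= 1 by lra.
have := cvx _ _ c (cvx _ _ _ Kp Kq (divr_ge0 b0 (ltW abp)) t1) Kr c0 c1.
have -> : 1 - c = a + b by lra.
by rewrite /=; congr K; congr (_, _); field.
Qed.

(** When [X z < X z'], this is non-negative exactly if [w] is on or below the line through [z] and
    [z']. *)
Let ell z z' w := (Y z' - Y z) * (X w - X z) - (Y w - Y z) * (X z' - X z).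

(** The ray from [c] through [w2] can be prolonged beyond [w2] inside the triangle [z z' w1], so
    [interior_extend] applies. When [w2] is on the side from [z] to [z'], the prolongation must not
    rise above that side, hence the condition on [c]. *)
Lemma steep_interior c z z' w1 w2 : C° c -> K z -> K z' -> K w1 -> touch z -> touch z' ->
  X z < X z' -> 0 <= ell z z' w2 -> `|X w2 - X w1| < Y w2 - Y w1 ->
  0 < ell z z' w2 \/ ell z z' c <= 0 -> C° w2.
Proof.
move=> Cc Kz Kz' K1 [T T1 hT] [T' T'1 hT'] zz' l2 st hl.
have [A0 P0 Q0] := steep_triangle zz' T1 T'1 (hT _ Kz') (hT' _ Kz) (hT _ K1) (hT' _ K1) l2 st.
set A := _ - _ in A0.
(* Barycentric coordinates with respect to [z], [z'] and [w1], as affine functions of the point. *)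
pose al w := ((X z' - X w1) * (Y w - Y w1) - (Y z' - Y w1) * (X w - X w1)) / A.
pose be w := ((X w1 - X z) * (Y w - Y w1) + (Y z - Y w1) * (X w - X w1)) / A.
pose de w := ell z z' w / A.
have al2 : 0 < al w2 by exact: divr_gt0.
have be2 : 0 < be w2 by exact: divr_gt0.
have de2 : 0 < de w2 \/ (0 <= de w2 /\ de c <= 0).
  case: hl => [h|h]; [left; exact: divr_gt0|right; split; first exact: divr_ge0 (ltW A0)].
  by rewrite pmulr_lle0// invr_gt0.
have [t1 t10 h1] := small_step (b := al c) (or_introl al2).
have [t2 t20 h2] := small_step (b := be c) (or_introl be2).
have [t3 t30 h3] := small_step de2.
pose t := Num.min t1 (Num.min t2 t3).
have t0 : 0 < t by rewrite !lt_min t10 t20.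
have tt1 : t <= t1 by rewrite /t ge_min lexx.
have tt2 : t <= t2 by rewrite /t !ge_min lexx orbT.
have tt3 : t <= t3 by rewrite /t !ge_min lexx !orbT.
apply: (interior_extend bC Cc t0).
have a0 : 0 <= al w2 + t * (al w2 - al c) by apply: h1 => //; exact: ltW.
have b0 : 0 <= be w2 + t * (be w2 - be c) by apply: h2 => //; exact: ltW.
have c0 : 0 <= de w2 + t * (de w2 - de c) by apply: h3 => //; exact: ltW.
have An : A != 0 by rewrite gt_eqF.
have sum1 w : al w + be w + de w = 1.
  rewrite /al /be /de /ell -!mulrDl; apply: (mulIf An); rewrite divfK// mul1r /A /X /Y; ring.
have := conv3 Kz Kz' K1 a0 b0 c0.
have -> : al w2 + t * (al w2 - al c) + (be w2 + t * (be w2 - be c)) +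
  (de w2 + t * (de w2 - de c)) = 1.
  transitivity ((al w2 + be w2 + de w2) * (1 + t) - t * (al c + be c + de c)); first by ring.
  by rewrite !sum1; ring.
move=> /(_ erefl); congr K.
have lin w (u : R * R) : (u = e \/ u = perp e) ->
    al w * dot z u + be w * dot z' u + de w * dot w1 u = dot w u.
  move=> uE; apply: (mulIf An).
  transitivity ((al w * A) * dot z u + (be w * A) * dot z' u + (de w * A) * dot w1 u); first by ring.
  rewrite !divfK// /ell /A.
  by case: uE => ->; rewrite -/(X z) -/(X z') -/(X w1) -/(X w) -/(Y z) -/(Y z') -/(Y w1) -/(Y w); ring.
have both (u : R * R) : (u = e \/ u = perp e) ->
  dot ((al w2 + t * (al w2 - al c)) * z.1 + (be w2 + t * (be w2 - be c)) * z'.1 +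
       (de w2 + t * (de w2 - de c)) * w1.1,
       (al w2 + t * (al w2 - al c)) * z.2 + (be w2 + t * (be w2 - be c)) * z'.2 +
       (de w2 + t * (de w2 - de c)) * w1.2) u =
  dot (w2.1 + t * (w2.1 - c.1), w2.2 + t * (w2.2 - c.2)) u.
  move=> uE; transitivity (dot w2 u + t * (dot w2 u - dot c u)); last by rewrite /dot /=; ring.
  by rewrite -(lin w2 u uE) -(lin c u uE) /dot /=; ring.
by apply: frame_inj; rewrite /X /Y; apply: both; [right|left].
Qed.

Let cross (p q : R * R) := X p * Y q - Y p * X q.

(* Coordinates of [w - c] in the basis [z - c, z' - c]; [w] lies in the open
   convex cone spanned by that basis when the minimum is positive. *)
Let cone c z z' w := Num.min (cross (w - c) (z' - c) / cross (z - c) (z' - c))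
                             (cross (z - c) (w - c) / cross (z - c) (z' - c)).

Let cone_decomp c z z' w : cross (z - c) (z' - c) != 0 ->
  let a := cross (w - c) (z' - c) / cross (z - c) (z' - c) in
  let b := cross (z - c) (w - c) / cross (z - c) (z' - c) in
  w = (c.1 + a * (z.1 - c.1) + b * (z'.1 - c.1), c.2 + a * (z.2 - c.2) + b * (z'.2 - c.2)).
Proof.
move=> D0 a b.
have both (u : R * R) : (u = e \/ u = perp e) -> dot w u =
    dot (c.1 + a * (z.1 - c.1) + b * (z'.1 - c.1), c.2 + a * (z.2 - c.2) + b * (z'.2 - c.2)) u.
  move=> uE; transitivity (dot c u + a * (dot z u - dot c u) + b * (dot z' u - dot c u)).
    have aE : a * cross (z - c) (z' - c) = cross (w - c) (z' - c) by rewrite divfK.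
    have bE : b * cross (z - c) (z' - c) = cross (z - c) (w - c) by rewrite divfK.
    apply: (mulIf D0); set D := cross (z - c) (z' - c) in aE bE *.
    transitivity (dot c u * D + (a * D) * (dot z u - dot c u) + (b * D) * (dot z' u - dot c u)); last by ring.
    rewrite aE bE /D.
    by case: uE => ->; rewrite /cross !XB !YB /X /Y; ring.
  by rewrite /dot /=; ring.
by apply: frame_inj; rewrite /X /Y; apply: both; [right|left].
Qed.

(** Of two distinct points of the closure on a ray from [c], the nearer one is interior. *)
Let ray_bdry c z w k : C° c -> bdry C z -> bdry C w -> 0 <= k ->
  w = (c.1 + k * (z.1 - c.1), c.2 + k * (z.2 - c.2)) -> w = z.
Proof.
move=> Cc [Kz Cz] [Kw Cw] k0 wE.
have [k1|k1|k1] := ltgtP k 1; last first.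
- by rewrite wE k1 !mul1r [c.1 + _]addrC [c.2 + _]addrC !subrK -surjective_pairing.
- exfalso; apply: Cz.
  apply: (interior_extend bC Cc (_ : 0 < k - 1)); first by rewrite subr_gt0.
  by move: Kw; rewrite wE; congr (closure C _); congr (_, _); ring.
- exfalso; apply: Cw.
  have := interior_conv bC Cc Kz k0 k1; congr (C° _).
  by rewrite wE; congr (_, _); ring.
Qed.

(** [cone] vanishes only on the two rays from [c] through [z] and [z'], each of which meets the
    boundary once. *)
Let cone_neq0 c z z' w : C° c -> cross (z - c) (z' - c) != 0 ->
  bdry C z -> bdry C z' -> bdry C w -> w <> z -> w <> z' -> cone c z z' w != 0.
Proof.
move=> Cc D0 bz bz' bw wz wz'; apply/eqP; rewrite /cone.
have := cone_decomp w D0; rewrite /=.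
set a := cross (w - c) _ / _; set b := cross _ (w - c) / _ => wE.
case: leP => [ab a0|ab b0].
  apply: wz'; apply: (ray_bdry Cc bz' bw (_ : 0 <= b)); first by rewrite -a0.
  by rewrite wE a0 !mul0r !addr0.
apply: wz; apply: (ray_bdry Cc bz bw (_ : 0 <= a)); first by rewrite ltW// -b0.
by rewrite wE b0 !mul0r !addr0.
Qed.

Let cX : continuous (X \o gamma).
Proof.
apply: (@lipschitz_fun_continuous _ _ 1) => s t; rewrite mul1r -XB.
exact: le_trans (frame_X_enorm _) (arc_length_lipschitz s t aC).
Qed.

Let cY : continuous (Y \o gamma).
Proof.
apply: (@lipschitz_fun_continuous _ _ 1) => s t; rewrite mul1r -YB.
exact: le_trans (frame_Y_enorm _) (arc_length_lipschitz s t aC).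
Qed.

Let ccone c z z' : continuous (cone c z z' \o gamma).
Proof.
have lin k1 k2 k3 : continuous (fun t => k1 * X (gamma t) + k2 * Y (gamma t) + k3).
  move=> t; apply: cvgD; last exact: cvg_cst.
  by apply: cvgD; (apply: cvgM; first exact: cvg_cst); [exact: cX|exact: cY].
set D := cross (z - c) (z' - c).
move=> t.
apply: (@continuous_min R _ (fun t => cross (gamma t - c) (z' - c) / D)
  (fun t => cross (z - c) (gamma t - c) / D) t).
- have -> : (fun t => cross (gamma t - c) (z' - c) / D) =
      fun t => Y (z' - c) / D * X (gamma t) + - X (z' - c) / D * Y (gamma t) +
               (Y c * X (z' - c) - X c * Y (z' - c)) / D.
    by apply/funext => x; rewrite /cross !(XB (gamma x)) !(YB (gamma x)); ring.
  exact: lin.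
- have -> : (fun t => cross (z - c) (gamma t - c) / D) =
      fun t => - Y (z - c) / D * X (gamma t) + X (z - c) / D * Y (gamma t) +
               (Y (z - c) * X c - X (z - c) * Y c) / D.
    by apply/funext => x; rewrite /cross !(XB (gamma x)) !(YB (gamma x)); ring.
  exact: lin.
Qed.

(** Injectivity over less than a period inside [[0, 2 * L[]: an arc through the base point is
    parametrised beyond [L]. *)
Lemma gamma_neq t t' : 0 <= t -> t < t' -> t' < t + L -> t' < 2 * L -> gamma t <> gamma t'.
Proof.
move=> t0 tt tL tL2; have [L0 per inj _ _] := aC.
have inL u : 0 <= u -> u < L -> u \in `[0, L[ by move=> *; rewrite in_itv/=; apply/andP.
have [t'L|Lt'] := ltP t' L.
  move/(inj _ _ (inL _ t0 (lt_trans tt t'L)) (inL _ (le_trans t0 (ltW tt)) t'L)).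
  by move=> tE; move: tt; rewrite tE ltxx.
have g' : gamma t' = gamma (t' - L) by rewrite -[in LHS](subrK L t') per.
rewrite g'; have [tl|Lt] := ltP t L.
  have h : t' - L \in `[0, L[ by apply: inL; lra.
  move/(inj _ _ (inL _ t0 tl) h) => tE; move: tL; rewrite tE; lra.
have -> : gamma t = gamma (t - L) by rewrite -[in LHS](subrK L t) per.
have h : t' - L \in `[0, L[ by apply: inL; lra.
have h' : t - L \in `[0, L[ by apply: inL; lra.
by move/(inj _ _ h' h)/addIr => tE; move: tt; rewrite tE ltxx.
Qed.

Lemma gammaMn n t : gamma (t + L *+ n) = gamma t.
Proof.
have [_ per _ _ _] := aC; elim: n t => [|n IH] t; first by rewrite addr0.
by rewrite mulrSr addrA per.
Qed.

Lemma gamma_bdry t : 0 <= t -> t < 2 * L -> bdry C (gamma t).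
Proof.
move=> t0 tL; have [L0 per _ img _] := aC; rewrite -img.
have [t1|t1] := ltP t L; first by exists t => //=; rewrite in_itv/= t0.
exists (t - L); first by rewrite /= in_itv/=; apply/andP; split; lra.
by rewrite -per subrK.
Qed.

Lemma bdry_gamma s w : bdry C w -> 0 <= s -> s < L ->
  exists t, [/\ s <= t, t < s + L & gamma t = w].
Proof.
have [L0 per _ <- _] := aC => -[t]; rewrite /= in_itv/= => /andP[t0 tL] <- s0 sL.
have [st|ts] := leP s t; first by exists t; split => //; lra.
by exists (t + L); rewrite per; split => //; lra.
Qed.

(** By continuity [f] keeps its sign on each of the two open arcs, and its value at [w] excludes
    that both signs are negative. *)
Let arc_cases (f : R * R -> R) s s' :
  0 <= s -> s < s' -> s' < L -> continuous (f \o gamma) ->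
  (forall w, bdry C w -> w <> gamma s -> w <> gamma s' -> f w != 0) ->
  (exists w, [/\ bdry C w, w <> gamma s, w <> gamma s' & 0 < f w]) ->
  (forall t, s < t -> t < s' -> 0 < f (gamma t)) \/
  (forall t, s' < t -> t < s + L -> 0 < f (gamma t)).
Proof.
move=> s0 ss sL cf f0 [w [bw ws ws' fw]]; have [L0 per _ _ _] := aC.
have [t [st tL tw]] := bdry_gamma bw s0 (lt_trans ss sL).
have n1 u : s < u -> u < s' -> (f \o gamma) u != 0.
  move=> su us; apply: f0; first by apply: gamma_bdry; lra.
    by apply/nesym/gamma_neq; lra.
  by apply: gamma_neq; lra.
have n2 u : s' < u -> u < s + L -> (f \o gamma) u != 0.
  move=> su us; apply: f0; first by apply: gamma_bdry; lra.
    by apply/nesym/gamma_neq; lra.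
  by apply/nesym/gamma_neq; lra.
have [h1|h1] := continuous_constant_sign cf n1; first by left.
have [h2|h2] := continuous_constant_sign cf n2; first by right.
exfalso; move: fw; rewrite -tw ltNge => /negP; apply.
have [E|N] := eqVneq t s; first by move: ws; rewrite -tw E.
have [E|N'] := eqVneq t s'; first by move: ws'; rewrite -tw E.
have st' : s < t by rewrite lt_neqAle eq_sym N.
apply: ltW; have [ts'|ts'] := ltP t s'; first exact: h1.
by apply: h2 => //; rewrite lt_neqAle eq_sym N'.
Qed.

(** Slopes of at most 1 make [X] injective along the arc, hence monotone. Each side of an inscribed
    polygon is at most twice its increment of [X], and these increments add up without
    cancellation. *)
Let arc_bound t0 t1 : 0 <= t0 -> t0 < t1 -> t1 < t0 + L -> t1 < 2 * L ->
  (forall t t', t0 <= t -> t <= t1 -> t0 <= t' -> t' <= t1 ->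
     `|Y (gamma t') - Y (gamma t)| <= `|X (gamma t') - X (gamma t)|) ->
  t1 - t0 <= 2 * `|X (gamma t1) - X (gamma t0)|.
Proof.
move=> t00 t01 tL tL2 slope; have [_ _ _ _ len] := aC.
have inj : {in `[t0, t1] &, injective (X \o gamma)}.
  move=> t t'; rewrite !in_itv/= => /andP[a b] /andP[a' b'] /= xE.
  have := slope t t' a b a' b'; rewrite xE subrr normr0 normr_le0 subr_eq0 => /eqP yE.
  have gE := frame_inj xE (esym yE).
  have [tt|tt|//] := ltgtP t t'.
    by exfalso; apply: (gamma_neq _ tt) gE; lra.
  by exfalso; apply: (gamma_neq _ tt) (esym gE); lra.
have mono := unstable.strict_monotonicW (itv_continuous_inj_mono (continuous_subspaceT cX) inj).
rewrite -lee_fin -(len _ _ (ltW t01)); apply: ub_ereal_sup => _ [p pab <-].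
rewrite lee_fin; apply: (@le_trans _ _ (2 * variation t0 t1 (X \o gamma) p)).
  rewrite /polygonal_length /variation mulr_sumr !big_nat.
  apply: ler_sum => n np; apply: (le_trans (frame_enorm_le _)).
  have ib m : (m < (size p).+1)%N -> t0 <= nth t1 (t0 :: p) m /\ nth t1 (t0 :: p) m <= t1.
    by move=> mp; split; [exact: itv_partition_nth_ge|exact: itv_partition_nth_le].
  have [a b] := ib n.+1 np; have [a' b'] := ib n (ltnW np).
  rewrite XB YB mulr_natl mulr2n lerD2l.
  exact: slope.
case: mono => [nd|ni].
  by rewrite (nondecreasing_variation nd pab) ler_wpM2l// ler_norm.
have ni' : {in `[t0, t1] &, nonincreasing_fun (X \o gamma)}.
  by move=> x y xI yI xy; exact: ni.
by rewrite (nonincreasing_variation ni' pab) ler_wpM2l// distrC ler_norm.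
Qed.

(** What [steep_interior] requires of the upper point. *)
Let good c p q w := 0 <= ell p q w /\ (0 < ell p q w \/ ell p q c <= 0).

Let crossE c p q : cross (p - c) (q - c) = - ell p q c.
Proof. by rewrite /cross /ell !XB !YB; ring. Qed.

Let ell_decomp c p q w (a b : R) :
  w = (c.1 + a * (p.1 - c.1) + b * (q.1 - c.1), c.2 + a * (p.2 - c.2) + b * (q.2 - c.2)) ->
  ell p q w = (1 - a - b) * ell p q c.
Proof. by move=> ->; rewrite /ell /X /Y /dot /=; ring. Qed.

Let cone_ray c p q t : cross (p - c) (q - c) != 0 ->
  cone c p q (c.1 + t * (p.1 - c.1 + (q.1 - c.1)), c.2 + t * (p.2 - c.2 + (q.2 - c.2))) = t.
Proof.
move=> D0; rewrite /cone; set w := (_, _).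
have -> : cross (w - c) (q - c) = t * cross (p - c) (q - c).
  by rewrite /w /cross /X /Y /dot /=; ring.
have -> : cross (p - c) (w - c) = t * cross (p - c) (q - c).
  by rewrite /w /cross /X /Y /dot /=; ring.
by rewrite mulfK// minxx.
Qed.

Let cone_end c p q : cross (p - c) (q - c) != 0 -> cone c p q p = 0 /\ cone c p q q = 0.
Proof.
move=> D0; have z w : cross w w = 0 by rewrite /cross; ring.
rewrite /cone !z !mulfV// !mul0r; split; first by rewrite minC min_l.
by rewrite min_l.
Qed.

Let dir_neq0 c p q : cross (p - c) (q - c) != 0 ->
  (p.1 - c.1 + (q.1 - c.1), p.2 - c.2 + (q.2 - c.2)) != 0 :> R * R.
Proof.
apply: contra => /eqP [h1 h2]; apply/eqP.
have -> : q - c = - (p - c) :> R * R.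
  by rewrite [LHS]surjective_pairing [RHS]surjective_pairing /=; congr (_, _); lra.
by rewrite /cross /X /Y /dot /=; ring.
Qed.

(** [f] singles out the lower of the two arcs. If some interior point [c] lies above the chord, the
    lower arc is what [c] sees in the cone of [p] and [q]. Otherwise the whole body is on or below
    the chord, [c] is taken strictly below it, and the arc is the part outside the cone. *)
Let side p q : bdry C p -> bdry C q -> touch p -> touch q -> X p < X q ->
  exists c (f : R * R -> R), [/\ C° c, continuous (f \o gamma),
    forall w, bdry C w -> w <> p -> w <> q -> f w != 0,
    exists w, [/\ bdry C w, w <> p, w <> q & 0 < f w] &
    forall w, bdry C w -> 0 < f w -> good c p q w].
Proof.
move=> bp bq [T T1 hT] [T' T'1 hT'] pq.
have Kp := bdry_closure bp; have Kq := bdry_closure bq; have [_ _ cvx] := cK.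
have [[c [Cc c0]]|nA] := pselect (exists c, C° c /\ ell p q c < 0).
  have D0 : cross (p - c) (q - c) != 0 by rewrite crossE oppr_eq0 lt_eqF.
  have [fp fq] := cone_end D0.
  exists c, (cone c p q); split; [by []|exact: ccone| | |].
  - by move=> w bw wp wq; exact: cone_neq0.
  - have [t t0 bt] := interior_bdry_ray bC Cc (dir_neq0 D0); rewrite /= in bt.
    have ft := cone_ray t D0.
    exists (c.1 + t * (p.1 - c.1 + (q.1 - c.1)), c.2 + t * (p.2 - c.2 + (q.2 - c.2))).
    by split => //; rewrite ?ft// => E; move: ft; rewrite E ?fp ?fq => tE; rewrite -tE ltxx in t0.
  - move=> w [Kw Cw]; rewrite /cone; have := cone_decomp w D0; rewrite /=.
    set a := cross (w - c) _ / _; set b := cross _ (w - c) / _ => wE.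
    rewrite lt_min => /andP[a0 b0]; have wl := ell_decomp wE.
    split; last by right; exact: ltW.
    (* For [a + b < 1] the point [w] would be inside the triangle [c p q], hence interior. *)
    rewrite wl; rewrite mulr_le0// ?(ltW c0)// leNgt; apply/negP => ab; apply: Cw.
    have s0 : 0 < a + b by rewrite addr_gt0.
    have t1 : b / (a + b) <= 1 by rewrite ler_pdivrMr// mul1r lerDr ltW.
    have := interior_conv bC Cc (cvx _ _ _ Kp Kq (divr_ge0 (ltW b0) (ltW s0)) t1) (ltW s0).
    move=> /(_ ltac:(lra)); congr (C° _); rewrite wE /=.
    by congr (_, _); field; rewrite gt_eqF.
have nA' c : C° c -> 0 <= ell p q c.
  by move=> Cc; rewrite leNgt; apply/negP => h; apply: nA; exists c.
have [c [Cc c0]] : exists c, C° c /\ 0 < ell p q c.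
  (* Pushing an interior point against [e] makes [ell] strictly positive. *)
  have [c0 Cc0] := exists_interior bC; have [d d0 dC] := interior_push Cc0.
  exists (c0.1 - d * e.1, c0.2 - d * e.2); split; first exact: dC.
  have -> : ell p q (c0.1 - d * e.1, c0.2 - d * e.2) = ell p q c0 +
      d * (e.1 ^+ 2 + e.2 ^+ 2) * (X q - X p).
    by rewrite /ell /X /Y /dot /=; ring.
  by rewrite ue mulr1 ltr_wpDl ?nA'// mulr_gt0 ?subr_gt0.
have D0 : cross (p - c) (q - c) != 0 by rewrite crossE oppr_eq0 gt_eqF.
have [fp fq] := cone_end D0.
have below w : K w -> 0 <= ell p q w.
  move=> Kw; rewrite leNgt; apply/negP => h.
  set x := ell p q c in c0; set y := ell p q w in h.
  have s0 : 0 < x - y by lra.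
  pose t := (2 * x - y) / (2 * (x - y)).
  have t0 : 0 <= t by rewrite divr_ge0//; lra.
  have t1 : t < 1 by rewrite ltr_pdivrMr; lra.
  have := nA' _ (interior_conv bC Cc Kw t0 t1).
  have -> : ell p q ((1 - t) * c.1 + t * w.1, (1 - t) * c.2 + t * w.2) = (1 - t) * x + t * y.
    by rewrite /x /y /ell /X /Y /dot /=; ring.
  have -> : (1 - t) * x + t * y = y / 2.
    by rewrite /t; field; rewrite gt_eqF.
  by lra.
exists c, (fun w => - cone c p q w); split.
- by [].
- by move=> t; apply: cvgN; exact: ccone.
- by move=> w bw wp wq; rewrite oppr_eq0; exact: cone_neq0.
- have v0 : (- (p.1 - c.1 + (q.1 - c.1)), - (p.2 - c.2 + (q.2 - c.2))) != 0 :> R * R.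
    by have := dir_neq0 D0; rewrite -oppr_eq0.
  have [t t0 bt] := interior_bdry_ray bC Cc v0; rewrite /= !mulrN -!mulNr in bt.
  have ft := cone_ray (- t) D0.
  exists (c.1 + (- t) * (p.1 - c.1 + (q.1 - c.1)), c.2 + (- t) * (p.2 - c.2 + (q.2 - c.2))).
  split => //; rewrite ?ft ?opprK// => E; move: ft; rewrite E ?fp ?fq => /eqP;
    by rewrite eq_sym oppr_eq0 gt_eqF.
- move=> w [Kw _]; rewrite /cone; have := cone_decomp w D0; rewrite /=.
  set a := cross (w - c) _ / _; set b := cross _ (w - c) / _ => wE.
  rewrite oppr_gt0 gt_min => ab; have wl := ell_decomp wE.
  split; first exact: below.
  left; rewrite lt_neqAle below// andbT eq_sym wl; apply/eqP => /eqP.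
  rewrite mulf_eq0 (gt_eqF c0) orbF => /eqP abE.
  have lin (u : R * R) : dot w u = a * dot p u + b * dot q u.
    have -> : a = 1 - b by lra.
    have aE : a = 1 - b by lra.
    by rewrite [in LHS]wE aE /dot /=; ring.
  have Kc : K c by apply: subset_closure; exact: interior_subset.
  have pq0 : 0 < X q - X p by rewrite subr_gt0.
  (* [w] is on the line through [p] and [q], beyond one of them. The supporting line at that end
     then contains the other end as well, so the body lies on or above the chord line, whereas [c]
     is strictly below it. *)
  case/orP: ab => [a0|b0].
    have := hT' _ Kw; have := hT' _ Kp; have := hT' _ Kc.
    rewrite !lin => h1 h2 h3.
    have aE : b = 1 - a by lra.
    have : a * (Y p + T' * X p - (Y q + T' * X q)) >= 0.
      by move: h3; rewrite aE /X /Y; lra.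
    rewrite nmulr_rge0// => h4.
    move: c0; rewrite ltNge => /negP; apply.
    have -> : ell p q c = - ((X q - X p) * (Y c + T' * X c - (Y q + T' * X q))).
      have E : Y p = Y q + T' * X q - T' * X p by move: h2 h4; rewrite /X /Y; lra.
      by rewrite /ell E; ring.
    by rewrite oppr_le0 mulr_ge0 ?(ltW pq0)// subr_ge0.
  have := hT _ Kw; have := hT _ Kq; have := hT _ Kc.
  rewrite !lin => h1 h2 h3.
  have aE : a = 1 - b by lra.
  have : b * (Y q + T * X q - (Y p + T * X p)) >= 0.
    by move: h3; rewrite aE /X /Y; lra.
  rewrite nmulr_rge0// => h4.
  move: c0; rewrite ltNge => /negP; apply.
  have -> : ell p q c = - ((X q - X p) * (Y c + T * X c - (Y p + T * X p))).
    have E : Y q = Y p + T * X p - T * X q by move: h2 h4; rewrite /X /Y; lra.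
    by rewrite /ell E; ring.
  by rewrite oppr_le0 mulr_ge0 ?(ltW pq0)// subr_ge0.
Qed.

Lemma touch_not_steep q w : touch q -> K w -> ~ `|X q - X w| < Y q - Y w.
Proof.
move=> [T T1 hT] Kw; apply/negP; rewrite -leNgt.
have : T * (X w - X q) <= `|X q - X w|.
  by rewrite (le_trans (ler_norm _))// normrM distrC ler_piMl.
by have := hT _ Kw; rewrite /X /Y; lra.
Qed.

(** On the arc selected by [side] no point is steeply above another boundary point, since it would
    be interior. So [arc_bound] applies to that arc, which is one of the two between [s] and
    [s']. *)
Let arc_dist_aux p q s s' : 0 <= s -> s < s' -> s' < L ->
  (p = gamma s /\ q = gamma s') \/ (p = gamma s' /\ q = gamma s) ->
  touch p -> touch q -> X p < X q ->
  s' - s <= 2 * (X q - X p) \/ L - (s' - s) <= 2 * (X q - X p).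
Proof.
move=> s0 ss sL pqE tp tq pq; have [L0 per _ _ _] := aC.
have bs : bdry C (gamma s) by apply: gamma_bdry; lra.
have bs' : bdry C (gamma s') by apply: gamma_bdry; lra.
have bp : bdry C p by case: pqE => -[-> _].
have bq : bdry C q by case: pqE => -[_ ->].
have [c [f [Cc cf f0 [w0 [bw0 w0p w0q fw0]] fgood]]] := side bp bq tp tq pq.
have slope w1 w2 : bdry C w1 -> bdry C w2 -> (w2 = p \/ w2 = q \/ 0 < f w2) ->
    Y w2 - Y w1 <= `|X w2 - X w1|.
  move=> b1 b2 h; rewrite leNgt; apply/negP => st.
  case: h => [h|[h|h]].
  - by move: st; rewrite h; exact: touch_not_steep (bdry_closure b1).
  - by move: st; rewrite h; exact: touch_not_steep (bdry_closure b1).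
  - have [g1 g2] := fgood _ b2 h; case: (b2) => _; apply.
    exact: (steep_interior Cc (bdry_closure bp) (bdry_closure bq) (bdry_closure b1) tp tq pq g1 st g2).
have arc t0 t1 : 0 <= t0 -> t0 < t1 -> t1 < t0 + L -> t1 < 2 * L ->
    (forall t, t0 <= t -> t <= t1 -> gamma t = p \/ gamma t = q \/ 0 < f (gamma t)) ->
    t1 - t0 <= 2 * `|X (gamma t1) - X (gamma t0)|.
  move=> t00 t01 tL tL2 h; apply: arc_bound => // t t' a b a' b'.
  have bt : bdry C (gamma t) by apply: gamma_bdry; lra.
  have bt' : bdry C (gamma t') by apply: gamma_bdry; lra.
  rewrite ler_norml; apply/andP; split.
    by have := slope _ _ bt' bt (h _ a b); rewrite distrC; lra.
  exact: slope _ _ bt bt' (h _ a' b').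
have ends t : gamma t = gamma s \/ gamma t = gamma s' -> gamma t = p \/ gamma t = q.
  by case: pqE => -[-> ->] [->|->]; by [left|right].
have XE : `|X (gamma s') - X (gamma s)| = X q - X p.
  move: pq; case: pqE => -[-> ->] pq; first by rewrite gtr0_norm// subr_gt0.
  by rewrite ltr0_norm ?opprB// subr_lt0.
have cases : (forall t, s < t -> t < s' -> 0 < f (gamma t)) \/
  (forall t, s' < t -> t < s + L -> 0 < f (gamma t)).
  apply: arc_cases => //.
    by move=> w bw ws ws'; apply: f0 => //; case: pqE => -[pE qE]; rewrite ?pE ?qE.
  by exists w0; split => //; case: pqE w0p w0q => -[-> ->].
case: cases => h; [left|right].
  rewrite -XE; apply: arc => //; [lra|lra|] => t t0 t1.
  have [E|N] := eqVneq t s; first by have [->|->] := @ends t ltac:(by left; rewrite E); [left|right; left].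
  have [E|N'] := eqVneq t s'; first by have [->|->] := @ends t ltac:(by right; rewrite E); [left|right; left].
  by right; right; apply: h; rewrite lt_neqAle ?t0 ?t1 ?N'// eq_sym N.
have -> : L - (s' - s) = (s + L) - s' by ring.
rewrite -XE distrC -(per s); apply: arc; [lra|lra|lra|lra|] => t t0 t1.
have [E|N] := eqVneq t s'; first by have [->|->] := @ends t ltac:(by right; rewrite E); [left|right; left].
have [E|N'] := eqVneq t (s + L); first by have [->|->] := @ends t ltac:(by left; rewrite E per); [left|right; left].
by right; right; apply: h; rewrite lt_neqAle ?t0 ?t1 ?N'// eq_sym N.
Qed.

(** Two alternatives occur because the lower arc may or may not contain the base point of the
    curve. *)
Lemma arc_dist s s' : 0 <= s -> s < s' -> s' < L -> touch (gamma s) -> touch (gamma s') ->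
  s' - s <= 2 * `|X (gamma s') - X (gamma s)| \/
  L - (s' - s) <= 2 * `|X (gamma s') - X (gamma s)|.
Proof.
move=> s0 ss sL ts ts'; have [L0 _ _ _ _] := aC.
have bs : bdry C (gamma s) by apply: gamma_bdry; lra.
have bs' : bdry C (gamma s') by apply: gamma_bdry; lra.
have [h|h|h] := ltgtP (X (gamma s)) (X (gamma s')).
- by rewrite gtr0_norm ?subr_gt0//; apply: (arc_dist_aux s0 ss sL _ ts ts' h); left.
- by rewrite ltr0_norm ?subr_lt0// opprB; apply: (arc_dist_aux s0 ss sL _ ts' ts h); right.
(* Touched points with equal abscissas coincide, as neither is steeply above the other. *)
- exfalso; apply: (gamma_neq s0 ss _ _); [lra|lra|].
  apply: frame_inj => //.
  have := touch_not_steep ts (bdry_closure bs'); have := touch_not_steep ts' (bdry_closure bs).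
  by rewrite h subrr normr0 => /negP + /negP; rewrite -!leNgt; lra.
Qed.

End lower_arcs.

(** * Two facts on functions of one variable *)

Section line_lemmas.
Context {R : realType}.
Notation mu := (@lebesgue_measure R).

Lemma norm_sub_le (s t r : R) : 0 <= s <= r -> 0 <= t <= r -> `|s - t| <= r.
Proof. by move=> /andP[? ?] /andP[? ?]; rewrite ler_norml; apply/andP; split; lra. Qed.

(** Each interval of a cover of [A] is mapped into a segment that is no longer, and these segments
    cover [[a, b]]. *)
Lemma lipschitz_image_measure (A : set R) (F : R -> R) (a b : R) : a <= b ->
  (forall s t, `|F s - F t| <= `|s - t|) ->
  (forall x, a <= x -> x <= b -> exists2 s, A s & F s = x) ->
  ((b - a)%:E <= mu A)%E.
Proof.
move=> ab FL surj; have [|Aoo] := leP +oo%E (mu A).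
  by rewrite leye_eq => /eqP ->; rewrite leey.
have mA0 : (0 <= mu A)%E by exact: outer_measure_ge0.
apply/lee_addgt0Pr => /= e e0.
have [I_ AI Ie] : exists2 I_, open_itv_cover A I_ &
    (\sum_(0 <= k <oo) wlength idfun (I_ k) <= mu A + e%:E)%E.
  have fA : mu A \is a fin_num by rewrite ge0_fin_numE.
  have : ((wlength idfun)^* A)%mu \is a fin_num by exact: fA.
  rewrite outer_measure_open_itv_cover.
  move=> /lb_ereal_inf_adherent-/(_ _ e0)[_/= [I_]] AI <- Ie.
  exists I_ => //; apply: ltW; apply: lt_le_trans Ie _.
  by rewrite -outer_measure_open_itv_cover.
have [AI1 AI2] := AI.
have cover k : exists G : set R, [/\ measurable G, (forall s, I_ k s -> G (F s)) &
    (mu G <= wlength idfun (I_ k))%E].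
  have [[p q] /= ->] := AI1 k.
  have [qp|pq] := leP q p.
    exists set0; split => //; last by rewrite measure0; exact: wlength_ge0.
    by move=> s; rewrite /= in_itv/= => /andP[ps sq]; move: (lt_trans ps sq); rewrite ltNge qp.
  pose c := (p + q) / 2.
  exists `[F c - (q - p) / 2, F c + (q - p) / 2]%classic; split => //.
    move=> s; rewrite /= !in_itv/= => /andP[ps sq].
    have : `|F s - F c| <= (q - p) / 2.
      apply: (le_trans (FL _ _)); rewrite ler_norml /c; apply/andP; split; lra.
    by rewrite ler_norml => /andP[h1 h2]; apply/andP; split; lra.
  rewrite wlength_itv/= lebesgue_measure_itv/= !lte_fin pq ifT; last by lra.
  by rewrite -EFinB lee_fin; lra.
pose G k := projT1 (cid (cover k)).
have GP k : [/\ measurable (G k), (forall s, I_ k s -> G k (F s)) &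
    (mu (G k) <= wlength idfun (I_ k))%E] by rewrite /G; case: cid.
have abG : `[a, b]%classic `<=` \bigcup_k G k.
  move=> x; rewrite /= in_itv/= => /andP[ax xb]; have [s As <-] := surj x ax xb.
  by have [k _ Ik] := AI2 s As; exists k => //; have [_ h _] := GP k; exact: h.
have muab : ((b - a)%:E <= mu (`[a, b]%classic : set R))%E.
  rewrite lebesgue_measure_itv/= lte_fin.
  by case: ltgtP ab => // -> _; rewrite subrr.
apply: (le_trans muab).
have := @measure_sigma_subadditive _ _ _ mu `[a, b]%classic G
  (fun k => let: And3 h _ _ := GP k in h) (measurable_itv _) abG.
move=> /le_trans; apply; apply: le_trans Ie; apply: lee_nneseries => // k _.
by have [] := GP k.
Qed.

(** [g] decreases up to a minimum point [m] and increases afterwards. On either side of [m] the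
    shifted difference telescopes and leaves an interval of length [eps] at the outer end; a third
    one ends at [m]. Each costs at most [eps * B]. *)
Lemma quasi_convex_shift (g : R -> R) (a b B eps : R) : a <= b -> 0 <= eps ->
  continuous g -> (forall x, a <= x -> x <= b + eps -> 0 <= g x <= B) ->
  (forall x y z, a <= x -> x <= y -> y <= z -> z <= b + eps -> g y <= Num.max (g x) (g z)) ->
  \int[mu]_x (\1_(`[a, b]%classic) x * `|g (x + eps) - g x|) <= 3 * eps * B.
Proof.
move=> ab e0 cg gB qg.
have [m mab gm] : exists2 m, m \in `[a, b + eps] & forall x, x \in `[a, b + eps] -> g m <= g x.
  by apply: EVT_min; [lra|exact: continuous_subspaceT].
move: mab; rewrite in_itv/= => /andP[am mb].
have B0 : 0 <= B by have /andP[] := gB m am mb; exact: le_trans.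
have le_eps x : x <= x + eps by rewrite lerDl.
have ale x : a <= x -> a <= x + eps by move/le_trans; apply.
have leb x : x <= b -> x <= b + eps by move/le_trans; apply.
have leb' x : x <= b -> x + eps <= b + eps by rewrite lerD2r.
have mb' : m - eps <= b + eps by rewrite (le_trans _ mb)// gerBl.
have dec x y : a <= x -> x <= y -> y <= m -> g y <= g x.
  move=> ax xy ym; have := qg x y m ax xy ym mb; rewrite (max_idPl _)//.
  by apply: gm; rewrite in_itv/= ax; lra.
have inc x y : m <= x -> x <= y -> y <= b + eps -> g x <= g y.
  move=> mx xy yb; have := qg m x y am mx xy yb; rewrite (max_idPr _)//.
  by apply: gm; rewrite in_itv/= yb andbT; lra.
have mg : measurable_fun setT g by exact: continuous_measurable_fun.
have bg p q : a <= p -> q <= b + eps -> bbsR (fun x => \1_(`[p, q]%classic) x * g x).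
  move=> ap qb; apply: (bbs_dominated (K := B) (bbs_segment p q)).
    by apply: measurable_funM => //; have [] := bbs_segment p q.
  move=> x; rewrite segE; case: (boolP ((p <= x) && (x <= q))) => [/andP[px xq]|_].
    have /andP[g0 gB'] := gB x (le_trans ap px) (le_trans xq qb).
    by rewrite mul1r normr1 mulr1 ger0_norm.
  by rewrite !mul0r normr0 mulr0.
have mgs : measurable_fun setT (fun x : R => g (x + eps)).
  by apply: (measurableT_comp mg); exact: measurable_realfun.measurable_funD.
have bI : bbsR (fun x => \1_(`[a, b]%classic) x * `|g (x + eps) - g x|).
  apply: (bbs_dominated (K := B) (bbs_segment a b)).
    apply: measurable_funM; first by have [] := bbs_segment a b.
    by apply: measurableT_comp => //; exact: measurable_realfun.measurable_funB.
  move=> x; rewrite segE; case: (boolP ((a <= x) && (x <= b))) => [/andP[ax xb]|_].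
    have /andP[g0 gB0] := gB x ax (leb x xb).
    have /andP[g1 gB1] := gB (x + eps) (ale x ax) (leb' x xb).
    by rewrite mul1r normr1 mulr1 normr_id norm_sub_le// ?g0 ?g1.
  by rewrite !mul0r normr0 mulr0.
have bP := bg a (m - eps) (lexx a) mb'.
have bf1 := bg (a + eps) m (ale a (lexx a)) mb.
have bf2 := bg (m + eps) (b + eps) (ale m am) (lexx _).
have bQ := bg m b am (leb b (lexx b)).
have bE := bbsZ B (bbs_segment (m - eps) m).
have bS := bbsD (bbsB (bbsD (bbsB bP (bbs_shift eps bf1)) (bbs_shift eps bf2)) bQ) bE.
have bS' := bbsD (bbsB (bbsD (bbsB bP bf1) bf2) bQ) bE.
apply: (@le_trans _ _ (\int[mu]_x (\1_(`[a, m - eps]%classic) x * g x -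
   \1_(`[a + eps, m]%classic) (x + eps) * g (x + eps) +
   \1_(`[m + eps, b + eps]%classic) (x + eps) * g (x + eps) -
   \1_(`[m, b]%classic) x * g x + B * \1_(`[m - eps, m]%classic) x))).
  apply: (le_Rint norm1_fin bI bS) => x; rewrite !segE.
  rewrite !lerD2r (_ : (x + eps <= m) = (x <= m - eps)); last by rewrite lerBrDr.
  have [xa|ax] := ltP x a.
    have -> : (m <= x) = false by apply/negbTE; rewrite -ltNge (lt_le_trans xa).
    by rewrite /= !mul0r ?(subrr, addr0, add0r, subr0) mulr_ge0.
  have [bx|xb] := ltP b x.
    have -> : (x <= m - eps) = false by apply/negbTE; rewrite -ltNge; lra.
    by rewrite !andbF !mul0r ?(subrr, addr0, add0r, subr0) mulr_ge0.
  have /andP[g0 gB0] := gB x ax (leb x xb).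
  have /andP[g1 gB1] := gB (x + eps) (ale x ax) (leb' x xb).
  rewrite /= andbT mul1r; have [xm|mx] := leP x (m - eps).
    have := dec x (x + eps) ax (le_eps x); rewrite -lerBrDr => /(_ xm) d.
    rewrite ler0_norm ?subr_le0// opprB !mul1r.
    have [mx|_] := leP m x; last by rewrite !mul0r addr0 subr0 lerDl mulr_ge0.
    have i := inc x (x + eps) mx (le_eps x) (leb' x xb).
    have : 0 <= B * ((m - eps <= x) && (x <= m))%:R by rewrite mulr_ge0.
    rewrite /= !mul1r; lra.
  rewrite (ltW mx) /= !mul0r subrr add0r; have [xm|xm] := leP m x.
    have i := inc x (x + eps) xm (le_eps x) (leb' x xb).
    by rewrite !mul1r ger0_norm ?subr_ge0// lerDl mulr_ge0.
  by rewrite (ltW xm) !mul0r subrr add0r mulr1 norm_sub_le// ?g0 ?g1.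
have bs1 := bbsZ B (bbs_segment a (a + eps)).
have bs2 := bbsZ B (bbs_segment b (b + eps)).
have bs12 := bbsD (bbsD bs1 bs2) bE.
apply: (@le_trans _ _ (\int[mu]_x (B * \1_(`[a, a + eps]%classic) x +
   B * \1_(`[b, b + eps]%classic) x + B * \1_(`[m - eps, m]%classic) x))); last first.
  rewrite (RintD norm1_fin (bbsD bs1 bs2) bE) (RintD norm1_fin bs1 bs2).
  rewrite !(RintZ norm1_fin B (bbs_segment _ _)) !Rint_segment// ?gerBl//.
  by have -> : B * (a + eps - a) + B * (b + eps - b) + B * (m - (m - eps)) = 3 * eps * B by ring.
rewrite (RintD norm1_fin (bbsB (bbsD (bbsB bP (bbs_shift eps bf1)) (bbs_shift eps bf2)) bQ) bE).
rewrite (RintB norm1_fin (bbsD (bbsB bP (bbs_shift eps bf1)) (bbs_shift eps bf2)) bQ).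
rewrite (RintD norm1_fin (bbsB bP (bbs_shift eps bf1)) (bbs_shift eps bf2)).
rewrite (RintB norm1_fin bP (bbs_shift eps bf1)).
(* Translated back, the shifted terms cancel outside intervals of length [eps]. *)
rewrite (Rint_shift eps bf1) (Rint_shift eps bf2).
rewrite -(RintB norm1_fin bP bf1) -(RintD norm1_fin (bbsB bP bf1) bf2).
rewrite -(RintB norm1_fin (bbsD (bbsB bP bf1) bf2) bQ) -(RintD norm1_fin (bbsB (bbsD (bbsB bP bf1) bf2) bQ) bE).
apply: (le_Rint norm1_fin bS' bs12) => x; rewrite lerD2r !segE.
have pc p q : a <= p -> q <= b + eps -> 0 <= ((p <= x) && (x <= q))%:R * g x <= B * ((p <= x) && (x <= q))%:R.
  move=> ap qb; case: (boolP ((p <= x) && (x <= q))) => [/andP[px xq]|_].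
    by rewrite mul1r mulr1; apply: gB; [exact: le_trans px|exact: le_trans qb].
  by rewrite mul0r mulr0 lexx.
apply: (@le_trans _ _ (((a <= x) && (x <= a + eps))%:R * g x + ((b <= x) && (x <= b + eps))%:R * g x)); last first.
  have /andP[_ h1] := pc a (a + eps) (lexx a) (leb' a ab).
  have /andP[_ h2] := pc b (b + eps) ab (lexx _).
  exact: lerD.
rewrite -subr_ge0 -!mulNr -!mulrDl -mulrBl.
have [gx|gx] := boolP ((a <= x) && (x <= b + eps)); last first.
  have out p q : a <= p -> q <= b + eps -> ((p <= x) && (x <= q)) = false.
    by move=> ap qb; apply/negbTE; apply: contra gx => /andP[px xq]; apply/andP; split; [exact: le_trans px|exact: le_trans qb].
  by rewrite !out ?(subrr, addr0, mul0r)//; by [exact: ale|exact: leb|exact: leb'].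
have /andP[ax xb] := gx; have /andP[g0 _] := gB x ax xb.
rewrite mulr_ge0// ax xb /= !andbT.
have c1 : (x <= m - eps)%R%:R <= ((a + eps <= x) && (x <= m))%R%:R + (x <= a + eps)%R%:R :> R.
  case: (leP x (m - eps)) => h1; last by rewrite addr_ge0.
  have -> : x <= m by rewrite (le_trans h1)// gerBl.
  by case: (leP (a + eps) x) => [_|/ltW->]; rewrite /= ?add0r// lerDl.
have c2 : (m + eps <= x)%R%:R <= ((m <= x) && (x <= b))%R%:R + (b <= x)%R%:R :> R.
  case: (leP (m + eps) x) => h1; last by rewrite addr_ge0.
  have -> : m <= x by rewrite (le_trans _ h1).
  by case: (leP x b) => [_|/ltW->]; rewrite /= ?add0r// lerDl.
by move: c1 c2; clear; lra.
Qed.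

End line_lemmas.

(** * Depth below the supporting line *)

Section small_angles.
Context {R : realType}.

Lemma cos_ge_half (x : R) : `|x| <= 1 -> 2^-1 <= cos x.
Proof.
move=> x1; have := cosB1_le x; have : x ^+ 2 <= 1.
  by rewrite -[leRHS](expr1n _ 2) -real_normK ?num_real// ler_pXn2r ?nnegrE.
lra.
Qed.

Lemma sin_ge_half (x : R) : 0 <= x -> x <= 1 -> x / 2 <= sin x.
Proof.
move=> x0 x1.
have [c] := @MVT_segment R (@sin R) (@cos R) 0 x x0
  (fun y _ => is_derive_sin y) (continuous_subspaceT (@continuous_sin R)).
rewrite in_itv/= => /andP[c0 cx]; rewrite sin0 !subr0 => ->.
rewrite mulrC ler_wpM2r// cos_ge_half// ger0_norm//; exact: le_trans cx x1.
Qed.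

Lemma max_lipschitz (x y m : R) : `|Num.max x m - Num.max y m| <= `|x - y|.
Proof.
have := ler_norm (x - y); have := ler_norm (y - x); rewrite [`|y - x|]distrC.
have := normr_ge0 (x - y); move: `|x - y| => d d0 h1 h2; rewrite ler_norml.
by case: (leP x m); case: (leP y m) => *; apply/andP; split; lra.
Qed.

Lemma min_lipschitz (x y m : R) : `|Num.min x m - Num.min y m| <= `|x - y|.
Proof.
have := ler_norm (x - y); have := ler_norm (y - x); rewrite [`|y - x|]distrC.
have := normr_ge0 (x - y); move: `|x - y| => d d0 h1 h2; rewrite ler_norml.
by case: (leP x m); case: (leP y m) => *; apply/andP; split; lra.
Qed.

Lemma norm_between (c d t x r : R) : `|c - t| <= r -> `|d - t| <= r -> c <= x -> x <= d ->
  `|x - t| <= r.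
Proof.
by rewrite !ler_norml => /andP[? ?] /andP[? ?] ? ?; apply/andP; split; lra.
Qed.

Lemma norm_shift_le (x t p q r : R) : `|x - t| <= p -> `|q| <= r -> `|x + q - t| <= p + r.
Proof.
move=> xp qr; rewrite addrAC (le_trans (ler_normD _ _))//; exact: lerD.
Qed.

Lemma norm_halfD (x t q : R) : `|x - t| <= 2^-1 -> `|q| <= 2^-1 -> `|x + q - t| <= 1.
Proof. by move=> xp qr; rewrite (le_trans (norm_shift_le xp qr))//; lra. Qed.

Lemma norm_half_between (c d x t eps : R) : `|c - t| <= 2^-1 -> `|d - t| <= 2^-1 ->
  eps <= 2^-1 -> c - eps <= x -> x <= d + eps -> `|x - t| <= 1.
Proof.
by rewrite !ler_norml => /andP[? ?] /andP[? ?] ? ? ?; apply/andP; split; lra.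
Qed.

Lemma norm_sub_lt (s t r : R) : 0 <= s -> s < r -> 0 <= t -> t < r -> `|s - t| < r.
Proof. by move=> *; rewrite ltr_norml; apply/andP; split; lra. Qed.

Lemma norm_sub_perturb (s s' t t' r q : R) : `|s' - s| <= r -> `|t' - t| <= r ->
  `|s' - t'| <= q -> `|s - t| <= q + 2 * r.
Proof.
by rewrite !ler_norml => /andP[? ?] /andP[? ?] /andP[? ?]; apply/andP; split; lra.
Qed.

Lemma norm_half_le1 (x : R) : `|x| <= 2^-1 -> `|x| <= 1.
Proof. by move=> h; lra. Qed.

Lemma measurable_le_real d (T : measurableType d) (f : T -> R) (c : R) :
  measurable_fun setT f -> measurable_fun setT (fun z => (f z <= c)%R%:R : R).
Proof.
move=> mf; have mA : measurable (f @^-1` `]-oo, c]).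
  by rewrite -[X in measurable X]setTI; apply: mf => //; exact: measurable_itv.
rewrite (_ : (fun z => _) = \1_(f @^-1` `]-oo, c])); first exact: measurable_indic.
apply/funext => z; rewrite indicE; congr (nat_of_bool _)%:R.
by apply/idP/idP => [h|/set_mem]; [apply/mem_set|]; rewrite /= in_itv/=.
Qed.

Notation mu := (@lebesgue_measure R).

Lemma bbs_oc (a b : R) : bbsR (\1_(`]a, b]%classic)).
Proof.
apply: (@bbs_itv R `]a, b] (Num.max `|a| `|b|)) => x; rewrite in_itv/= => /andP[ax xb].
rewrite le_max; have [x0|x0] := leP 0 x.
  by rewrite ger0_norm// (le_trans xb (ler_norm _)) orbT.
apply/orP; left; rewrite ltr0_norm// -(normrN a); apply: le_trans (ler_norm _).
by rewrite lerN2 ltW.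
Qed.

Lemma Rint_oc (a b : R) : a <= b -> \int[mu]_x \1_(`]a, b]%classic) x = b - a.
Proof.
move=> ab; rewrite Rint_indic; last exact: measurable_itv.
have := lebesgue_measure_itv `]a, b]; rewrite /= lte_fin => ->.
by case: ltgtP ab => //= -> _; rewrite subrr.
Qed.

Lemma ocE (a b x : R) : \1_(`]a, b]%classic) x = ((a < x) && (x <= b))%R%:R :> R.
Proof. by rewrite indicE; congr (nat_of_bool _)%:R; rewrite mem_setE in_itv. Qed.

(** A cyclic interval around [s1] is unrolled into three copies, since it may wrap around either end
    of a period. *)
Lemma cyclic_cover (L r s s1 : R) : 0 <= r -> `|s - s1| <= r \/ L - `|s - s1| <= r ->
  `|s - s1| < L ->
  1 <= \1_(`[s1 - r, s1 + r]%classic) s + \1_(`[s1 + L - r, s1 + L + r]%classic) s +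
       \1_(`[s1 - L - r, s1 - L + r]%classic) s :> R.
Proof.
move=> r0 h hL; rewrite !segE.
have one (a b c : R) : a = 1 \/ b = 1 \/ c = 1 -> 0 <= a -> 0 <= b -> 0 <= c -> 1 <= a + b + c.
  by case=> [->|[->|->]] a0 b0 c0; lra.
apply: one => //.
have [ss|ss] := leP s1 s; move: h hL; [rewrite ger0_norm ?subr_ge0//|rewrite ltr0_norm ?subr_lt0//].
  by case=> h hL; [left|right; left]; rewrite (_ : _ && _ = true)//; apply/andP; split; lra.
by case=> h hL; [left|right; right]; rewrite (_ : _ && _ = true)//; apply/andP; split; lra.
Qed.

(** The integral telescopes to that of [g] over the last interval of length [eps] minus that over
    the first one. *)
Lemma rise_integral (g : R -> R) (M a b eps h H : R) : measurable_fun setT g ->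
  (forall x, `|g x| <= M) -> 0 <= eps -> a + eps <= b ->
  (forall x, a <= x -> x <= a + eps -> g x <= h) ->
  (forall x, b - eps <= x -> x <= b -> H <= g x) ->
  bbsR (fun x => \1_(`]a + eps, b]%classic) x * (g x - g (x - eps))) /\
  (H - h) * eps <= \int[mu]_x (\1_(`]a + eps, b]%classic) x * (g x - g (x - eps))).
Proof.
move=> mg gM e0 ab gh gH.
have bg p q : bbsR (fun x => \1_(`]p, q]%classic) x * g x) := bbsM (bbs_oc p q) mg gM.
have b1 := bg (a + eps) b; have b2 := bg a (b - eps).
have bI : bbsR (fun x => \1_(`]a + eps, b]%classic) x * (g x - g (x - eps))).
  have := bbsB b1 (bbs_shift (- eps) b2); congr bbs; apply/funext => x.
  by rewrite !ocE ltrBrDr lerD2r mulrBr.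
split => //.
have -> : \int[mu]_x (\1_(`]a + eps, b]%classic) x * (g x - g (x - eps))) =
    \int[mu]_x (\1_(`]a + eps, b]%classic) x * g x - \1_(`]a, b - eps]%classic) x * g x).
  rewrite (RintB norm1_fin b1 b2) -(Rint_shift (- eps) b2) -(RintB norm1_fin b1 (bbs_shift (- eps) b2)).
  by apply: eq_Rintegral => x _; rewrite !ocE ltrBrDr lerD2r mulrBr.
have -> : (H - h) * eps = \int[mu]_x (H * \1_(`]b - eps, b]%classic) x - h * \1_(`]a, a + eps]%classic) x).
  rewrite (RintB norm1_fin (bbsZ _ (bbs_oc _ _)) (bbsZ _ (bbs_oc _ _))).
  rewrite !(RintZ norm1_fin _ (bbs_oc _ _)) !Rint_oc; [|lra|lra].
  by ring.
apply: (le_Rint norm1_fin (bbsB (bbsZ _ (bbs_oc _ _)) (bbsZ _ (bbs_oc _ _))) (bbsB b1 b2)) => x.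
rewrite !ocE; case: (leP x a) => xa.
  have -> : (a + eps < x) = false by apply/negbTE; rewrite -leNgt; lra.
  have -> : (b - eps < x) = false by apply/negbTE; rewrite -leNgt; lra.
  by rewrite /= !mul0r !mulr0.
case: (leP x (a + eps)) => xae.
  have xb : x <= b by lra.
  rewrite xb; have [bx|bx] := ltP (b - eps) x.
    by rewrite /= !mulr1 !mul0r !subr0; have := gh x (ltW xa) xae; have := gH x (ltW bx) xb; lra.
  by rewrite /= mulr0 mul0r mulr1 mul1r; have := gh x (ltW xa) xae; lra.
have [bx|bx] := ltP (b - eps) x; last first.
  have xb : x <= b by lra.
  by rewrite xb /= !mulr0 !mul1r !subrr.
case: (leP x b) => xb; last by rewrite /= !mulr0 !mul0r.
by rewrite /= !mulr1 mulr0 mul1r mul0r; have := gH x (ltW bx) xb; lra.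
Qed.

(** A step of [eps] changes [g] by at most [lambda / 4], so [g] is below [lambda / 4] on the first
    interval and above [3 * lambda / 4] on the last one. *)
Lemma rise_lower_bound (g F : R -> R) (M t b eps lambda : R) :
  continuous g -> (forall x, `|g x| <= M) -> (forall x y, `|g x - g y| <= M * `|x - y|) ->
  bbsR F -> (forall x, 0 <= F x) -> t <= b -> g t = 0 -> g b = lambda ->
  0 < M -> 0 < eps -> 0 < lambda -> M * eps * 4 <= lambda ->
  (forall x, t <= x -> x <= b -> g x - g (x - eps) <= F x) ->
  eps * lambda / 2 <= \int[mu]_x F x.
Proof.
move=> cg gM gL bF F0 tb gt gb M0 e0 l0 Me FG.
have mg : measurable_fun setT g by exact: continuous_measurable_fun.
have -> : eps * lambda / 2 = (3 * lambda / 4 - lambda / 4) * eps by lra.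
have near x y : `|x - y| <= eps -> `|g x - g y| <= lambda / 4.
  move=> xy; apply: le_trans (gL x y) _; rewrite ler_pdivlMr//.
  by apply: le_trans Me; rewrite ler_wpM2r// ler_wpM2l// ltW.
have low x : t <= x -> x <= t + eps -> g x <= lambda / 4.
  move=> h1 h2; have := near x t; rewrite gt subr0 ger0_norm ?subr_ge0// lerBlDl.
  by move=> /(_ h2); exact: le_trans (ler_norm _).
have high x : b - eps <= x -> x <= b -> 3 * lambda / 4 <= g x.
  move=> h1 h2; have := near b x; rewrite gb ger0_norm ?subr_ge0// lerBlDr -lerBlDl => /(_ h1) h.
  by have := ler_norm (lambda - g x); lra.
have far : t + eps <= b.
  have := gL b t; rewrite gb gt subr0 gtr0_norm// ger0_norm ?subr_ge0// => h.
  rewrite -lerBrDl leNgt; apply/negP => h'.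
  have : M * (b - t) < M * eps by rewrite ltr_pM2l.
  have := mulr_gt0 M0 e0; lra.
have [bI hI] := rise_integral mg gM (ltW e0) far low high.
apply: le_trans hI _; apply: (le_Rint norm1_fin bI bF) => x.
rewrite ocE; case: (boolP ((t + eps < x) && (x <= b))) => [/andP[h1 h2]|_].
  rewrite mul1r; apply: FG => //; apply: le_trans (ltW h1); by rewrite lerDl ltW.
by rewrite mul0r.
Qed.

End small_angles.

(** * Directions close to a fixed one *)

Section window.
Context {R : realType}.
Notation mu := (@lebesgue_measure R).
Variables (C : set (R * R)) (L : R) (gamma : R -> R * R) (theta0 : R).
Hypotheses (bC : convex_body C) (aC : arc_length_param C L gamma).
Let K := closure C.
Let cK : compact_convex K := closure_compact_convex bC.
Let e := uvec theta0.
Let ue : unit_dir e := unit_uvec theta0.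
Let X (z : R * R) := dot z (perp e).
Let Y (z : R * R) := dot z e.

Definition depth (z : R * R) (theta : R) := dot z (uvec theta) - supp K (uvec theta).

(* Within angle 1 of [theta0] the weight is [1 / cos (theta - theta0)]; the
   truncation makes it globally Lipschitz. *)
Definition weight (theta : R) := (Num.max (cos (theta - theta0)) 2^-1)^-1.

(** Near [theta0] this is the distance from [z] to the supporting line measured along [e] instead of
    orthogonally to the line. *)
Definition gap z theta := depth z theta * weight theta.

Let K0 : K !=set0 := body_closure_neq0 bC.

Lemma depth_ge0 z theta : K z -> 0 <= depth z theta.
Proof. by move=> Kz; rewrite subr_ge0; exact: supp_le. Qed.

Let wmax theta : 2^-1 <= Num.max (cos (theta - theta0)) 2^-1 <= 1.
Proof.
rewrite le_max lexx orbT ge_max cos_le1 /=; lra.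
Qed.

Lemma weight_bounds theta : 1 <= weight theta <= 2.
Proof.
have /andP[h1 h2] := wmax theta; rewrite /weight.
have p : 0 < Num.max (cos (theta - theta0)) 2^-1 by apply: lt_le_trans h1; rewrite invr_gt0.
apply/andP; split; first by rewrite invf_ge1.
by rewrite -[leRHS]invrK lef_pV2// posrE invr_gt0.
Qed.

Lemma weight_lipschitz s t : `|weight s - weight t| <= 4 * `|s - t|.
Proof.
rewrite /weight; set a := Num.max _ _; set b := Num.max _ _.
have /andP[a1 _] := wmax s; have /andP[b1 _] := wmax t; rewrite -/a -/b in a1 b1.
have ab : `|a - b| <= `|s - t|.
  have := cos_lipschitz (s - theta0) (t - theta0); rewrite opprB addrA subrK => h.
  apply: le_trans h; exact: max_lipschitz.
have a0 : 0 < a by lra.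
have b0 : 0 < b by lra.
have -> : a^-1 - b^-1 = (b - a) * (a^-1 * b^-1).
  by field; rewrite !gt_eqF.
rewrite normrM distrC mulrC ler_pM//.
rewrite ger0_norm ?mulr_ge0 ?invr_ge0 ?(ltW a0) ?(ltW b0)//.
have ha : a^-1 <= 2 by rewrite -[leRHS]invrK lef_pV2// posrE invr_gt0.
have hb : b^-1 <= 2 by rewrite -[leRHS]invrK lef_pV2// posrE invr_gt0.
apply: (@le_trans _ _ (2 * 2)); last by lra.
by rewrite ler_pM// invr_ge0 ltW.
Qed.

Lemma weightE theta : `|theta - theta0| <= 1 -> weight theta = (cos (theta - theta0))^-1.
Proof. by move/cos_ge_half => h; rewrite /weight max_l. Qed.

Lemma supp_uvec_lipschitz D s t : (forall z, K z -> `|z.1| <= D /\ `|z.2| <= D) ->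
  `|supp K (uvec s) - supp K (uvec t)| <= 2 * D * `|s - t|.
Proof.
move=> KD; wlog st : s t / supp K (uvec s) <= supp K (uvec t).
  move=> H; have [|h] := leP (supp K (uvec s)) (supp K (uvec t)); first exact: H.
  by rewrite distrC [`|s - t|]distrC; apply: H; exact: ltW.
have [p Kp ps] := supp_attained (uvec s) cK K0; have [p1 p2] := KD _ Kp.
rewrite ler0_norm ?subr_le0// opprB -ps.
apply: le_trans (dot_uvec_lipschitz s t p1 p2).
rewrite distrC; apply: le_trans (ler_norm _).
by rewrite lerD2r; exact: supp_le.
Qed.

(** [M] depends on the body; it only restricts the step [eps] and the range of [lambda], and does
    not reach the final constants. *)
Lemma gap_regular : exists M, [/\ 1 <= M,
  forall z s t, K z -> `|gap z s - gap z t| <= M * `|s - t| &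
  forall z t, K z -> 0 <= gap z t <= M].
Proof.
have [_ [D KD] _] := cK.
have D0 : 0 <= D by have [z Kz] := K0; have [+ _] := KD _ Kz; exact: le_trans.
have db z t : K z -> depth z t <= 4 * D.
  move=> Kz; have [z1 z2] := KD _ Kz; have := dot_unit_bound (unit_uvec t) z1 z2.
  have [p Kp pt] := supp_attained (uvec t) cK K0; have [p1 p2] := KD _ Kp.
  have := dot_unit_bound (unit_uvec t) p1 p2; rewrite pt !ler_norml /depth => /andP[? ?] /andP[? ?]; lra.
exists (24 * D + 1); split; first by rewrite lerDr mulr_ge0.
  move=> z s t Kz; have [z1 z2] := KD _ Kz.
  have -> : gap z s - gap z t = (depth z s - depth z t) * weight s +
      depth z t * (weight s - weight t) by rewrite /gap; ring.
  rewrite (le_trans (ler_normD _ _))// !normrM.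
  have /andP[w1 w2] := weight_bounds s.
  have a1 : `|depth z s - depth z t| <= 4 * D * `|s - t|.
    have -> : depth z s - depth z t = (dot z (uvec s) - dot z (uvec t)) -
        (supp K (uvec s) - supp K (uvec t)) by rewrite /depth; ring.
    rewrite (le_trans (ler_normB _ _))//.
    have := dot_uvec_lipschitz s t z1 z2; have := supp_uvec_lipschitz s t KD; lra.
  have a2 : `|depth z s - depth z t| * `|weight s| <= 4 * D * `|s - t| * 2.
    by rewrite ler_pM// ger0_norm// (le_trans _ w1).
  have a3 : `|depth z t| * `|weight s - weight t| <= 4 * D * (4 * `|s - t|).
    by rewrite ler_pM ?weight_lipschitz// ger0_norm ?db// depth_ge0.
  have := normr_ge0 (s - t); lra.
move=> z t Kz; have := db z t Kz; have := depth_ge0 t Kz; rewrite /gap.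
have /andP[w1 w2] := weight_bounds t; move: (weight t) (depth z t) w1 w2 => w d w1 w2 d0 d1.
apply/andP; split; first by rewrite mulr_ge0//; lra.
have : d * w <= 4 * D * 2 by rewrite ler_pM//; lra.
lra.
Qed.

Let dot_frame z theta : dot z (uvec theta) =
  cos (theta - theta0) * Y z + sin (theta - theta0) * X z.
Proof.
have := cos2Dsin2 theta0.
rewrite /Y /X /e /perp /dot /uvec /= cosB sinB.
move: (cos theta0) (sin theta0) (cos theta) (sin theta) => a b c d ab.
transitivity ((z.1 * c + z.2 * d) * (a ^+ 2 + b ^+ 2)); first by rewrite ab mulr1.
by ring.
Qed.

Let sec theta theta' := (cos (theta - theta0))^-1 * (cos (theta' - theta0))^-1.

(** The gap is a convex function of [tan (theta - theta0)], with subgradient [X z - X p] where the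
    supporting line touches [p]; the factor on the left is the increment of this tangent. *)
Lemma gap_shift z p theta theta' : K z -> K p -> depth p theta = 0 ->
  `|theta - theta0| <= 1 -> `|theta' - theta0| <= 1 ->
  sin (theta' - theta) * sec theta theta' * (X z - X p) <= gap z theta' - gap z theta.
Proof.
move=> Kz Kp dp t1 t1'; rewrite /gap !weightE//.
have c0 : 0 < cos (theta - theta0) by apply: lt_le_trans (cos_ge_half t1); rewrite invr_gt0.
have c0' : 0 < cos (theta' - theta0) by apply: lt_le_trans (cos_ge_half t1'); rewrite invr_gt0.
have dz : depth z theta = dot (z - p) (uvec theta).
  by rewrite dotBl; move: dp; rewrite /depth; lra.
have dz' : dot (z - p) (uvec theta') <= depth z theta'.
  by rewrite dotBl /depth lerD2l lerN2; exact: supp_le.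
apply: (@le_trans _ _ (dot (z - p) (uvec theta') / cos (theta' - theta0) -
                       dot (z - p) (uvec theta) / cos (theta - theta0))); last first.
  by rewrite dz lerD2r ler_pM2r// invr_gt0.
have -> : theta' - theta = (theta' - theta0) - (theta - theta0) by ring.
rewrite !dot_frame -(dotBl z p (perp e)) -/(X _) /sec.
move: c0 c0'; move: (X (z - p)) (Y (z - p)) (theta - theta0) (theta' - theta0) => x y ps ph.
rewrite sinB; move: (cos ps) (sin ps) (cos ph) (sin ph) => a b c d a0 c0.
by rewrite le_eqVlt; apply/orP; left; apply/eqP; field; rewrite !gt_eqF.
Qed.

Lemma sec_bounds theta theta' : `|theta - theta0| <= 1 -> `|theta' - theta0| <= 1 ->
  1 <= sec theta theta' <= 4.
Proof.
move=> t1 t1'; have := weightE t1; have := weightE t1'; rewrite /sec => <- <-.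
have /andP[a1 a2] := weight_bounds theta; have /andP[b1 b2] := weight_bounds theta'.
apply/andP; split.
  by rewrite -[leLHS]mulr1 ler_pM.
have -> : 4 = 2 * 2 :> R by lra.
by rewrite ler_pM//; [lra|lra].
Qed.

(** The subgradient inequality is applied to the step whose sign is that of [X z - X p]. *)
Lemma gap_shift_ge z p theta eps : K z -> K p -> depth p theta = 0 ->
  `|theta - theta0| <= 2^-1 -> 0 <= eps -> eps <= 2^-1 ->
  eps / 2 * `|X z - X p| <= `|gap z (theta + eps) - gap z theta| +
                          `|gap z (theta - eps) - gap z theta|.
Proof.
move=> Kz Kp dp t1 e0 e1.
have t0 := norm_half_le1 t1.
have tp : `|theta + eps - theta0| <= 1 by apply: (norm_halfD t1); rewrite ger0_norm.
have tm : `|theta - eps - theta0| <= 1 by apply: (norm_halfD t1); rewrite normrN ger0_norm.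
have := gap_shift Kz Kp dp t0 tp; have := gap_shift Kz Kp dp t0 tm.
have -> : theta - eps - theta = - eps by ring.
have -> : theta + eps - theta = eps by ring.
rewrite sinN.
have /andP[k1 _] := sec_bounds t0 tp; have /andP[k2 _] := sec_bounds t0 tm.
have e2 : eps <= 1 by lra.
have s1 := sin_ge_half e0 e2.
move: (sec _ _) (sec _ _) k1 k2 => k k' k1 k2 h2 h1.
have [x0|x0] := leP 0 (X z - X p).
  rewrite ger0_norm//.
  have : eps / 2 * (X z - X p) <= sin eps * k' * (X z - X p).
    rewrite ler_wpM2r// -[leLHS]mulr1 ler_pM//; lra.
  have := ler_norm (gap z (theta + eps) - gap z theta).
  have := normr_ge0 (gap z (theta - eps) - gap z theta); lra.
rewrite ltr0_norm//.
have : eps / 2 * - (X z - X p) <= sin eps * k * - (X z - X p).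
  rewrite ler_wpM2r ?oppr_ge0 ?(ltW x0)// -[leLHS]mulr1 ler_pM//; lra.
have := ler_norm (gap z (theta - eps) - gap z theta).
have := normr_ge0 (gap z (theta + eps) - gap z theta); lra.
Qed.

Lemma gap_shift_le z p theta eps : K z -> K p -> depth p theta = 0 ->
  `|theta - theta0| <= 2^-1 -> `|eps| <= 2^-1 ->
  gap z theta - gap z (theta + eps) <= 4 * `|eps| * `|X z - X p|.
Proof.
move=> Kz Kp dp t1 e1.
have t0 := norm_half_le1 t1.
have tp : `|theta + eps - theta0| <= 1 := norm_halfD t1 e1.
have := gap_shift Kz Kp dp t0 tp.
have -> : theta + eps - theta = eps by ring.
have /andP[k1 k4] := sec_bounds t0 tp.
have s1 : `|sin eps| <= `|eps|.
  by have := sin_lipschitz eps 0; rewrite sin0 !subr0.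
move: (sec _ _) k1 k4 => k k1 k4 h.
have : - (sin eps * k * (X z - X p)) <= `|eps| * 4 * `|X z - X p|.
  rewrite (le_trans (ler_norm _))// normrN normrM ler_wpM2r// normrM ler_pM//.
  by rewrite ger0_norm//; lra.
lra.
Qed.

(** By the subgradient inequality at [t], the gap does not decrease towards the end indicated by the
    sign of [X z - X p]. *)
Lemma gap_quasi_convex z t1 t t2 : K z -> `|t1 - theta0| <= 1 -> `|t2 - theta0| <= 1 ->
  t1 <= t -> t <= t2 -> gap z t <= Num.max (gap z t1) (gap z t2).
Proof.
move=> Kz a1 a2 h1 h2.
have a : `|t - theta0| <= 1 := norm_between a1 a2 h1 h2.
have [p Kp pt] := supp_attained (uvec t) cK K0.
have dp : depth p t = 0 by rewrite /depth pt subrr.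
have d2 : 0 <= t2 - t <= pi.
  have := pi_ge2 R; move: a a2; rewrite !ler_norml => /andP[? ?] /andP[? ?] ?.
  by apply/andP; split; lra.
have d1 : 0 <= t - t1 <= pi.
  have := pi_ge2 R; move: a a1; rewrite !ler_norml => /andP[? ?] /andP[? ?] ?.
  by apply/andP; split; lra.
have [x0|x0] := leP 0 (X z - X p).
  have /andP[k1 _] := sec_bounds a a2.
  rewrite le_max; apply/orP; right; rewrite -subr_ge0.
  apply: le_trans (gap_shift Kz Kp dp a a2).
  by apply: mulr_ge0 => //; apply: mulr_ge0; [exact: sin_ge0_pi|lra].
have /andP[k1 _] := sec_bounds a a1.
rewrite le_max; apply/orP; left; rewrite -subr_ge0.
apply: le_trans (gap_shift Kz Kp dp a a1).
have -> : t1 - t = - (t - t1) by ring.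
rewrite sinN !mulNr -mulrN; apply: mulr_ge0; last by rewrite oppr_ge0 ltW.
by apply: mulr_ge0; [exact: sin_ge0_pi|lra].
Qed.

Lemma gamma_real_bdry s : bdry C (gamma s).
Proof.
have [L0 per _ _ _] := aC.
have [n sn] : exists n : nat, 0 <= s + L *+ n.
  exists (Num.bound (`|s| / L)); have := archi_boundP (divr_ge0 (normr_ge0 s) (ltW L0)).
  rewrite ltr_pdivrMr// -mulr_natl => h.
  by have := ler_norm (- s); rewrite normrN; lra.
rewrite -(gammaMn aC n s); set t := s + _ in sn *.
pose m := Num.truncn (t / L).
have tL0 : 0 <= t / L by rewrite divr_ge0// ltW.
have /andP[m1 m2] := truncn_itv tL0; rewrite -/m in m1 m2.
have mL : L *+ m <= t by rewrite -mulr_natl -ler_pdivlMr.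
have mL' : t < L *+ m + L.
  by move: m2; rewrite ltr_pdivrMr// -natr1 mulrDl mul1r mulr_natl.
have -> : gamma t = gamma (t - L *+ m) by rewrite -(gammaMn aC m (t - L *+ m)) subrK.
by apply: (gamma_bdry aC); lra.
Qed.

Lemma gamma_closure s : K (gamma s).
Proof. by case: (gamma_real_bdry s). Qed.
Arguments gamma_closure : clear implicits.

(** A lowest point of the section through [w] cannot be interior. This projects points of the body
    onto the boundary curve. *)
Lemma lowest_point w : K w -> exists z, [/\ bdry C z, X z = X w & Y z <= Y w].
Proof.
move=> Kw.
have cA : compact (K `&` [set z | X z = X w]).
  apply: (subclosed_compact _ (compact_convex_compact cK)); last by move=> z [].
  apply: closedI; first exact: closed_closure.
  have -> : [set z | X z = X w] = X @^-1` [set X w] by [].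
  apply: closed_comp; first by move=> z _; exact: dot_continuous.
  exact: closed_eq.
have [z [Kz zw] zmin] := dot_min e cA (ex_intro _ w (conj Kw erefl)).
exists z; split => //; last by apply: (zmin w); split.
split => // /interior_push[d d0 dC].
have := zmin (z.1 - d * e.1, z.2 - d * e.2).
have -> : dot (z.1 - d * e.1, z.2 - d * e.2) e = dot z e - d * (e.1 ^+ 2 + e.2 ^+ 2).
  by rewrite /dot /=; ring.
rewrite ue mulr1 => H; suff : dot z e <= dot z e - d by lra.
apply: H; split; last by rewrite /= -zw /X /dot /=; ring.
by apply: subset_closure; apply: interior_subset; exact: dC.
Qed.

(** * Squared chords against touched perimeter: upper bound *)

Let perp_frame theta w : dot w (uvec theta) = 0 ->
  cos (theta - theta0) * dot w (perp (uvec theta)) = X w.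
Proof.
move=> dq; have -> : dot w (perp (uvec theta)) =
    cos (theta - theta0) * X w - sin (theta - theta0) * Y w.
  have := cos2Dsin2 theta0; rewrite /X /Y /e /perp /dot /= cosB sinB.
  move: (cos theta0) (sin theta0) (cos theta) (sin theta) => a b c d ab.
  transitivity ((a ^+ 2 + b ^+ 2) * (w.1 * - d + w.2 * c)); first by rewrite ab mul1r.
  by ring.
move: dq; rewrite dot_frame; have := cos2Dsin2 (theta - theta0).
move: (cos _) (sin _) (X _) (Y _) => a b x y ab h.
transitivity ((a ^+ 2 + b ^+ 2) * x - b * (a * y + b * x)); first by ring.
by rewrite h ab; ring.
Qed.

(** The abscissas of the two ends differ by at least half the length of the chord, so one end is at
    least a quarter of it away from [p]. *)
Lemma chord_offset theta lambda : `|theta - theta0| <= 2^-1 ->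
  forall p, K p -> cap_chord C lambda theta != 0 ->
  exists q, [/\ K q, depth q theta = lambda &
    cap_chord C lambda theta / 4 <= `|X q - X p|].
Proof.
move=> t1 p Kp k0; have [z Kz zt] := chord_pos_line k0.
have t0 : `|theta - theta0| <= 1 by lra.
have c2 := cos_ge_half t0.
have [p' [q' [Kp' Kq' pt qt [kE _]]]] := chord_attained cK (ex_intro2 _ _ z Kz zt).
have dq : dot (q' - p') (uvec theta) = 0 by rewrite dotBl pt qt subrr.
have E : cos (theta - theta0) * dot (q' - p') (perp (uvec theta)) = X q' - X p'.
  by rewrite perp_frame// /X dotBl.
have v0 := chord_ge0 (uvec theta) (supp K (uvec theta) + lambda) cK.
rewrite -kE in v0; rewrite /cap_chord -kE; move: v0 E; set V := dot _ _ => v0 E.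
have VE : V / 2 <= X q' - X p'.
  by rewrite -E mulrC ler_wpM2r.
have dep z' : dot z' (uvec theta) = supp K (uvec theta) + lambda -> depth z' theta = lambda.
  by rewrite /depth => ->; rewrite addrC addKr.
have [h|h] := leP (V / 4) `|X q' - X p|.
  by exists q'; split => //; exact: dep.
exists p'; split => //; first exact: dep.
by move: h; rewrite ltr_norml => /andP[h1 h2]; rewrite ler0_norm ?opprB; lra.
Qed.

Let lip_measurable (f : R -> R) k : (forall s t, `|f s - f t| <= k * `|s - t|) ->
  measurable_fun setT f.
Proof. by move=> h; apply: continuous_measurable_fun; exact: lipschitz_fun_continuous h. Qed.

Notation plane := (measurableTypeR R * measurableTypeR R)%type.

Lemma measurable_gap t : measurable_fun setT (fun z : plane => gap (gamma z.1) (z.2 + t)).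
Proof.
have [_ [D KD] _] := cK.
have m2 : measurable_fun setT (fun z : plane => z.2 + t : R).
  by apply: measurable_realfun.measurable_funD.
have g1 : measurable_fun setT (fun s => (gamma s).1).
  apply: (lip_measurable (k := 1)) => s u; rewrite mul1r.
  exact: le_trans (abs_fst_enorm (gamma s - gamma u)) (arc_length_lipschitz s u aC).
have g2 : measurable_fun setT (fun s => (gamma s).2).
  apply: (lip_measurable (k := 1)) => s u; rewrite mul1r.
  exact: le_trans (abs_snd_enorm (gamma s - gamma u)) (arc_length_lipschitz s u aC).
have mH : measurable_fun setT (fun th => supp K (uvec th)).
  by apply: lip_measurable => s u; exact: supp_uvec_lipschitz KD.
have mw : measurable_fun setT weight by apply: lip_measurable; exact: weight_lipschitz.
have mc : measurable_fun setT (@cos R).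
  by apply: continuous_measurable_fun; exact: continuous_cos.
have ms : measurable_fun setT (@sin R).
  by apply: continuous_measurable_fun; exact: continuous_sin.
apply: measurable_funM; last exact: (measurableT_comp mw m2).
apply: measurable_realfun.measurable_funB; last exact: (measurableT_comp mH m2).
by apply: measurable_realfun.measurable_funD; apply: measurable_funM;
  [exact: (measurableT_comp g1 measurable_fst)|exact: (measurableT_comp mc m2)|
   exact: (measurableT_comp g2 measurable_fst)|exact: (measurableT_comp ms m2)].
Qed.

(** The cut-off is at [2 * lambda] because the weight, at most 2, turns a depth of [lambda] into a
    gap of at most [2 * lambda]. *)
Definition near_variation (lambda eps : R) (z : R * R) : R :=
  (gap (gamma z.1) z.2 <= 2 * lambda)%R%:R *
  (`|gap (gamma z.1) (z.2 + eps) - gap (gamma z.1) z.2| +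
   `|gap (gamma z.1) (z.2 - eps) - gap (gamma z.1) z.2|).

Let mgap0 : measurable_fun setT (fun z : plane => gap (gamma z.1) z.2).
Proof.
have := measurable_gap 0; congr measurable_fun.
by apply/funext => z; rewrite addr0.
Qed.

Lemma bbs2_near_variation lambda eps (a b c d : R) :
  bbs2 (fun z => \1_(`[a, b]%classic) z.1 * (\1_(`[c, d]%classic) z.2 *
                 near_variation lambda eps z)).
Proof.
have [M [M1 _ gM]] := gap_regular.
apply: (bbs2_tensor (K := 2 * M) (bbs_segment a b) (bbs_segment c d)).
  apply: measurable_funM; first exact: measurable_le_real.
  apply: measurable_realfun.measurable_funD; apply: measurableT_comp => //;
    apply: measurable_realfun.measurable_funB => //; exact: measurable_gap.
move=> z; rewrite /near_variation normrM.
have gg t : `|gap (gamma z.1) t - gap (gamma z.1) z.2| <= M.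
  have /andP[h1 h2] := gM (gamma z.1) t (gamma_closure _).
  have /andP[h3 h4] := gM (gamma z.1) z.2 (gamma_closure _).
  by rewrite ler_norml; apply/andP; split; lra.
rewrite -[leRHS]mul1r; apply: ler_pM => //; first by rewrite normr_nat lern1 leq_b1.
rewrite ger0_norm ?addr_ge0// mulr_natl mulr2n; exact: lerD.
Qed.

Lemma bbs_near_variation s lambda eps c d :
  bbsR (fun theta => \1_(`[c, d]%classic) theta * near_variation lambda eps (s, theta)).
Proof.
have := bbs2_slice1 s (bbs2_near_variation lambda eps s s c d); congr bbs.
by apply/funext => x; rewrite /= segE lexx mul1r.
Qed.

(** Let [V] be the chord. Boundary points of small gap whose abscissa is at least [V / 8] away from
    that of the touched point have measure at least [V / 8], and [gap_shift_ge] makes the integrand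
    at least [eps / 2 * (V / 8)] there; 128 is [2 * 8 * 8]. *)
Lemma cap_chord_sq_le theta lambda eps c d : `|theta - theta0| <= 2^-1 ->
  0 <= eps -> eps <= 2^-1 -> 0 <= lambda -> c <= theta -> theta <= d ->
  eps * cap_chord C lambda theta ^+ 2 <=
  128 * \int[mu]_s (\1_(`[0, L]%classic) s * (\1_(`[c, d]%classic) theta *
                 near_variation lambda eps (s, theta))).
Proof.
move=> t1 e0 e1 l0 ct td.
have bF := bbs2_slice2 theta (bbs2_near_variation lambda eps 0 L c d); rewrite /= in bF.
have F0 s : 0 <= near_variation lambda eps (s, theta) by rewrite mulr_ge0// addr_ge0.
have [L0 _ _ _ _] := aC.
have [k0|k0] := eqVneq (cap_chord C lambda theta) 0.
  rewrite k0 expr0n mulr0 mulr_ge0// Rintegral_ge0// => s _.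
  by rewrite !mulr_ge0// ?indicE.
have [p Kp pt] := supp_attained (uvec theta) cK K0.
have dp : depth p theta = 0 by rewrite /depth pt subrr.
have [q [Kq dq hq]] := chord_offset t1 Kp k0.
set V := cap_chord C lambda theta in k0 hq *.
have V0 : 0 <= V := chord_ge0 _ _ cK.
have t0 : `|theta - theta0| <= 1 by lra.
have c2 := cos_ge_half t0.
pose A := [set s | [/\ 0 <= s <= L, gap (gamma s) theta <= 2 * lambda &
                       V / 8 <= `|X (gamma s) - X p|]].
have cX : continuous (X \o gamma).
  apply: (@lipschitz_fun_continuous _ _ 1) => s t; rewrite mul1r.
  by rewrite -dotBl; exact: le_trans (frame_X_enorm ue _) (arc_length_lipschitz s t aC).
have mA : measurable A.
  have -> : A = `[0, L]%classic `&` ((fun s => gap (gamma s) theta) @^-1` `]-oo, 2 * lambda]) `&`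
      ((fun s => `|X (gamma s) - X p|) @^-1` `[V / 8, +oo[).
    apply/seteqP; split => s /=; rewrite !in_itv/= ?andbT; first by case.
    by move=> [[]].
  apply: measurableI; first apply: measurableI => //.
    rewrite -[X in measurable X]setTI.
    have mg : measurable_fun setT (fun s => gap (gamma s) theta).
      exact: (measurableT_comp mgap0 (measurable_pair2 theta)).
    by apply: mg => //; exact: measurable_itv.
  rewrite -[X in measurable X]setTI.
  have mg : measurable_fun setT (fun s => `|X (gamma s) - X p|).
    apply: measurableT_comp => //; apply: measurable_realfun.measurable_funB => //.
    exact: continuous_measurable_fun.
  by apply: mg => //; exact: measurable_itv.
have bA : bbsR (\1_A).
  by apply: (bbs_indic (M := L)) => // s [/andP[s0 sL] _ _]; rewrite /norm1 ger0_norm.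
(* The segment from [p] to [q] stays at depth at most [lambda], and descending from it to the
   boundary does not increase the depth. *)
have onseg t : 0 <= t -> t <= 1 -> V / 8 <= t * `|X q - X p| ->
    exists2 s, A s & X (gamma s) = X p + t * (X q - X p).
  move=> tt0 tt1 tV; have [_ _ cvx] := cK.
  have Kw := cvx p q t Kp Kq tt0 tt1.
  set w := (_, _) in Kw.
  have Xw : X w = X p + t * (X q - X p) by rewrite /w /X /dot /=; ring.
  have dw : dot w (uvec theta) = supp K (uvec theta) + t * lambda.
    have -> : dot w (uvec theta) = dot p (uvec theta) + t * (dot q (uvec theta) - dot p (uvec theta)).
      by rewrite /w /dot /=; ring.
    by rewrite pt -dq /depth.
  have [z [bz Xz Yz]] := lowest_point Kw.
  have [s [s0 sL sz]] := bdry_gamma aC bz (lexx 0) L0; rewrite add0r in sL.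
  have Xs : X (gamma s) = X p + t * (X q - X p) by rewrite sz Xz Xw.
  exists s => //; split.
  - by rewrite s0 ltW.
  - have dz : depth z theta <= lambda.
      rewrite /depth dot_frame; move: dw; rewrite dot_frame -Xz => dw.
      have : cos (theta - theta0) * Y z <= cos (theta - theta0) * Y w.
        by rewrite ler_wpM2l//; lra.
      have : t * lambda <= 1 * lambda by rewrite ler_wpM2r.
      by move: dw; lra.
    have /andP[w1 w2] := weight_bounds theta; have [Kz _] := bz.
    by rewrite /gap sz mulrC ler_pM// ?depth_ge0//; lra.
  - by rewrite Xs addrAC subrr add0r normrM ger0_norm.
have x0 : 0 < `|X q - X p|.
  by apply: lt_le_trans hq; rewrite divr_gt0// lt_neqAle eq_sym k0.
have muA : ((V / 8)%:E <= mu A)%E.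
  have Xlip s t : `|(X \o gamma) s - (X \o gamma) t| <= `|s - t|.
    by rewrite /= -dotBl; exact: le_trans (frame_X_enorm ue _) (arc_length_lipschitz s t aC).
  have hx x : V / 8 <= x -> x <= V / 4 -> exists2 s, A s &
      X (gamma s) = X p + x / `|X q - X p| * (X q - X p).
    move=> hx1 hx2; have xp : 0 <= x by apply: le_trans hx1; rewrite divr_ge0.
    apply: onseg; first by rewrite divr_ge0.
      by rewrite ler_pdivrMr// mul1r (le_trans hx2).
    by rewrite divfK// gt_eqF.
  have [xpos|xneg] := leP 0 (X q - X p).
    have -> : V / 8 = (X p + V / 4) - (X p + V / 8) by lra.
    apply: (lipschitz_image_measure _ Xlip); first by lra.
    move=> x h1 h2; have [||s As sE] := hx (x - X p); [by rewrite lerBrDl|by rewrite lerBlDl|].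
    exists s => //=; rewrite sE ger0_norm// divfK; first by ring.
    by rewrite -(ger0_norm xpos) gt_eqF.
  have -> : V / 8 = (X p - V / 8) - (X p - V / 4) by lra.
  apply: (lipschitz_image_measure _ Xlip); first by lra.
  move=> x h1 h2; have [||s As sE] := hx (X p - x); [by rewrite lerBrDr -lerBrDl|by rewrite lerBlDr -lerBlDl|].
  exists s => //=; rewrite sE ltr0_norm// invrN mulrN mulNr divfK; first by ring.
  by rewrite lt_eqF.
have key s : eps / 2 * (V / 8) * \1_A s <=
   \1_(`[0, L]%classic) s * (\1_(`[c, d]%classic) theta * near_variation lambda eps (s, theta)).
  rewrite [\1_A s]indicE; case: (boolP (s \in A)) => [/set_mem [s0 gs xs]|_]; last first.
    by rewrite mulr0 !mulr_ge0// indicE.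
  rewrite mulr1 !segE s0 ct td !mul1r /near_variation /= gs mul1r.
  apply: le_trans (gap_shift_ge (gamma_closure s) Kp dp t1 e0 e1).
  by rewrite ler_wpM2l//; lra.
have := le_Rint norm1_fin (bbsZ _ bA) bF key.
rewrite (RintZ norm1_fin _ bA) Rint_indic// => H.
have hA : V / 8 <= fine (mu A).
  have fA : mu A \is a fin_num.
    rewrite ge0_fin_numE//; apply: (@le_lt_trans _ _ (mu (`[0, L]%classic : set R))).
      by apply: le_measure; rewrite ?inE// => s [] /=; rewrite in_itv.
    by rewrite lebesgue_measure_itv/=; case: ifP => _; rewrite -?EFinB ltry.
  by rewrite -lee_fin fineK.
have : eps / 2 * (V / 8) * (V / 8) <= eps / 2 * (V / 8) * fine (mu A).
  by rewrite ler_wpM2l// mulr_ge0// divr_ge0.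
by move: H; rewrite expr2; lra.
Qed.

Let gap_continuous z : K z -> continuous (gap z).
Proof.
by move=> Kz; have [M [_ gL _]] := gap_regular; apply: lipschitz_fun_continuous => s t; exact: gL.
Qed.

Definition near_set (c d lambda : R) := [set s | 0 <= s <= L /\
  exists2 theta, c <= theta <= d & depth (gamma s) theta <= lambda].

Let depth_lipschitz s t theta : `|depth (gamma s) theta - depth (gamma t) theta| <= `|s - t|.
Proof.
rewrite /depth opprB addrA subrK -dotBl.
exact: le_trans (frame_Y_enorm (unit_uvec theta) _) (arc_length_lipschitz s t aC).
Qed.

Let depth_continuous z : continuous (depth z).
Proof.
have [_ [D KD] _] := cK.
move=> t; apply: cvgB.
  apply: cvgD; apply: cvgM; try exact: cvg_cst.
    exact: continuous_cos.
  exact: continuous_sin.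
have cH : continuous (fun th => supp K (uvec th)).
  by apply: lipschitz_fun_continuous => u v; exact: supp_uvec_lipschitz KD.
exact: cH.
Qed.

(** Membership bounds the minimum of the depth over [[c, d]], a 1-Lipschitz function of [s]. *)
Lemma measurable_near_set c d lambda : c <= d -> measurable (near_set c d lambda).
Proof.
move=> cd.
have ex s : exists2 m, m \in `[c, d] & forall t, t \in `[c, d] ->
    depth (gamma s) m <= depth (gamma s) t.
  apply: EVT_min => //; apply: continuous_subspaceT; exact: depth_continuous.
pose m s := sval (cid2 (ex s)).
have mI s : m s \in `[c, d] by rewrite /m; case: cid2.
have mm s t : t \in `[c, d] -> depth (gamma s) (m s) <= depth (gamma s) t.
  by rewrite /m; case: cid2 => x /= _; exact.
pose f s := depth (gamma s) (m s).
have fL s t : `|f s - f t| <= 1 * `|s - t|.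
  rewrite mul1r; wlog st : s t / f t <= f s.
    move=> H; have [|h] := leP (f t) (f s); first exact: H.
    by rewrite distrC [`|s - t|]distrC; apply: H; exact: ltW.
  rewrite ger0_norm ?subr_ge0//; apply: le_trans (depth_lipschitz s t (m t)).
  by apply: le_trans (ler_norm _); rewrite lerD2r /f; exact: mm.
have -> : near_set c d lambda = `[0, L]%classic `&` (f @^-1` `]-oo, lambda]).
  apply/seteqP; split => s /=.
    rewrite !in_itv/= => -[s0 [t tI h]]; split => //.
    by apply: le_trans h; apply: mm; rewrite in_itv.
  rewrite !in_itv/= => -[s0 h]; split => //; exists (m s) => //.
  by have := mI s; rewrite in_itv.
apply: measurableI => //; rewrite -[X in measurable X]setTI.
have mf : measurable_fun setT f := lip_measurable fL.
by apply: mf => //; exact: measurable_itv.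
Qed.

(** Truncating the gap at [3 * lambda] preserves quasi-convexity and is invisible where the gap is
    at most [2 * lambda], as a step changes it by at most [lambda]. Each of the two steps costs
    [3 * eps * (3 * lambda)] by [quasi_convex_shift]. *)
Lemma near_variation_le s c d lambda eps M : 0 <= eps -> eps <= 2^-1 -> 0 <= lambda ->
  M * eps <= lambda -> (forall z s t, K z -> `|gap z s - gap z t| <= M * `|s - t|) ->
  c <= d -> `|c - theta0| <= 2^-1 -> `|d - theta0| <= 2^-1 ->
  \int[mu]_theta (\1_(`[c, d]%classic) theta * near_variation lambda eps (s, theta)) <=
  18 * eps * lambda.
Proof.
move=> e0 e1 l0 Me gL cd cw dw.
have Kg := gamma_closure s.
pose G t := Num.min (gap (gamma s) t) (3 * lambda).
have cG : continuous G.
  move=> t; apply: (@continuous_min R _ (gap (gamma s)) (fun=> 3 * lambda)).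
    exact: gap_continuous.
  exact: cvg_cst.
have G0 t : 0 <= G t <= 3 * lambda.
  have [M' [_ _ gM]] := gap_regular; have /andP[g0 _] := gM _ t Kg.
  by rewrite ge_min lexx orbT le_min g0 mulr_ge0.
have win t : c - eps <= t -> t <= d + eps -> `|t - theta0| <= 1.
  exact: norm_half_between.
have qG x y z : c - eps <= x -> x <= y -> y <= z -> z <= d + eps ->
    G y <= Num.max (G x) (G z).
  move=> cx xy yz zd.
  have := gap_quasi_convex Kg (win x cx ltac:(lra)) (win z ltac:(lra) zd) xy yz.
  have mon a b : a <= b -> Num.min a (3 * lambda) <= Num.min b (3 * lambda).
    by move=> ab; rewrite le_min !ge_min ab lexx orbT.
  by rewrite !le_max => /orP[/mon h|/mon h]; apply/orP; [left|right].
have h1 := @quasi_convex_shift R G c d (3 * lambda) eps cd e0 cG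
  (fun x _ _ => G0 x) (fun x y z a b c' d' => qG x y z ltac:(lra) b c' d').
pose G' t := G (- t).
have cG' : continuous G'.
  apply: (@lipschitz_fun_continuous _ _ M) => u v; rewrite /G'.
  apply: le_trans (min_lipschitz _ _ _) _; apply: le_trans (gL _ _ _ Kg) _.
  by rewrite -opprD normrN.
have qG' x y z : - d <= x -> x <= y -> y <= z -> z <= - c + eps ->
    G' y <= Num.max (G' x) (G' z).
  move=> dx xy yz zc; rewrite /G' maxC; apply: qG; rewrite ?lerN2//.
    by rewrite lerNr opprB addrC.
  by rewrite (@le_trans _ _ d) ?lerDl// lerNl.
have h2 := @quasi_convex_shift R G' (- d) (- c) (3 * lambda) eps ltac:(lra) e0 cG'
  (fun x _ _ => G0 (- x)) qG'.
have mG : measurable_fun setT G by exact: continuous_measurable_fun.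
have bG t : bbsR (fun x => \1_(`[c, d]%classic) x * `|G (x + t) - G x|).
  apply: (bbs_dominated (K := 3 * lambda) (bbs_segment c d)).
    apply: measurable_funM; first by have [] := bbs_segment c d.
    apply: measurableT_comp => //; apply: measurable_realfun.measurable_funB => //.
    by apply: (measurableT_comp mG); exact: measurable_realfun.measurable_funD.
  move=> x; rewrite normrM mulrC ler_wpM2r// normr_id.
  exact: norm_sub_le.
have h3 : \int[mu]_x (\1_(`[c, d]%classic) x * `|G (x + - eps) - G x|) <= 3 * eps * (3 * lambda).
  apply: le_trans h2; have n1 : (-1 : R) != 0 by rewrite oppr_eq0 oner_eq0.
  rewrite (Rint_affine 0 n1 (bG (- eps))) normrN1 mul1r le_eqVlt; apply/orP; left; apply/eqP; apply: eq_Rintegral => x _.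
  rewrite /G' !segE mulN1r addr0 opprD; congr (_ * _); congr (nat_of_bool _)%:R.
  by rewrite andbC lerNr lerNl.
have bF' := bbs_near_variation s lambda eps c d.
have -> : 18 * eps * lambda = 3 * eps * (3 * lambda) + 3 * eps * (3 * lambda) by ring.
apply: le_trans (lerD h1 h3); rewrite -(RintD norm1_fin (bG eps) (bG (- eps))).
apply: (le_Rint norm1_fin bF' (bbsD (bG eps) (bG (- eps)))) => x.
rewrite -mulrDr ler_wpM2l//.
rewrite /near_variation /=; case: (leP (gap (gamma s) x) (2 * lambda)) => hg; last first.
  by rewrite mul0r addr_ge0.
rewrite mul1r /G (min_l (_ : gap (gamma s) x <= 3 * lambda)); last by lra.
have gle t : `|t| <= eps -> gap (gamma s) (x + t) <= 3 * lambda.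
  move=> te; have := gL _ (x + t) x Kg; rewrite addrAC subrr add0r => h.
  have : M * `|t| <= lambda.
    have [M0|M0] := leP 0 M; first by apply: le_trans Me; rewrite ler_wpM2l.
    by apply: le_trans l0; rewrite nmulr_rle0.
  by have := ler_norm (gap (gamma s) (x + t) - gap (gamma s) x); lra.
by rewrite !(min_l (gle _ _))// ?normrN ger0_norm.
Qed.

Let neg_near s c d lambda eps : c <= d -> 0 <= s <= L -> ~ near_set c d (2 * lambda) s ->
  \int[mu]_theta (\1_(`[c, d]%classic) theta * near_variation lambda eps (s, theta)) = 0.
Proof.
move=> cd sL h; apply: Rint0_eq => x; rewrite segE.
case: (boolP ((c <= x) && (x <= d))) => [cx|_]; last by rewrite mul0r.
rewrite /near_variation /= leNgt; case: ltP; rewrite ?mul0r ?mulr0// => hg.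
exfalso; apply: h; split => //; exists x => //; apply: le_trans hg.
have /andP[w1 _] := weight_bounds x.
by rewrite /gap ler_peMr// depth_ge0//; exact: gamma_closure.
Qed.

(** The majorant [k] carries the measurability in the angle. The step [eps] cancels between the two
    orders of integration, and 2304 is [128 * 18]. *)
Lemma cap_chord_upper c d : c <= d -> `|c - theta0| <= 2^-1 -> `|d - theta0| <= 2^-1 ->
  exists2 lambda0, 0 < lambda0 & forall lambda, 0 < lambda -> lambda <= lambda0 ->
    exists k : R -> R, [/\ bbsR k, forall theta, 0 <= k theta,
      forall theta, c <= theta -> theta <= d -> cap_chord C lambda theta ^+ 2 <= k theta &
      \int[mu]_theta k theta <= 2304 * lambda * fine (mu (near_set c d (2 * lambda)))].
Proof.
move=> cd cw dw; have [M [M1 gL _]] := gap_regular.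
have M0 : 0 < M by lra.
exists (M / 2); first by rewrite divr_gt0.
move=> lambda l0 lM; pose eps := lambda / M.
have e0 : 0 < eps by exact: divr_gt0.
have e1 : eps <= 2^-1 by rewrite ler_pdivrMr//; lra.
have Me : M * eps <= lambda by rewrite mulrC divfK// gt_eqF.
have bF := bbs2_near_variation lambda eps 0 L c d.
have bk := bbs2_fubini2 bF; rewrite /= in bk.
exists (fun theta => 128 / eps * \int[mu]_s (\1_(`[0, L]%classic) s *
  (\1_(`[c, d]%classic) theta * near_variation lambda eps (s, theta)))).
split; first exact: bbsZ bk.
  move=> theta; apply: mulr_ge0; first by rewrite divr_ge0// ltW.
  apply: Rintegral_ge0 => s _.
  have F0 : 0 <= near_variation lambda eps (s, theta).
    by rewrite mulr_ge0// addr_ge0.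
  by rewrite !mulr_ge0// indicE.
  move=> theta ct td; rewrite mulrAC ler_pdivlMr// mulrC.
  apply: cap_chord_sq_le => //; try exact: ltW.
  exact: norm_between cw dw ct td.
rewrite (RintZ norm1_fin _ bk) -(Rint_swap bF).
have bk1 := bbs2_fubini1 bF; rewrite /= in bk1.
have mE := measurable_near_set (2 * lambda) cd.
have bE : bbsR (\1_(near_set c d (2 * lambda))).
  by apply: (bbs_indic (M := L)) => // s [/andP[s0 sL] _]; rewrite /norm1 ger0_norm.
have : \int[mu]_x \int[mu]_y (\1_(`[0, L]%classic) x *
    (\1_(`[c, d]%classic) y * near_variation lambda eps (x, y))) <=
    \int[mu]_s (18 * eps * lambda * \1_(near_set c d (2 * lambda)) s).
  apply: (le_Rint norm1_fin bk1 (bbsZ _ bE)) => s.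
  have bFs := bbs_near_variation s lambda eps c d.
  rewrite (RintZ norm1_fin _ bFs) segE.
  case: (boolP ((0 <= s) && (s <= L))) => sL; last first.
    rewrite /= mul0r; apply: mulr_ge0; last by rewrite indicE.
    by apply: mulr_ge0; [apply: mulr_ge0|]; rewrite ?ltW// ler0n.
  rewrite mul1r indicE; case: (boolP (s \in _)) => [_|/negP hs].
    by rewrite mulr1; apply: near_variation_le gL cd cw dw => //; exact: ltW.
  by rewrite neg_near ?mulr0// => h; apply: hs; exact/mem_set.
rewrite (RintZ norm1_fin _ bE) Rint_indic// => H.
have k0 : 0 <= 128 / eps by rewrite divr_ge0// ltW.
have := ler_wpM2l k0 H; move/le_trans; apply.
rewrite le_eqVlt; apply/orP; left; apply/eqP; move: (fine _) => m.
by field; rewrite gt_eqF.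
Qed.

(** * Squared chords against touched perimeter: lower bound *)

Lemma interior_depth : exists c r, [/\ K c, 0 < r & forall theta, r <= depth c theta].
Proof.
have [c Cc] := exists_interior bC; have [r r0 rC] := interior_push Cc.
exists c, r; split => //; first by apply: subset_closure; exact: interior_subset.
move=> theta; have Kc' : K (c.1 - r * cos theta, c.2 - r * sin theta).
  by apply: subset_closure; apply: interior_subset; exact: rC (unit_uvec theta).
have := depth_ge0 theta Kc'; rewrite /depth.
have -> : dot (c.1 - r * cos theta, c.2 - r * sin theta) (uvec theta) =
    dot c (uvec theta) - r * (cos theta ^+ 2 + sin theta ^+ 2).
  by rewrite /dot /=; ring.
by rewrite cos2Dsin2; lra.
Qed.

(** A cap can be wider than the chord that bounds it, but only by a multiple of [lambda]: each point
    is moved towards an interior point [c] until its depth is exactly [lambda], which takes a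
    fraction of at most [4 / r * lambda] of the way. *)
Lemma cone_offset : exists M lambda1, [/\ 0 <= M, 0 < lambda1 &
  forall theta lambda z p, `|theta - theta0| <= 1 -> 0 <= lambda -> lambda <= lambda1 ->
    K z -> K p -> depth z theta <= lambda -> depth p theta <= lambda ->
    `|X z - X p| <= cap_chord C lambda theta + M * lambda].
Proof.
have [c [r' [Kc r'0 dc']]] := interior_depth.
pose r := 2 * r'; have r0 : 0 < r by rewrite mulr_gt0.
have dc theta : r / 2 <= depth c theta by have := dc' theta; rewrite /r; lra.
have [_ [D KD] cvx] := cK.
have D0 : 0 <= D by have [z Kz] := K0; have [+ _] := KD _ Kz; exact: le_trans.
have Xb z : K z -> `|X z| <= 2 * D.
  by move=> /KD[z1 z2]; apply: dot_unit_bound => //; exact: unit_perp.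
exists (32 * D / r), (r / 4); split; first by rewrite divr_ge0 ?mulr_ge0// ltW.
  by rewrite divr_gt0.
move=> theta lambda z p t0 l0 l1 Kz Kp dz dp.
have push w : K w -> depth w theta <= lambda -> exists w', [/\ K w',
    depth w' theta = lambda & `|X w' - X w| <= 16 * D / r * lambda].
  move=> Kw dw; have d0 := depth_ge0 theta Kw; have dct := dc theta.
  have s0 : 0 < depth c theta - depth w theta by lra.
  pose t := (lambda - depth w theta) / (depth c theta - depth w theta).
  have tt0 : 0 <= t by rewrite divr_ge0//; lra.
  have tt1 : t <= 1 by rewrite ler_pdivrMr//; lra.
  have tE : t * (depth c theta - depth w theta) = lambda - depth w theta.
    by rewrite divfK// gt_eqF.
  have tr : t <= 4 / r * lambda.
    rewrite ler_pdivrMr//.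
    have : 4 / r * lambda * (r / 4) <= 4 / r * lambda * (depth c theta - depth w theta).
      have k0 : 0 <= 4 / r * lambda by rewrite mulr_ge0// divr_ge0// ltW.
      by apply: (ler_wpM2l k0); lra.
    have -> : 4 / r * lambda * (r / 4) = lambda by field; rewrite gt_eqF.
    by lra.
  have lin (u : R * R) : dot ((1 - t) * w.1 + t * c.1, (1 - t) * w.2 + t * c.2) u =
      dot w u + t * (dot c u - dot w u) by rewrite /dot /=; ring.
  exists ((1 - t) * w.1 + t * c.1, (1 - t) * w.2 + t * c.2); split; first exact: cvx.
    by move: tE; rewrite /depth lin; lra.
  rewrite /X lin addrAC subrr add0r normrM (ger0_norm tt0) -/(X c) -/(X w).
  have -> : 16 * D / r * lambda = (4 / r * lambda) * (4 * D) by field; rewrite gt_eqF.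
  apply: ler_pM => //; rewrite (le_trans (ler_normB _ _))//.
  by have := Xb _ Kc; have := Xb _ Kw; lra.
have [z' [Kz' dz' Xz]] := push _ Kz dz; have [p' [Kp' dp' Xp]] := push _ Kp dp.
have on w : depth w theta = lambda -> dot w (uvec theta) = supp K (uvec theta) + lambda.
  by rewrite /depth; lra.
have key : `|X z' - X p'| <= cap_chord C lambda theta.
  have d0 : dot (z' - p') (uvec theta) = 0 by rewrite dotBl (on _ dz') (on _ dp') subrr.
  have -> : X z' - X p' = X (z' - p') by rewrite /X dotBl.
  rewrite -(perp_frame d0).
  have c1 := cos_ge_half t0.
  apply: (@le_trans _ _ `|dot (z' - p') (perp (uvec theta))|).
    by rewrite normrM ler_piMl// ler_norml cos_geN1 cos_le1.
  have h1 := chord_ge cK Kp' Kz' (on _ dp') (on _ dz').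
  have h2 := chord_ge cK Kz' Kp' (on _ dz') (on _ dp').
  rewrite ler_norml h1 andbT; move: h2; rewrite !dotBl /cap_chord; lra.
have -> : 32 * D / r * lambda = 2 * (16 * D / r * lambda) by ring.
exact: norm_sub_perturb Xz Xp key.
Qed.

(** Decreases are counted because [gap_shift_le] controls them by the abscissa relative to the point
    touched at the same angle; an increase would involve the point touched after the step. *)
Definition fall (lambda eps : R) (z : R * R) : R :=
  (gap (gamma z.1) z.2 <= lambda)%R%:R *
  (Num.max 0 (gap (gamma z.1) z.2 - gap (gamma z.1) (z.2 + eps)) +
   Num.max 0 (gap (gamma z.1) z.2 - gap (gamma z.1) (z.2 - eps))).

Let fall_ge0 lambda eps z : 0 <= fall lambda eps z.
Proof. by rewrite mulr_ge0// addr_ge0// le_max lexx. Qed.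

Definition touch_set (c d : R) := [set s | 0 <= s < L /\
  exists2 theta, c <= theta <= d & depth (gamma s) theta = 0].

Lemma touch_setE c d : touch_set c d = near_set c d 0 `&` `]-oo, L[%classic.
Proof.
apply/seteqP; split => s /=.
  move=> [/andP[s0 sL] [t tI dt]]; rewrite in_itv/=; split => //; split; first by rewrite s0 ltW.
  by exists t => //; rewrite dt.
rewrite in_itv/= => -[[/andP[s0 _] [t tI dt]] sL]; split; first by rewrite s0.
exists t => //; apply/eqP; rewrite eq_le dt depth_ge0//; exact: gamma_closure.
Qed.

Lemma measurable_touch_set c d : c <= d -> measurable (touch_set c d).
Proof.
move=> cd; rewrite touch_setE; apply: measurableI => //; exact: measurable_near_set.
Qed.

Let bbs_touch c d : c <= d -> bbsR (\1_(touch_set c d)).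
Proof.
move=> cd; apply: (bbs_indic (M := L)); first exact: measurable_touch_set.
by move=> s [/andP[s0 sL] _]; rewrite /norm1 ger0_norm// ltW.
Qed.

Lemma bbs2_fall lambda eps (f : R -> R) (c d : R) : bbsR f ->
  bbs2 (fun z => f z.1 * (\1_(`[c, d]%classic) z.2 * fall lambda eps z)).
Proof.
move=> bf; have [M [M1 _ gM]] := gap_regular.
apply: (bbs2_tensor (K := 2 * M) bf (bbs_segment c d)).
  apply: measurable_funM; first exact: measurable_le_real.
  by apply: measurable_realfun.measurable_funD; apply: measurable_maxr => //;
    apply: measurable_realfun.measurable_funB => //; exact: measurable_gap.
move=> z; rewrite /fall normrM.
have gg t : 0 <= Num.max 0 (gap (gamma z.1) z.2 - gap (gamma z.1) t) <= M.
  have /andP[h1 h2] := gM (gamma z.1) t (gamma_closure _).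
  have /andP[h3 h4] := gM (gamma z.1) z.2 (gamma_closure _).
  by rewrite le_max lexx /= ge_max; apply/andP; split; lra.
rewrite -[leRHS]mul1r; apply: ler_pM => //; first by rewrite normr_nat lern1 leq_b1.
have /andP[a1 a2] := gg (z.2 + eps); have /andP[b1 b2] := gg (z.2 - eps).
by rewrite ger0_norm ?addr_ge0// mulr_natl mulr2n; exact: lerD.
Qed.

Lemma bbs_fall s lambda eps c d :
  bbsR (fun theta => \1_(`[c, d]%classic) theta * fall lambda eps (s, theta)).
Proof.
have := bbs2_slice1 s (bbs2_fall lambda eps c d (bbs_segment s s)); congr bbs.
by apply/funext => x; rewrite /= segE lexx mul1r.
Qed.

(** The slope is [tan (t - theta0)], at most 1 because on the window the sine is at most 1/2 and the
    cosine at least 1/2. *)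
Let touch_touch s c d : `|c - theta0| <= 2^-1 -> `|d - theta0| <= 2^-1 ->
  touch_set c d s -> touch C e (gamma s).
Proof.
move=> cw dw [_ [t /andP[ct td] dt]].
have tw : `|t - theta0| <= 2^-1 := norm_between cw dw ct td.
have c0 : 2^-1 <= cos (t - theta0) by apply: cos_ge_half; lra.
have cp : 0 < cos (t - theta0) by lra.
exists (sin (t - theta0) / cos (t - theta0)).
  rewrite normrM normfV (gtr0_norm cp) ler_pdivrMr// mul1r.
  by have := sin_lipschitz (t - theta0) 0; rewrite sin0 !subr0; lra.
have E w : dot w e + sin (t - theta0) / cos (t - theta0) * dot w (perp e) =
    dot w (uvec t) / cos (t - theta0).
  rewrite (dot_frame w t) -/(X w) -/(Y w); move: cp; move: (cos _) (sin _) (X w) (Y w) => a b x y a0.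
  by field; rewrite gt_eqF.
move=> w Kw; rewrite !E ler_pM2r ?invr_gt0//; have := supp_le (uvec t) cK Kw.
by move: dt; rewrite /depth; lra.
Qed.

(** By [arc_dist] the touched points with small gap at [theta] lie in a cyclic interval of radius
    [2 * Rr] around one of them. Its three copies have total length [12 * Rr], and the integrand is
    at most [8 * eps * Rr]. *)
Let fall_bound c d theta lambda eps (Rr : R) : `|c - theta0| <= 2^-1 -> `|d - theta0| <= 2^-1 ->
  c <= theta -> theta <= d -> 0 <= eps -> eps <= 2^-1 -> 0 <= lambda -> 0 <= Rr ->
  (forall z p, K z -> K p -> depth z theta <= lambda -> depth p theta <= lambda ->
    `|X z - X p| <= Rr) ->
  \int[mu]_s (\1_(touch_set c d) s * (\1_(`[c, d]%classic) theta * fall lambda eps (s, theta)))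
  <= 96 * eps * Rr ^+ 2.
Proof.
move=> cw dw ct td e0 e1 l0 R0 hR; have [L0 _ _ _ _] := aC.
have cd : c <= d := le_trans ct td.
have tw : `|theta - theta0| <= 2^-1 := norm_between cw dw ct td.
have dg s : depth (gamma s) theta <= gap (gamma s) theta.
  have /andP[w1 _] := weight_bounds theta.
  by rewrite /gap ler_peMr// depth_ge0//; exact: gamma_closure.
have [p Kp pt] := supp_attained (uvec theta) cK K0.
have dp : depth p theta = 0 by rewrite /depth pt subrr.
have fb s : gap (gamma s) theta <= lambda -> fall lambda eps (s, theta) <= 8 * eps * Rr.
  move=> gl; rewrite /fall /= gl mul1r.
  have Ks := gamma_closure s.
  have xR : `|X (gamma s) - X p| <= Rr.
    by apply: hR => //; [exact: le_trans (dg s) gl|rewrite dp].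
  have ee : `|eps| <= 2^-1 by rewrite ger0_norm.
  have ee' : `|- eps| <= 2^-1 by rewrite normrN.
  have h1 := gap_shift_le Ks Kp dp tw ee.
  have h2 := gap_shift_le Ks Kp dp tw ee'; rewrite normrN in h2.
  rewrite (ger0_norm e0) in h1 h2.
  have h3 : 4 * eps * `|X (gamma s) - X p| <= 4 * eps * Rr by rewrite ler_wpM2l// mulr_ge0.
  have h4 : 0 <= 4 * eps * Rr by rewrite !mulr_ge0.
  have -> : 8 * eps * Rr = 4 * eps * Rr + 4 * eps * Rr by ring.
  by apply: lerD; rewrite ge_max h4 /=; apply: le_trans h3.
have bF := bbs2_slice2 theta (bbs2_fall lambda eps c d (bbs_touch cd)); rewrite /= in bF.
have [[s1 [T1 g1]]|none] := pselect (exists s, touch_set c d s /\ gap (gamma s) theta <= lambda);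
    last first.
  rewrite Rint0_eq ?mulr_ge0 ?sqr_ge0//.
  move=> s; rewrite [\1_(touch_set c d) s]indicE; case: (boolP (s \in _)) => [/set_mem sT|_].
    rewrite /fall /=; case: leP => gl; last by rewrite mul0r !mulr0.
    by exfalso; apply: none; exists s.
  by rewrite mul0r.
have bs x := bbs_segment (x - 2 * Rr) (x + 2 * Rr).
have b3 := bbsD (bbsD (bs s1) (bs (s1 + L))) (bs (s1 - L)).
apply: (@le_trans _ _ (\int[mu]_s (8 * eps * Rr *
  (\1_(`[s1 - 2 * Rr, s1 + 2 * Rr]%classic) s + \1_(`[s1 + L - 2 * Rr, s1 + L + 2 * Rr]%classic) s +
   \1_(`[s1 - L - 2 * Rr, s1 - L + 2 * Rr]%classic) s)))); last first.
  rewrite (RintZ norm1_fin _ b3) (RintD norm1_fin (bbsD (bs s1) (bs (s1 + L))) (bs (s1 - L))).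
  rewrite (RintD norm1_fin (bs s1) (bs (s1 + L))) !Rint_segment; [|lra|lra|lra].
  by rewrite le_eqVlt; apply/orP; left; apply/eqP; ring.
apply: (le_Rint norm1_fin bF (bbsZ _ b3)) => s.
have i0 (a b x : R) : 0 <= \1_(`[a, b]%classic) x :> R by rewrite indicE.
have r0 : 0 <= 8 * eps * Rr by rewrite !mulr_ge0.
rewrite [\1_(touch_set c d) s]indicE; case: (boolP (s \in _)) => [/set_mem sT|_]; last first.
  by rewrite mul0r mulr_ge0// !addr_ge0.
have one (a b x : R) : a <= x -> x <= b -> \1_(`[a, b]%classic) x = 1 :> R.
  by move=> ax xb; rewrite segE ax xb.
rewrite (one c d theta ct td) !mul1r.
case: (leP (gap (gamma s) theta) lambda) => gl; last first.
  have -> : fall lambda eps (s, theta) = 0 by rewrite /fall /= leNgt gl mul0r.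
  by rewrite mulr_ge0// !addr_ge0.
apply: le_trans (fb s gl) _; rewrite -[leLHS]mulr1 ler_wpM2l//.
have xx : `|X (gamma s) - X (gamma s1)| <= Rr.
  apply: hR; [exact: gamma_closure|exact: gamma_closure| |].
    exact: le_trans (dg s) gl.
  exact: le_trans (dg s1) g1.
have ts := touch_touch cw dw sT; have ts1 := touch_touch cw dw T1.
have [/andP[s0 sL] _] := sT; have [/andP[s10 s1L] _] := T1.
apply: cyclic_cover; first by rewrite mulr_ge0.
  have far v : v <= 2 * `|X (gamma s) - X (gamma s1)| -> v <= 2 * Rr.
    by move/le_trans; apply; rewrite ler_wpM2l.
  have [h|h|h] := ltgtP s s1.
  - rewrite ltr0_norm ?subr_lt0// opprB.
    have := arc_dist bC aC ue s0 h s1L ts ts1; rewrite distrC -/(X _) -/(X _).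
    by case=> /far; [left|right].
  - rewrite gtr0_norm ?subr_gt0//.
    have := arc_dist bC aC ue s10 h sL ts1 ts; rewrite -/(X _) -/(X _).
    by case=> /far; [left|right].
  - by left; rewrite h subrr normr0 mulr_ge0.
exact: norm_sub_lt.
Qed.

(** Touched points for which the whole passage of the gap between 0 and [lambda] takes place inside
    the window. [tall_set_limit] shows that the other touched points are negligible in the limit. *)
Definition tall_set c d lambda := [set s | touch_set c d s /\
  (lambda <= gap (gamma s) c \/ lambda <= gap (gamma s) d)].

(** Between the angle of contact and an angle where the gap equals [lambda], quasi-convexity keeps
    the gap at most [lambda], so the cut-off in [fall] is inactive and [rise_lower_bound] applies.
    The passage on the left of the contact is reflected. *)
Let fall_mass s c d lambda eps M : c <= d -> `|c - theta0| <= 2^-1 -> `|d - theta0| <= 2^-1 ->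
  0 < eps -> eps <= 2^-1 -> 0 < lambda -> M * eps * 4 <= lambda -> 1 <= M ->
  (forall z s t, K z -> `|gap z s - gap z t| <= M * `|s - t|) ->
  (forall z t, K z -> 0 <= gap z t <= M) ->
  tall_set c d lambda s ->
  eps * lambda / 2 <= \int[mu]_theta (\1_(`[c, d]%classic) theta * fall lambda eps (s, theta)).
Proof.
move=> cd cw dw e0 e1 l0 Me M1 gL gM [[sL [t /andP[ct td] dt]] tall].
have Kg := gamma_closure s.
set g := gap (gamma s).
have gt : g t = 0 by rewrite /g /gap dt mul0r.
have cg : continuous g := gap_continuous Kg.
have mg : measurable_fun setT g by exact: continuous_measurable_fun.
have gn x : `|g x| <= M by have /andP[g0 g1] := gM _ x Kg; rewrite ger0_norm.
have tw : `|t - theta0| <= 1 := norm_half_le1 (norm_between cw dw ct td).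
have gLip x y : `|g x - g y| <= M * `|x - y| := gL _ _ _ Kg.
have bF := bbs_fall s lambda eps c d.
have f0 y : 0 <= \1_(`[c, d]%classic) y * fall lambda eps (s, y).
  by rewrite mulr_ge0 ?fall_ge0// indicE.
have ffall y : c <= y -> y <= d -> g y <= lambda ->
    g y - g (y + eps) <= \1_(`[c, d]%classic) y * fall lambda eps (s, y) /\
    g y - g (y - eps) <= \1_(`[c, d]%classic) y * fall lambda eps (s, y).
  move=> cy yd gy; rewrite segE cy yd /fall /= -/g gy !mul1r; split.
    by rewrite ler_wpDr ?le_max ?lexx// orbT.
  by rewrite ler_wpDl ?le_max ?lexx// orbT.
have M0 : 0 < M := lt_le_trans ltr01 M1.
case: tall => [hc|hd].
  have [b bI gb] : exists2 b, b \in `[c, t] & g b = lambda.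
    apply: IVT => //; first exact: continuous_subspaceT.
    by rewrite gt; apply/andP; split; [rewrite ge_min (ltW l0) orbT|rewrite le_max hc].
  move: bI; rewrite in_itv/= => /andP[cb bt].
  have bw : `|b - theta0| <= 1 := norm_half_le1 (norm_between cw dw cb (le_trans bt td)).
  have n1 : (-1 : R) != 0 by rewrite oppr_eq0 oner_eq0.
  rewrite (Rint_affine 0 n1 bF) normrN1 mul1r.
  apply: (@rise_lower_bound _ (g \o -%R) _ M (- t) (- b)) => //=; rewrite ?opprK ?lerN2//.
  - by move=> x; apply: continuous_comp; [exact: opp_continuous|exact: cg].
  - by move=> x y; rewrite (le_trans (gLip _ _))// -opprD normrN.
  - exact: bbs_affine 0 n1 bF.
  move=> x; rewrite mulN1r addr0 opprB [eps - x]addrC lerNl lerNr => tx xb.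
  have gx : g (- x) <= lambda.
    by have := gap_quasi_convex Kg bw tw xb tx; rewrite -/g gb gt (max_l (ltW l0)).
  by apply: (ffall (- x) _ _ gx).1; [exact: le_trans cb xb|exact: le_trans tx td].
have [b bI gb] : exists2 b, b \in `[t, d] & g b = lambda.
  apply: IVT => //; first exact: continuous_subspaceT.
  by rewrite gt; apply/andP; split; [rewrite ge_min (ltW l0)|rewrite le_max hd orbT].
move: bI; rewrite in_itv/= => /andP[tb bd].
have bw : `|b - theta0| <= 1 := norm_half_le1 (norm_between cw dw (le_trans ct tb) bd).
apply: (@rise_lower_bound _ g _ M t b) => // x tx xb.
have gx : g x <= lambda.
  by have := gap_quasi_convex Kg tw bw tx xb; rewrite -/g gb gt (max_r (ltW l0)).
by apply: (ffall x _ _ gx).2; [exact: le_trans ct tx|exact: le_trans xb bd].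
Qed.

Lemma measurable_tall_set c d lambda : c <= d -> measurable (tall_set c d lambda).
Proof.
move=> cd; have mg t : measurable_fun setT (fun s => gap (gamma s) t).
  exact: (measurableT_comp mgap0 (measurable_pair2 t)).
have mgt t : measurable ((fun s => gap (gamma s) t) @^-1` `[lambda, +oo[).
  by rewrite -[X in measurable X]setTI; apply: mg => //; exact: measurable_itv.
have -> : tall_set c d lambda = touch_set c d `&`
    (((fun s => gap (gamma s) c) @^-1` `[lambda, +oo[) `|`
     ((fun s => gap (gamma s) d) @^-1` `[lambda, +oo[)).
  by apply/seteqP; split => s /=; rewrite !in_itv/= !andbT.
apply: measurableI; first exact: measurable_touch_set.
exact: measurableU.
Qed.

(** The error [M * lambda ^+ 2] stems from [cone_offset]; it is negligible against an integral of
    [k] of order [lambda]. *)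
Lemma cap_chord_lower c d : c <= d -> `|c - theta0| <= 2^-1 -> `|d - theta0| <= 2^-1 ->
  exists M lambda0, [/\ 0 <= M, 0 < lambda0 & forall lambda, 0 < lambda -> lambda <= lambda0 ->
    exists k : R -> R, [/\ bbsR k,
      forall theta, c <= theta -> theta <= d ->
        k theta <= 192 * cap_chord C lambda theta ^+ 2 + M * lambda ^+ 2,
      forall theta, ~~ ((c <= theta) && (theta <= d)) -> k theta = 0 &
      lambda / 2 * fine (mu (tall_set c d lambda)) <= \int[mu]_theta k theta]].
Proof.
move=> cd cw dw; have [M [M1 gL gM]] := gap_regular.
have [M' [lambda1 [M'0 l10 cone]]] := cone_offset.
have M0 : 0 < M by lra.
exists (192 * M' ^+ 2), (Num.min lambda1 M); split.
- by apply: mulr_ge0; [exact: ler0n|exact: sqr_ge0].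
- by rewrite lt_min l10 M0.
move=> lambda l0; rewrite le_min => /andP[ll1 lM].
(* The largest step allowed by [rise_lower_bound]. *)
pose eps := lambda / M / 4.
have e0 : 0 < eps by rewrite !divr_gt0.
have e1 : eps <= 2^-1.
  have : lambda / M <= 1 by rewrite ler_pdivrMr// mul1r.
  by rewrite /eps; lra.
have Me : M * eps * 4 <= lambda.
  by rewrite /eps -mulrA divfK// mulrC divfK// gt_eqF.
have bF := bbs2_fall lambda eps c d (bbs_touch cd).
have bk := bbs2_fubini2 bF; rewrite /= in bk.
exists (fun theta => eps^-1 * \int[mu]_s (\1_(touch_set c d) s *
  (\1_(`[c, d]%classic) theta * fall lambda eps (s, theta)))); split.
- exact: bbsZ bk.
- move=> theta ct td; rewrite mulrC ler_pdivrMr//.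
  have tw : `|theta - theta0| <= 1 := norm_half_le1 (norm_between cw dw ct td).
  have k0 : 0 <= cap_chord C lambda theta := chord_ge0 _ _ cK.
  have R0 : 0 <= cap_chord C lambda theta + M' * lambda.
    by rewrite addr_ge0// mulr_ge0// ltW.
  have := fall_bound cw dw ct td (ltW e0) e1 (ltW l0) R0.
  move=> /(_ (fun z p => cone theta lambda z p tw (ltW l0) ll1)) /le_trans; apply.
  rewrite mulrAC ler_wpM2r ?(ltW e0)//.
  rewrite -subr_ge0.
  move: (cap_chord C lambda theta) => k; rewrite (_ : _ - _ = 96 * (k - M' * lambda) ^+ 2); last by ring.
  by apply: mulr_ge0; [exact: ler0n|exact: sqr_ge0].
- move=> theta h; rewrite Rint0_eq ?mulr0// => s.
  by rewrite segE (negbTE h) mul0r mulr0.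
rewrite (RintZ norm1_fin _ bk) -(Rint_swap bF).
have bk1 := bbs2_fubini1 bF; rewrite /= in bk1.
have mT := measurable_tall_set lambda cd.
have bT : bbsR (\1_(tall_set c d lambda)).
  by apply: (bbs_indic (M := L)) => // s [[/andP[s0 sL] _] _]; rewrite /norm1 ger0_norm// ltW.
rewrite -ler_pdivrMl ?invr_gt0// invrK mulrA.
have -> : eps * (lambda / 2) * fine (mu (tall_set c d lambda)) =
    \int[mu]_s (eps * lambda / 2 * \1_(tall_set c d lambda) s).
  by rewrite (RintZ norm1_fin _ bT) Rint_indic// mulrA.
apply: (le_Rint norm1_fin (bbsZ _ bT) bk1) => s.
have bFs := bbs_fall s lambda eps c d.
rewrite (RintZ norm1_fin _ bFs) indicE; case: (boolP (s \in _)) => [/set_mem sT|_].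
  rewrite mulr1 indicE mem_set ?mul1r; last by case: sT.
  by apply: fall_mass gL gM sT.
rewrite mulr0 mulr_ge0 ?indicE// Rintegral_ge0// => t _.
by rewrite mulr_ge0 ?fall_ge0// indicE.
Qed.

Lemma near_set_compact c d s : c <= d -> 0 <= s <= L ->
  (forall lambda, 0 < lambda -> near_set c d lambda s) -> near_set c d 0 s.
Proof.
move=> cd sL h; split => //.
have [m mI mm] : exists2 m, m \in `[c, d] & forall t, t \in `[c, d] ->
    depth (gamma s) m <= depth (gamma s) t.
  by apply: EVT_min => //; apply: continuous_subspaceT; exact: depth_continuous.
exists m; first by move: mI; rewrite in_itv.
rewrite leNgt; apply/negP => m0.
have [_ [t tI]] := h (depth (gamma s) m / 2) ltac:(by rewrite divr_gt0).
have := mm t; rewrite in_itv/= => /(_ tI); lra.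
Qed.

End window.

(** * Estimates on an interval of directions *)

Section measure_limits.
Context {R : realType}.
Notation mu := (@lebesgue_measure R).

Lemma bounded_fin_num (A : set R) (L : R) : measurable A -> A `<=` `[0, L]%classic ->
  mu A \is a fin_num.
Proof.
move=> mA AL; rewrite ge0_fin_numE//; apply: (@le_lt_trans _ _ (mu (`[0, L]%classic : set R))).
  by apply: le_measure; rewrite ?inE.
by rewrite lebesgue_measure_itv/=; case: ifP => _; rewrite -?EFinB ltry.
Qed.

Lemma fine_measure_le (A B : set R) (L : R) : measurable A -> measurable B ->
  A `<=` B -> B `<=` `[0, L]%classic -> fine (mu A) <= fine (mu B).
Proof.
move=> mA mB AB BL; apply: fine_le; [exact: bounded_fin_num (subset_trans AB BL)|
  exact: bounded_fin_num BL|].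
by apply: le_measure; rewrite ?inE.
Qed.

Lemma fine_measureU (A B : set R) (L : R) : measurable A -> measurable B ->
  A `<=` `[0, L]%classic -> B `<=` `[0, L]%classic ->
  fine (mu (A `|` B)) <= fine (mu A) + fine (mu B).
Proof.
move=> mA mB AL BL.
have fA := bounded_fin_num mA AL; have fB := bounded_fin_num mB BL.
rewrite -fineD//; apply: fine_le.
- by apply: (@bounded_fin_num _ L); [exact: measurableU|rewrite subUset].
- by rewrite fin_numD fA.
- exact: measureU2.
Qed.

(** Continuity of the measure from above along the inverses of integers; monotonicity then covers
    all small [x]. *)
Lemma measure_shrink (A : R -> set R) (N : set R) (L eta : R) :
  (forall x, measurable (A x)) -> (forall x, A x `<=` `[0, L]%classic) ->
  (forall x y, x <= y -> A x `<=` A y) -> measurable N -> N `<=` `[0, L]%classic ->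
  (forall s, (forall x, 0 < x -> A x s) -> N s) -> 0 < eta ->
  exists2 x0, 0 < x0 & forall x, x <= x0 -> fine (mu (A x)) <= fine (mu N) + eta.
Proof.
move=> mA AL mono mN NL cap eta0.
pose F n := A (n.+1%:R^-1).
have mF n : measurable (F n) by exact: mA.
have mI : measurable (\bigcap_n F n) by exact: bigcapT_measurable.
have F0 : (mu (F 0%N) < +oo)%E.
  by rewrite -ge0_fin_numE//; exact: bounded_fin_num (mA _) (AL _).
have dF : nonincreasing_seq F.
  move=> m n mn; apply/subsetPset; apply: mono.
  by rewrite lef_pV2 ?posrE// ler_nat.
have IN : \bigcap_n F n `<=` N.
  move=> s Fs; apply: cap => x x0.
  have xb : x^-1 < (Num.bound x^-1)%:R by apply: archi_boundP; rewrite invr_ge0 ltW.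
  apply: (mono ((Num.bound x^-1).+1%:R^-1)); last exact: Fs.
  rewrite -[leRHS]invrK lef_pV2 ?posrE ?invr_gt0//.
  by rewrite (le_trans (ltW xb))// ler_nat.
have cv := nonincreasing_cvg_mu F0 mF mI dF.
have fI : mu (\bigcap_n F n) \is a fin_num.
  by apply: (@bounded_fin_num _ L) => //; exact: subset_trans NL.
have [n Fn] : exists n, (mu (F n) < (fine (mu N) + eta)%:E)%E.
  have lt : (mu (\bigcap_n F n) < (fine (mu N) + eta)%:E)%E.
    rewrite -(fineK fI) lte_fin (le_lt_trans (fine_measure_le mI mN IN NL))//.
    by rewrite ltrDl.
  have : \forall n \near \oo, ((mu \o F) n < (fine (mu N) + eta)%:E)%E.
    apply: (cv [set y | (y < (fine (mu N) + eta)%:E)%E]).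
    by apply: open_nbhs_nbhs; split => //; exact: open_ereal_lt_ereal.
  by case=> n _ h; exists n; exact: (h n (leqnn n)).
exists (n.+1%:R^-1); first by rewrite invr_gt0.
move=> x xn; have fA := bounded_fin_num (mF n) (AL _).
apply: (le_trans (fine_measure_le (mA x) (mF n) (mono _ _ xn) (AL _))).
by rewrite -lee_fin fineK// ltW.
Qed.

Lemma quarter_bound (x l M eta : R) : x <= M * l * 1 -> l * (4 * M + 1) <= eta -> 0 < l ->
  x <= eta / 4.
Proof. by lra. Qed.

End measure_limits.

(** * From windows to intervals *)

Section windows.
Context {R : realType}.
Notation mu := (@lebesgue_measure R).
Variables (C : set (R * R)) (L : R) (gamma : R -> R * R).
Hypotheses (bC : convex_body C) (aC : arc_length_param C L gamma).
Let K := closure C.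
Let cK : compact_convex K := closure_compact_convex bC.
Notation touch_set := (touch_set C L gamma).
Notation near_set := (near_set C L gamma).

Lemma touch_set_segment c d : touch_set c d `<=` `[0, L]%classic.
Proof. by move=> s [/andP[s0 sL] _]; rewrite /= in_itv/= s0 ltW. Qed.

Lemma near_set_limit c d eta : c <= d -> 0 < eta ->
  exists2 lambda0, 0 < lambda0 & forall lambda, lambda <= lambda0 ->
    fine (mu (near_set c d lambda)) <= fine (mu (touch_set c d)) + eta.
Proof.
move=> cd eta0; have [L0 _ _ _ _] := aC.
have mT := measurable_touch_set bC aC cd.
have TL := @touch_set_segment c d.
(* [near_set] includes the parameter [L] and [touch_set] does not, so the limit may contain this
   additional null point. *)
have sL : [set L] `<=` `[0, L]%classic by move=> s ->; rewrite /= in_itv/= lexx ltW.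
have NL : touch_set c d `|` [set L] `<=` `[0, L]%classic by rewrite subUset.
have mN : measurable (touch_set c d `|` [set L]) by exact: measurableU.
have [|||x0 x00 h] := @measure_shrink R (near_set c d) _ L eta
    (fun x => measurable_near_set bC aC x cd) _ _ mN NL _ eta0.
- by move=> x s [/andP[s0 sL'] _]; rewrite /= in_itv/= s0.
- move=> x y xy s [s0 [t tI dt]]; split => //; exists t => //; exact: le_trans xy.
- move=> s hs; have [sI _] := hs 1 ltr01.
  have := near_set_compact bC cd sI hs.
  have [-> _|sn] := eqVneq s L; first by right.
  move=> ns; left; rewrite (touch_setE bC aC); split => //; rewrite /= in_itv/=.
  by case/andP: sI => _; rewrite lt_neqAle sn.
exists x0 => // x xx0; apply: (le_trans (h x xx0)); rewrite lerD2r.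
apply: (le_trans (fine_measureU mT (measurable_set1 _) TL sL)).
by rewrite lebesgue_measure_set1 /= addr0.
Qed.

(** A touched point that is tall for no [lambda] has gap 0 at both ends of the window. It lies on
    two non-parallel supporting lines, which leaves at most one such point. *)
Lemma tall_set_limit theta0 c d eta : c < d -> `|c - theta0| <= 2^-1 -> `|d - theta0| <= 2^-1 ->
  0 < eta -> exists2 lambda0, 0 < lambda0 & forall lambda, lambda <= lambda0 ->
    fine (mu (touch_set c d)) - eta <= fine (mu (tall_set C L gamma theta0 c d lambda)).
Proof.
move=> cd cw dw eta0; have cd' := ltW cd.
have mT := measurable_touch_set bC aC cd'.
have mW x := measurable_tall_set theta0 bC aC x cd'.
have TL := @touch_set_segment c d.
pose A x := touch_set c d `\` tall_set C L gamma theta0 c d x.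
have AL x : A x `<=` `[0, L]%classic by move=> s [/TL].
have mA x : measurable (A x) by exact: measurableD.
pose N := [set s | touch_set c d s /\ forall x, 0 < x -> A x s].
have Kg u : K (gamma u) by case: (gamma_real_bdry aC u).
have N1 s s' : N s -> N s' -> s = s'.
  have flat u : N u -> depth C (gamma u) c = 0 /\ depth C (gamma u) d = 0.
    move=> [_ h].
    have z t : (forall x, 0 < x -> gap C theta0 (gamma u) t < x) -> depth C (gamma u) t = 0.
      move=> hx; apply/eqP; rewrite eq_le; apply/andP; split; last first.
        by apply: depth_ge0 => //; exact: Kg.
      have g0 : gap C theta0 (gamma u) t <= 0.
        by rewrite leNgt; apply/negP => /[dup] /hx; rewrite ltxx.
      have /andP[w1 _] := weight_bounds theta0 t.
      have d0 : 0 <= depth C (gamma u) t by apply: depth_ge0 => //; exact: Kg.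
      by apply: le_trans g0; rewrite /gap ler_peMr.
    split; apply: z => x x0; have [hT hW] := h x x0.
      by rewrite ltNge; apply/negP => hh; apply: hW; split => //; left.
    by rewrite ltNge; apply/negP => hh; apply: hW; split => //; right.
  move=> Ns Ns'; have [a1 a2] := flat _ Ns; have [b1 b2] := flat _ Ns'.
  have [[/andP[s0 sL] _] _] := Ns; have [[/andP[s0' sL'] _] _] := Ns'.
  have [L0 per inj _ _] := aC; apply: inj; rewrite ?in_itv/= ?s0 ?s0'//.
  have sp : 0 < sin (d - c).
    apply: sin_gt0_pi; have := pi_ge2 R; move: cw dw; rewrite !ler_norml => /andP[? ?] /andP[? ?] ?.
    by apply/andP; split; lra.
  have e1 : dot (gamma s - gamma s') (uvec c) = 0 by rewrite dotBl; move: a1 b1; rewrite /depth; lra.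
  have e2 : dot (gamma s - gamma s') (uvec d) = 0 by rewrite dotBl; move: a2 b2; rewrite /depth; lra.
  apply/eqP; rewrite -subr_eq0; apply/eqP; move: e1 e2; move: (gamma s - gamma s') => z.
  rewrite /dot /= => e1 e2; rewrite [z]surjective_pairing.
  move: sp; rewrite sinB => sp.
  have z1 : z.1 * (sin d * cos c - cos d * sin c) = 0.
    transitivity ((z.1 * cos c + z.2 * sin c) * sin d - (z.1 * cos d + z.2 * sin d) * sin c).
      by ring.
    by rewrite e1 e2 !mul0r subrr.
  have z2 : z.2 * (sin d * cos c - cos d * sin c) = 0.
    transitivity ((z.1 * cos d + z.2 * sin d) * cos c - (z.1 * cos c + z.2 * sin c) * cos d).
      by ring.
    by rewrite e1 e2 !mul0r subrr.
  have sn := lt0r_neq0 sp.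
  move/eqP: z1; rewrite mulf_eq0 (negbTE sn) orbF => /eqP ->.
  by move/eqP: z2; rewrite mulf_eq0 (negbTE sn) orbF => /eqP ->.
have [mN mN0] : measurable N /\ mu N = 0%E.
  have [[s Ns]|none] := pselect (exists s, N s).
    have -> : N = [set s].
      by apply/seteqP; split => [s' Ns'|_ ->] //=; exact: N1.
    by split; [exact: measurable_set1|exact: lebesgue_measure_set1].
  have -> : N = set0 by apply/seteqP; split => // s Ns; apply: none; exists s.
  by split; [exact: measurable0|exact: measure0].
have NL : N `<=` `[0, L]%classic by move=> s [/TL].
have [||x0 x00 h] := @measure_shrink R A N L eta mA AL _ mN NL _ eta0.
- move=> x y xy s [Ts hs]; split => // -[_ hh]; apply: hs; split => //.
  by case: hh => hh; [left|right]; exact: le_trans hh.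
- by move=> s hs; split => //; have [] := hs 1 ltr01.
exists x0 => // x xx0; have := h x xx0; rewrite mN0 /= add0r => hA.
have WL : tall_set C L gamma theta0 c d x `<=` `[0, L]%classic by move=> s [/TL].
have := fine_measureU (mA x) (mW x) (AL x) WL.
have -> : A x `|` tall_set C L gamma theta0 c d x = touch_set c d.
  by rewrite setDKU// => s [].
by lra.
Qed.

Let E lambda theta := radial_energy C lambda^-1 theta.
Let window_energy lambda c d := \int[mu]_theta (\1_(`[c, d]%classic) theta * E lambda theta).
Let perim c d := fine (mu (touch_set c d)).

Let bbs_energy lambda (f : R -> R) c d : 0 < lambda -> measurable_fun setT f ->
  (forall x, `|f x| <= \1_(`[c, d]%classic) x) -> bbsR (fun x => f x * E lambda x).
Proof.
move=> l0 mf fb; have [M lip] := radial_energy_lipschitz bC aC (rho := lambda^-1) ltac:(by rewrite invr_gt0).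
apply: (bbs_dominated (K := E lambda c + `|M| * `|d - c|) (bbs_segment c d)).
  apply: measurable_funM => //; apply: continuous_measurable_fun.
  exact: lipschitz_fun_continuous lip.
move=> x; have := fb x; rewrite segE.
case: (boolP ((c <= x) && (x <= d))) => [/andP[cx xd] f1|_]; last first.
  by rewrite normr_le0 => /eqP ->; rewrite mul0r normr0 mulr0.
have xc : `|x - c| <= `|d - c|.
  by rewrite !ger0_norm ?subr_ge0 ?(le_trans cx)// lerD2r.
have h1 : M * `|x - c| <= `|M| * `|d - c|.
  apply: (@le_trans _ _ (`|M| * `|x - c|)); first by rewrite ler_wpM2r// ler_norm.
  by rewrite ler_wpM2l.
have h2 : E lambda x <= E lambda c + `|M| * `|d - c|.
  rewrite -lerBlDl; apply: le_trans h1; apply: le_trans (lip x c); exact: ler_norm.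
rewrite normrM normr1 mulr1 mulrC -[leRHS]mulr1 ler_pM//.
by rewrite (ger0_norm (radial_energy_ge0 C _ _)).
Qed.

Let bbs_seg_energy lambda c d : 0 < lambda ->
  bbsR (fun x => \1_(`[c, d]%classic) x * E lambda x).
Proof.
move=> l0; apply: (bbs_energy (c := c) (d := d) l0); first by have [] := bbs_segment c d.
by move=> x; rewrite ger0_norm// indicE.
Qed.

Let window_energyDpi lambda c d : 0 < lambda ->
  window_energy lambda (c + pi) (d + pi) = window_energy lambda c d.
Proof.
move=> l0; rewrite /window_energy -(Rint_shift pi (bbs_seg_energy _ _ l0)).
apply: eq_Rintegral => x _; rewrite !segE !lerD2r.
by rewrite /E (radial_energyDpi bC aC) ?invr_gt0.
Qed.

(** The width is the sum of the depths of an interior point below two opposite supporting lines. The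
    factor [2 ^ 17] is the one required by [radial_energy_ge]. *)
Let width_lower : exists2 lambda0, 0 < lambda0 & forall lambda theta, lambda <= lambda0 ->
  2 ^+ 17 * lambda <= - supp K (- uvec theta) - supp K (uvec theta).
Proof.
have [c [r [Kc r0 hr]]] := interior_depth bC.
have p0 : 0 < 2 ^+ 17 :> R by rewrite exprn_gt0.
exists (r / 2 ^+ 17); first exact: divr_gt0.
move=> lambda theta; rewrite ler_pdivlMr// mulrC => /le_trans; apply.
have := hr theta; have := hr (theta + pi); rewrite /depth uvecDpi -/K.
have -> : dot c (- uvec theta) = - dot c (uvec theta) by rewrite /dot /=; ring.
by clear p0; lra.
Qed.

(** [A] is meant to be absolute: the body and the interval act only on the choice of [lambda0]. The
    additive [eta] gives a content to the case where both portions vanish. *)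
Definition upper_estimate (A c d : R) := forall eta, 0 < eta ->
  exists2 lambda0, 0 < lambda0 & forall lambda, 0 < lambda -> lambda <= lambda0 ->
    window_energy lambda c d <=
    A * lambda ^+ 3 * (perim c d + perim (c + pi) (d + pi) + eta).

Definition lower_estimate (B c d : R) := forall eta, 0 < eta ->
  exists2 lambda0, 0 < lambda0 & forall lambda, 0 < lambda -> lambda <= lambda0 ->
    B * lambda ^+ 3 * (perim c d + perim (c + pi) (d + pi) - eta) <=
    window_energy lambda c d.

Lemma upper_window c d : c < d -> d - c <= 1 -> upper_estimate (16 * 2304) c d.
Proof.
move=> cd dc eta eta0; have cd' := ltW cd.
have [l1 l10 w1] := width_lower.
pose th := (c + d) / 2.
have win x : c <= x -> x <= d -> `|x - th| <= 2^-1.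
  by move=> h1 h2; rewrite ler_norml /th; apply/andP; split; lra.
have win' x : c + pi <= x -> x <= d + pi -> `|x - (th + pi)| <= 2^-1.
  move=> h1 h2; have -> : x - (th + pi) = x - pi - th by ring.
  by apply: win; lra.
have [l2 l20 up1] := cap_chord_upper bC aC cd' (win c (lexx _) cd') (win d cd' (lexx _)).
have cdp : c + pi <= d + pi by rewrite lerD2r.
have [l3 l30 up2] := cap_chord_upper bC aC cdp (win' _ (lexx _) cdp) (win' _ cdp (lexx _)).
have e2 : 0 < eta / 2 by rewrite divr_gt0.
have [l4 l40 n1] := near_set_limit cd' e2.
have [l5 l50 n2] := near_set_limit cdp e2.
exists (Num.min l1 (Num.min l2 (Num.min l3 (Num.min (l4 / 2) (l5 / 2))))).
  by rewrite !lt_min l10 l20 l30 !divr_gt0.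
move=> lambda l0; rewrite !le_min => /andP[a1 /andP[a2 /andP[a3 /andP[a4 a5]]]].
have b4 : 2 * lambda <= l4 by rewrite mulrC -ler_pdivlMr.
have b5 : 2 * lambda <= l5 by rewrite mulrC -ler_pdivlMr.
have [k1 [b1 k10 hk1 i1]] := up1 _ l0 a2.
have [k2 [b2 k20 hk2 i2]] := up2 _ l0 a3.
have m1 := n1 _ b4; have m2 := n2 _ b5.
have b12 := bbsD b1 (bbs_shift pi b2).
apply: (@le_trans _ _ (\int[mu]_x (16 * lambda ^+ 2 * (k1 x + k2 (x + pi))))).
  apply: (le_Rint norm1_fin (bbs_seg_energy c d l0) (bbsZ _ b12)) => x.
  rewrite segE; case: (boolP ((c <= x) && (x <= d))) => [/andP[cx xd]|_]; last first.
    by rewrite mul0r mulr_ge0 ?addr_ge0// mulr_ge0// sqr_ge0.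
  rewrite mul1r.
  have wl : 2 * lambda <= - supp K (- uvec x) - supp K (uvec x).
    apply: le_trans (w1 _ x a1); apply: ler_wpM2r; first exact: ltW.
    by rewrite exprS ler_peMr// exprn_ege1// ler1n.
  apply: (le_trans (radial_energy_le bC aC l0 wl)).
  apply: ler_wpM2l; first by rewrite mulr_ge0// sqr_ge0.
  by apply: lerD; [exact: hk1|apply: hk2; rewrite lerD2r].
rewrite (RintZ norm1_fin _ b12) (RintD norm1_fin b1 (bbs_shift pi b2)) (Rint_shift pi b2).
have h : \int[mu]_x k1 x + \int[mu]_x k2 x <=
    2304 * lambda * (perim c d + perim (c + pi) (d + pi) + eta).
  have l23 : 0 <= 2304 * lambda by apply: mulr_ge0; [exact: ler0n|exact: ltW].
  apply: le_trans (lerD (le_trans i1 (ler_wpM2l l23 m1)) (le_trans i2 (ler_wpM2l l23 m2))) _.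
  rewrite -mulrDr; apply: (ler_wpM2l l23).
  by rewrite addrACA -splitr; exact: lexx.
have -> : 16 * 2304 * lambda ^+ 3 * (perim c d + perim (c + pi) (d + pi) + eta) =
    16 * lambda ^+ 2 * (2304 * lambda * (perim c d + perim (c + pi) (d + pi) + eta)) by ring.
by apply: ler_wpM2l => //; rewrite mulr_ge0// sqr_ge0.
Qed.

Let half_lower c d eta : c < d -> d - c <= 1 -> 0 < eta ->
  exists2 lambda0, 0 < lambda0 & forall lambda, 0 < lambda -> lambda <= lambda0 ->
    lambda ^+ 3 * (perim c d - eta) <= 384 * 2 ^+ 28 * window_energy lambda c d.
Proof.
move=> cd dc eta0; have cd' := ltW cd.
have [l1 l10 w1] := width_lower.
have rg := @radial_energy_ge R C L gamma bC aC.
have Q0 : 0 < 2 ^+ 28 :> R by rewrite exprn_gt0.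
move: Q0 rg; move: (2 ^+ 28) => Q Q0 rg.
pose th := (c + d) / 2.
have win x : c <= x -> x <= d -> `|x - th| <= 2^-1.
  by move=> h1 h2; rewrite ler_norml /th; apply/andP; split; lra.
have cw := win c (lexx _) cd'; have dw := win d cd' (lexx _).
have [M [l2 [M0 l20 low]]] := cap_chord_lower bC aC cd' cw dw.
have e2 : 0 < eta / 2 by rewrite divr_gt0.
have [l3 l30 tl] := tall_set_limit cd cw dw e2.
have d4 : 0 < 4 * M + 1 by rewrite ltr_wpDl// mulr_ge0.
exists (Num.min l1 (Num.min l2 (Num.min l3 (eta / (4 * M + 1))))).
  by rewrite !lt_min l10 l20 l30 divr_gt0.
move=> lambda l0; rewrite !le_min => /andP[a1 /andP[a2 /andP[a3 a4]]].
have [k [bk hk kout ik]] := low _ l0 a2.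
have lt := tl _ a3.
have l2p : 0 <= lambda ^+ 2 by exact: sqr_ge0.
have bE := bbs_seg_energy c d l0.
have bs := bbs_segment c d.
have H : lambda ^+ 2 * \int[mu]_x k x <=
    192 * Q * window_energy lambda c d + M * lambda ^+ 4 * (d - c).
  rewrite -(RintZ norm1_fin _ bk) -(Rint_segment cd') -(RintZ norm1_fin _ bs).
  rewrite /window_energy -(RintZ norm1_fin _ bE) -(RintD norm1_fin (bbsZ _ bE) (bbsZ _ bs)).
  apply: (le_Rint norm1_fin (bbsZ _ bk) (bbsD (bbsZ _ bE) (bbsZ _ bs))) => x.
  rewrite !segE; case: (boolP ((c <= x) && (x <= d))) => [/andP[cx xd]|out]; last first.
    by rewrite (kout _ out) !mulr0 mul0r mulr0 addr0.
  rewrite mul1r mulr1.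
  have := rg lambda x l0 (w1 _ x a1); rewrite -/(E lambda x).
  have := ler_wpM2l l2p (hk x cx xd).
  have -> : lambda ^+ 2 * (192 * cap_chord C lambda x ^+ 2 + M * lambda ^+ 2) =
     192 * (lambda ^+ 2 * cap_chord C lambda x ^+ 2) + M * lambda ^+ 4 by ring.
  move: (E lambda x) (lambda ^+ 2 * cap_chord C lambda x ^+ 2) (lambda ^+ 2 * k x) => u v w h1 h2.
  apply: (le_trans h1); rewrite lerD2r -mulrA.
  by apply: ler_wpM2l h2; exact: ler0n.
have l3p : 0 < lambda ^+ 3 by rewrite exprn_gt0.
have H2 : lambda ^+ 2 * (lambda / 2 * (perim c d - eta / 2)) <= lambda ^+ 2 * \int[mu]_x k x.
  apply: ler_wpM2l => //; apply: le_trans ik; apply: ler_wpM2l => //.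
  by rewrite divr_ge0// ltW.
have H3 : M * lambda ^+ 4 * (d - c) <= lambda ^+ 3 * (eta / 4).
  have -> : M * lambda ^+ 4 * (d - c) = lambda ^+ 3 * (M * lambda * (d - c)) by ring.
  apply: ler_wpM2l; first exact: ltW.
  have h1 : M * lambda * (d - c) <= M * lambda * 1.
    by apply: ler_wpM2l => //; rewrite mulr_ge0// ltW.
  have h2 : lambda * (4 * M + 1) <= eta by rewrite -ler_pdivlMr.
  exact: quarter_bound h1 h2 l0.
have H4 := le_trans H2 H.
have -> : lambda ^+ 3 * (perim c d - eta) =
    2 * (lambda ^+ 2 * (lambda / 2 * (perim c d - eta / 2))) - 2 * (lambda ^+ 3 * (eta / 4)).
  by field.
have -> : 384 * Q * window_energy lambda c d = 2 * (192 * Q * window_energy lambda c d) by ring.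
rewrite -mulrBr ler_pM2l// lerBlDr.
by apply: (le_trans H4); rewrite lerD2l.
Qed.

(** [2 ^ 28] comes from [energy_ge]; 768 is twice the 384 of [half_lower], as the same energy has to
    bound both portions. *)
Definition lower_constant : R := (768 * 2 ^+ 28)^-1.

Let lower_constantV_gt0 : 0 < 768 * 2 ^+ 28 :> R.
Proof. by apply: mulr_gt0; [rewrite ltr0n|rewrite exprn_gt0]. Qed.

Lemma lower_constant_gt0 : 0 < lower_constant.
Proof. by rewrite invr_gt0; exact: lower_constantV_gt0. Qed.

Lemma lower_window c d : c < d -> d - c <= 1 -> lower_estimate lower_constant c d.
Proof.
move=> cd dc eta eta0; have e2 : 0 < eta / 2 by rewrite divr_gt0.
have [l1 l10 h1] := half_lower cd dc e2.
have cdp : c + pi < d + pi by rewrite ltrD2r.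
have [|l2 l20 h2] := half_lower cdp _ e2; first by lra.
exists (Num.min l1 l2); first by rewrite lt_min l10.
move=> lambda l0; rewrite le_min => /andP[a1 a2].
have H1 := h1 _ l0 a1; have H2 := h2 _ l0 a2; rewrite (window_energyDpi _ _ l0) in H2.
rewrite -mulrA /lower_constant (ler_pdivrMl _ _ lower_constantV_gt0).
have -> : 768 * 2 ^+ 28 * window_energy lambda c d =
  384 * 2 ^+ 28 * window_energy lambda c d + 384 * 2 ^+ 28 * window_energy lambda c d.
  by move: (2 ^+ 28) => Q; ring.
have -> : lambda ^+ 3 * (perim c d + perim (c + pi) (d + pi) - eta) =
  lambda ^+ 3 * (perim c d - eta / 2) + lambda ^+ 3 * (perim (c + pi) (d + pi) - eta / 2).
  by field.
exact: lerD.
Qed.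

Let touch_setU c m d : c <= m -> m <= d -> touch_set c d = touch_set c m `|` touch_set m d.
Proof.
move=> cm md; apply/seteqP; split => s.
  move=> [s0 [t /andP[ct td] dt]]; have [tm|mt] := leP t m.
    by left; split => //; exists t => //; rewrite ct.
  by right; split => //; exists t => //; rewrite (ltW mt).
move=> [[s0 [t /andP[ct td] dt]]|[s0 [t /andP[ct td] dt]]]; split => //; exists t => //.
  by rewrite ct (le_trans td).
by rewrite td (le_trans cm).
Qed.

Let perimU c m d : c <= m -> m <= d ->
  [/\ perim c m <= perim c d, perim m d <= perim c d & perim c d <= perim c m + perim m d].
Proof.
move=> cm md; have cd := le_trans cm md.
have m1 := measurable_touch_set bC aC cm; have m2 := measurable_touch_set bC aC md.
have m3 := measurable_touch_set bC aC cd.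
have L1 := @touch_set_segment c m; have L2 := @touch_set_segment m d.
have L3 := @touch_set_segment c d.
split.
- by apply: (fine_measure_le m1 m3 _ L3); rewrite (touch_setU cm md); exact: subsetUl.
- by apply: (fine_measure_le m2 m3 _ L3); rewrite (touch_setU cm md); exact: subsetUr.
- by rewrite /perim (touch_setU cm md); exact: (fine_measureU m1 m2 L1 L2).
Qed.

Let window_energy_cat lambda c m d : 0 < lambda -> c <= m -> m <= d ->
  window_energy lambda c d = window_energy lambda c m + window_energy lambda m d.
Proof.
move=> l0 cm md.
have bo : bbsR (fun x => \1_(`]m, d]%classic) x * E lambda x).
  apply: (bbs_energy (c := m) (d := d) l0); first by have [] := bbs_oc m d.
  move=> x; rewrite ocE segE normr_nat ler_nat.
  by case: (leP m x) => [_|xm]; [case: (x <= d); rewrite ?andbF// andbT leq_b1|rewrite ltNge (ltW xm)].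
have -> : window_energy lambda m d = \int[mu]_x (\1_(`]m, d]%classic) x * E lambda x).
  rewrite /window_energy -Rintegral_indic// -[RHS]Rintegral_indic//.
  apply/esym; apply: Rintegral_itv_obnd_cbnd.
  have bi := bbs_integrable norm1_fin (bbs_seg_energy m d l0).
  apply: eq_integrable (integrableS _ _ _ bi) => //= x.
  rewrite inE/= in_itv/= => /andP[mx xd]; by rewrite segE (ltW mx) xd mul1r.
rewrite -(RintD norm1_fin (bbs_seg_energy c m l0) bo); apply: eq_Rintegral => x _.
rewrite -mulrDl !segE ocE; congr (_ * _).
case: (leP x m) => xm; rewrite ?andbT ?andbF /=.
  by rewrite addr0 (le_trans xm md) andbT.
by rewrite add0r (ltW (le_lt_trans cm xm)).
Qed.

(** The constants add because an edge with normal [m] is counted in both portions: each portion is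
    compared separately with that of the union. *)
Lemma upper_cat A A' c m d : 0 <= A -> 0 <= A' -> c <= m -> m <= d ->
  upper_estimate A c m -> upper_estimate A' m d -> upper_estimate (A + A') c d.
Proof.
move=> A0 A'0 cm md h1 h2 eta eta0.
have [l1 l10 {}h1] := h1 eta eta0; have [l2 l20 {}h2] := h2 eta eta0.
exists (Num.min l1 l2); first by rewrite lt_min l10.
move=> lambda l0; rewrite le_min => /andP[a1 a2].
rewrite (window_energy_cat l0 cm md) !mulrDl.
have [p1 p2 _] := perimU cm md.
have [q1 q2 _] := @perimU (c + pi) (m + pi) (d + pi) ltac:(lra) ltac:(lra).
have l3 : 0 <= lambda ^+ 3 by rewrite exprn_ge0// ltW.
apply: lerD.
  apply: (le_trans (h1 _ l0 a1)); rewrite -mulrA -[leRHS]mulrA; apply: ler_wpM2l => //.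
  by apply: ler_wpM2l => //; lra.
apply: (le_trans (h2 _ l0 a2)); rewrite -mulrA -[leRHS]mulrA; apply: ler_wpM2l => //.
by apply: ler_wpM2l => //; lra.
Qed.

(** Subadditivity of the portion goes in the favourable direction here, and the constant is kept. *)
Lemma lower_cat B c m d : 0 <= B -> c <= m -> m <= d ->
  lower_estimate B c m -> lower_estimate B m d -> lower_estimate B c d.
Proof.
move=> B0 cm md h1 h2 eta eta0; have e2 : 0 < eta / 2 by rewrite divr_gt0.
have [l1 l10 {}h1] := h1 _ e2; have [l2 l20 {}h2] := h2 _ e2.
exists (Num.min l1 l2); first by rewrite lt_min l10.
move=> lambda l0; rewrite le_min => /andP[a1 a2].
rewrite (window_energy_cat l0 cm md).
have [_ _ p3] := perimU cm md.
have [_ _ q3] := @perimU (c + pi) (m + pi) (d + pi) ltac:(lra) ltac:(lra).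
have l3 : 0 <= B * lambda ^+ 3 by rewrite mulr_ge0// exprn_ge0// ltW.
apply: le_trans (lerD (h1 _ l0 a1) (h2 _ l0 a2)); rewrite -mulrDr.
by apply: ler_wpM2l => //; lra.
Qed.

(** After [n] halvings the pieces are windows of length at most 1; each halving doubles the upper
    constant only. *)
Lemma estimates n c d : c < d -> d - c <= 2 ^+ n ->
  upper_estimate (16 * 2304 * 2 ^+ n) c d /\ lower_estimate lower_constant c d.
Proof.
elim: n c d => [|n IH] c d cd; first by rewrite expr0 mulr1 => dc; split; [exact: upper_window|exact: lower_window].
rewrite exprS => dc; pose m := (c + d) / 2.
have cm : c < m by rewrite /m; lra.
have md : m < d by rewrite /m; lra.
have [|u1 w1] := IH c m cm; first by rewrite /m; lra.
have [|u2 w2] := IH m d md; first by rewrite /m; lra.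
split; last exact: lower_cat (ltW lower_constant_gt0) (ltW cm) (ltW md) w1 w2.
have A0 : 0 <= 16 * 2304 * 2 ^+ n :> R by apply: mulr_ge0; [apply: mulr_ge0; exact: ler0n|exact: exprn_ge0].
have := upper_cat A0 A0 (ltW cm) (ltW md) u1 u2.
by congr upper_estimate; ring.
Qed.

End windows.

(** * Conclusion *)

Section conclusion.
Context {R : realType}.
Notation mu := (@lebesgue_measure R).

Lemma perimeter_portion_touch (C : set (R * R)) L gamma (a b : R) : convex_body C ->
  perimeter_portion C L gamma `[a, b]%classic = fine (mu (touch_set C L gamma a b)).
Proof.
move=> bC; rewrite /perimeter_portion; congr (fine (mu _)).
apply/seteqP; split => s [s0].
  move=> [t [nt]]; rewrite /= in_itv/= => tI; split => //; exists t => //.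
  by rewrite /depth (supp_closure _ bC) -nt subrr.
move=> [t tI dt]; split => //; exists t; split; last by rewrite /= in_itv.
by move: dt; rewrite /depth (supp_closure _ bC) => /eqP; rewrite subr_eq0 => /eqP /esym.
Qed.

Lemma translate_segment (a b t : R) :
  [set x + t | x in `[a, b]%classic] = `[a + t, b + t]%classic.
Proof.
apply/seteqP; split => [_ [x + <-]|x]; rewrite /= !in_itv/=; first by rewrite !lerD2r.
by exists (x - t); rewrite ?subrK//= in_itv/= lerBrDr lerBlDr.
Qed.

Lemma asymp_le_near (c rho0 : R) (f g : R -> R) :
  (forall rho, rho0 < rho -> f rho / g rho <= c) -> asymp_le_with c f g.
Proof.
move=> h; rewrite /asymp_le_with limf_esupE.
apply: (@le_trans _ _ (ereal_sup ((fun x => (f x / g x)%:E) @` [set x | rho0 < x]))).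
  apply: ereal_inf_lbound; exists [set x | rho0 < x] => //.
  by exists rho0; split => //; exact: num_real.
by apply: ub_ereal_sup => _ [x /= x0 <-]; rewrite lee_fin; exact: h.
Qed.

Lemma fourier_average_window (C : set (R * R)) (a b rho : R) :
  fourier_average C `[a, b]%classic rho =
  \int[mu]_theta (\1_(`[a, b]%classic) theta * radial_energy C (rho^-1)^-1 theta).
Proof. by rewrite invrK /fourier_average Rintegral_indic. Qed.

End conclusion.

Theorem lemma3p5 (R : realType) :
  exists2 c : R, 0 < c &
    forall (C : set (R * R)) (L : R) (gamma : R -> R * R) (alpha beta : R),
      convex_body C -> arc_length_param C L gamma ->
      alpha < beta -> beta <= alpha + 2 * pi ->
      let I := `[alpha, beta]%classic in
      let p := perimeter_portion C L gamma I
             + perimeter_portion C L gamma [set theta + pi | theta in I] in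
      (p != 0 ->
         asymp_with c (fourier_average C I) (fun rho => rho ^- 3 * p)) /\
      (p = 0 ->
         rho ^+ 3 * fourier_average C I rho @[rho --> +oo] --> (0 : R)).
Proof.
(* Three halvings suffice, since [2 * pi <= 2 ^ 3]. *)
pose A : R := 16 * 2304 * 2 ^+ 3; pose B := @lower_constant R.
have A0 : 0 < A by apply: mulr_gt0; [apply: mulr_gt0; rewrite ltr0n|rewrite exprn_gt0].
have B0 : 0 < B by exact: lower_constant_gt0.
have est (C : set (R * R)) L gamma (alpha beta : R) : convex_body C -> arc_length_param C L gamma ->
    alpha < beta -> beta <= alpha + 2 * pi ->
    upper_estimate C L gamma A alpha beta /\ lower_estimate C L gamma B alpha beta.
  move=> bC aC ab ba; apply: estimates => //.
  have p4 : pi <= 4 :> R by have := pihalf_lt2 R; lra.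
  by rewrite !exprS expr0 mulr1; lra.
move: A A0 B B0 est => A A0 B B0 est.
(* The term [2 * A] serves the upper bound with [eta = p], the term [2 / B] the lower bound with
   [eta = p / 2]. *)
exists (2 * A + 2 / B); first by rewrite addr_gt0// mulr_gt0// invr_gt0.
move=> C L gamma alpha beta bC aC ab ba I p.
have [up low] := est C L gamma alpha beta bC aC ab ba.
have pE : p = fine (lebesgue_measure (touch_set C L gamma alpha beta)) +
   fine (lebesgue_measure (touch_set C L gamma (alpha + pi) (beta + pi))).
  by rewrite /p /I translate_segment !perimeter_portion_touch.
have p0 : 0 <= p by rewrite pE addr_ge0// fine_ge0.
pose F rho := fourier_average C I rho.
have bound (P : R -> Prop) : (exists2 l0, 0 < l0 & forall l, 0 < l -> l <= l0 -> P l) ->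
    exists2 rho0, 0 < rho0 & forall rho, rho0 < rho -> P rho^-1.
  move=> [l0 l00 h]; exists l0^-1; first by rewrite invr_gt0.
  move=> rho hr; have r0 : 0 < rho by apply: lt_trans hr; rewrite invr_gt0.
  apply: h; first by rewrite invr_gt0.
  by rewrite -[leRHS]invrK lef_pV2 ?posrE ?invr_gt0// ltW.
have {}up eta : 0 < eta -> exists2 rho0, 0 < rho0 & forall rho, rho0 < rho ->
    F rho <= A * rho ^- 3 * (p + eta).
  move=> eta0; have [r0 r00 h] := bound _ (up eta eta0); exists r0 => // rho hr.
  by rewrite /F fourier_average_window pE -exprVn; exact: h.
have {}low eta : 0 < eta -> exists2 rho0, 0 < rho0 & forall rho, rho0 < rho ->
    B * rho ^- 3 * (p - eta) <= F rho.
  move=> eta0; have [r0 r00 h] := bound _ (low eta eta0); exists r0 => // rho hr.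
  by rewrite /F fourier_average_window pE -exprVn; exact: h.
split=> [pn|pz].
  have pp : 0 < p by rewrite lt_neqAle eq_sym pn.
  have [r1 r10 h1] := up p pp.
  have [r2 r20 h2] := low (p / 2) ltac:(by rewrite divr_gt0).
  split.
    apply: (@asymp_le_near _ _ r1) => rho hr.
    have q0 : 0 < rho ^- 3 by rewrite invr_gt0 exprn_gt0// (lt_trans r10).
    rewrite ler_pdivrMr ?mulr_gt0//; apply: (le_trans (h1 rho hr)).
    have B2 : 0 < 2 / B by rewrite divr_gt0.
    have -> : A * rho ^- 3 * (p + p) = 2 * A * (rho ^- 3 * p) by ring.
    by apply: ler_wpM2r; [rewrite mulr_ge0// ltW|rewrite lerDl ltW].
  apply: (@asymp_le_near _ _ r2) => rho hr.
  have q0 : 0 < rho ^- 3 by rewrite invr_gt0 exprn_gt0// (lt_trans r20).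
  have h := h2 rho hr.
  have Bp : B * rho ^- 3 * (p - p / 2) = (B / 2) * (rho ^- 3 * p) by field; rewrite gt_eqF ?(lt_trans r20).
  have F0 : 0 < F rho by apply: lt_le_trans h; rewrite Bp !mulr_gt0// invr_gt0.
  rewrite ler_pdivrMr//.
  have k : 2 / B * (B / 2) = 1 by field; rewrite gt_eqF.
  have -> : rho ^- 3 * p = 2 / B * ((B / 2) * (rho ^- 3 * p)) by rewrite mulrA k mul1r.
  apply: (@le_trans _ _ (2 / B * F rho)).
    by apply: ler_wpM2l; [rewrite divr_ge0// ltW|rewrite -Bp].
  by apply: ler_wpM2r; [exact: ltW|rewrite lerDr mulr_ge0// ltW].
have F0 rho : 0 <= F rho.
  by apply: Rintegral_ge0 => t _; apply: Rintegral_ge0 => d _; exact: sqr_ge0.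
apply/cvgrPdist_le => e e0.
(* With [p = 0] the upper estimate reduces to its error term, here exactly [e] after multiplication
   by [rho ^+ 3]. *)
have [r r0 h] := up (e / A) ltac:(by rewrite divr_gt0).
exists r; split; first exact: num_real.
move=> rho hr /=; have rp : 0 < rho by exact: lt_trans hr.
have r3 : 0 < rho ^+ 3 by rewrite exprn_gt0.
rewrite sub0r normrN ger0_norm; last by rewrite mulr_ge0 ?F0// ltW.
have := ler_wpM2l (ltW r3) (h rho hr); rewrite pz add0r.
by have -> : rho ^+ 3 * (A * rho ^- 3 * (e / A)) = e by field; rewrite !gt_eqF.
Qed.
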